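(* Let $1\le i\le N-1$, $\nu\in\mathrm{SYD}(N,n)$ and let $x=(\nu^{(1)},\dots,\nu^{(N)}=\nu)\in\mathrm{SSSYT}(\nu,N)$ be of type 2, i.e. (a) the last row of the skew tableau $\nu^{(i+1)}-\nu^{(i-1)}$ contains at least two free cells containing $i+1$ and fewer than two cells containing $i$; (b) the first two columns of $\nu^{(i+1)}$ contain exactly $i+1$ cells. Then $\tau_i(x)$ is obtained from $x$ as follows (entries outside $\nu^{(i+1)}-\nu^{(i-1)}$ unchanged): every row of $\nu^{(i+1)}-\nu^{(i-1)}$ other than the last is transformed as under the Bender–Knuth involution $\tau_i^{bk}$; in the last row, the first cell (which is free) changes its entry from $i$ to $i+1$ or from $i+1$ to $i$ if the number of free cells in the last row is odd, and the last row is otherwise unchanged.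
   Context: Crystals. Let $\mathfrak g$ be a complex semisimple Lie algebra with index set $I$ of simple roots $\alpha_i$, simple coroots $\alpha_i^\vee$, weight lattice $P$ and dominant weights $P_+$. A (normal) crystal is a set $B$ with maps $\mathrm{wt}:B\to P$, $\tilde e_i,\tilde f_i:B\to B\sqcup\{0\}$ with $\tilde e_i b=b'\iff\tilde f_ib'=b$, $\mathrm{wt}(\tilde e_ib)=\mathrm{wt}(b)+\alpha_i$, $\varepsilon_i(b)=\max\{k:\tilde e_i^kb\ne0\}$, $\varphi_i(b)=\max\{k:\tilde f_i^kb\ne0\}$, $\varphi_i-\varepsilon_i=\langle\mathrm{wt},\alpha_i^\vee\rangle$; we work with crystals whose connected components are isomorphic to Kashiwara crystals $B_\lambda$ of irreducible $U_q(\mathfrak g)$-modules $V_\lambda$, $\lambda\in P_+$. Tensor product: $\mathrm{wt}(b\otimes b')=\mathrm{wt}\,b+\mathrm{wt}\,b'$, $\tilde e_i(b\otimes b')=b\otimes\tilde e_ib'$ if $\varepsilon_i(b')>\varphi_i(b)$, else $\tilde e_ib\otimes b'$; $\tilde f_i(b\otimes b')=b\otimes\tilde f_ib'$ if $\varepsilon_i(b')\ge\varphi_i(b)$, else $\tilde f_ib\otimes b'$. Highest weight element: $\tilde e_ib=0$ for all $i$. Commutor and cactus action. $\xi_A$ is the Schützenberger involution (on each component $B_\lambda$ the unique map sending the highest to the lowest weight element with $\xi\tilde f_i=\tilde e_{\theta(i)}\xi$, $\xi\tilde e_i=\tilde f_{\theta(i)}\xi$, $w_0\alpha_i=-\alpha_{\theta(i)}$);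 the Henriques–Kamnitzer commutor is $\sigma_{A,B}(a\otimes b)=\xi_{B\otimes A}(\xi_B(b)\otimes\xi_A(a))$. On $B^{\otimes N}$ let $\sigma_{p,r,q}=1\otimes\sigma_{B^{\otimes(r-p+1)},B^{\otimes(q-r)}}\otimes1$ (acting on factors $p,\dots,q$), $s_{p,p+1}=\sigma_{p,p,p+1}$, $s_{p,q}=\sigma_{p,p,q}\circ s_{p+1,q}$. The Bender–Knuth generators of the cactus group act by $T_1=s_{1,2}$, $T_2=s_{1,2}\circ s_{1,3}\circ s_{1,2}$, $T_i=s_{1,i}\circ s_{1,i+1}\circ s_{1,i}\circ s_{1,i-1}$ ($i>2$). Spinor crystal. Type $D_n$, weights $(\lambda_1,\dots,\lambda_n)$ in an orthonormal basis, $\alpha_j=\epsilon_j-\epsilon_{j+1}$ ($j<n$), $\alpha_n=\epsilon_{n-1}+\epsilon_n$, $P_+=\{\lambda_j\in\frac12\mathbb Z,\lambda_j-\lambda_k\in\mathbb Z,\lambda_1\ge\dots\ge\lambda_n,\lambda_{n-1}+\lambda_n\ge0\}$. $B_S$ = sign vectors $(i_1,\dots,i_n)$, weight $\frac12\sum i_j\epsilon_j$; for $j<n$, $\tilde f_j$ turns $(i_j,i_{j+1})=(+,-)$ into $(-,+)$ (else $0$), $\tilde e_j$ the reverse; $\tilde f_n$ turns $(i_{n-1},i_n)=(+,+)$ into $(-,-)$ (else $0$), $\tilde e_n$ the reverse. $P[S]=\{(\pm\frac12,\dots,\pm\frac12)\}$, $b_\mu$ the element of weight $\mu$. $T^N$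 = tuples $(\mu_1,\dots,\mu_N)\in P[S]^N$ with all partial sums in $P_+$, $T^N_\lambda$ those with total sum $\lambda$; the highest weight elements of $B_S^{\otimes N}$ of weight $\lambda$ are exactly $b_{\mu_1}\otimes\cdots\otimes b_{\mu_N}$, $(\mu_k)\in T^N_\lambda$. Short tableaux. $\mathrm{SYD}(k,n)$: Young diagrams with at most $n$ columns, first two columns of total length $\le k$. $\mathrm{SSSYT}(\nu,N)$: sequences $(\nu^{(1)},\dots,\nu^{(N)}=\nu)$, $\nu^{(k)}\in\mathrm{SYD}(k,n)$, $\nu^{(k)}\subset\nu^{(k+1)}$, $\nu^{(k+1)}\setminus\nu^{(k)}$ a horizontal strip; viewed as a semistandard tableau with entry $k$ in $\nu^{(k)}\setminus\nu^{(k-1)}$. To $(\mu_k)\in T^N$ attach $\nu^{(k)}$: for $\gamma=\mu_1+\dots+\mu_k$, $l_j=k/2-\gamma_j$, $r_j=k/2+\gamma_j$, $\nu^{(k)}$ has column lengths $(l_n,\dots,l_1)$ ($n$ even) or $(r_n,l_{n-1},\dots,l_1)$ ($n$ odd); this is a bijection $T^N_\lambda\to\mathrm{SSSYT}(\nu,N)$. Define $\tau_i(x)$: if $x\leftrightarrow(\mu_k)$ and $T_i(b_{\mu_1}\otimes\cdots\otimes b_{\mu_N})=b_{\mu'_1}\otimes\cdots\otimes b_{\mu'_N}$ (in $B_S^{\otimes N}$), then $\tau_i(x)\leftrightarrow(\mu'_k)$. Free cells and Bender–Knuth: in the skew tableau of entries $i,i+1$ a cell is free if no other of its cells lies in the same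 column; Bender–Knuth rule on a row with $b$ free $i$'s followed by $c$ free $i+1$'s: replace by $c$ free $i$'s followed by $b$ free $i+1$'s, non-free cells unchanged. ''Last row'' = lowest row containing cells of $\nu^{(i+1)}-\nu^{(i-1)}$. *)

(* Defs.v *)
From mathcomp Require Import all_boot all_algebra.
Set Implicit Arguments. Unset Strict Implicit. Unset Printing Implicit Defensive.
Import GRing.Theory Num.Theory.

(* number of successful iterations of a partial map, capped by [fuel]:
   equals max{k : g^k x <> 0} as soon as fuel is at least that value *)
Fixpoint count_iter {T} (g : T -> option T) (fuel : nat) (x : T) : nat :=
  match fuel with
  | 0 => 0
  | m.+1 => if g x is Some y then (count_iter g m y).+1 else 0
  end.

Section Spinor.
Variable n : nat.

(* An element of B_S is a sign vector (i_1,...,i_n), stored as a list of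
   booleans of length n (true = +).  Crystal indices are 0-based:
   index j (j < n) stands for the simple root alpha_{j+1}. *)
Definition tens := seq (seq bool).

Definition f1 (j : nat) (s : seq bool) : option (seq bool) :=
  if j.+1 < n then
    (if nth false s j && ~~ nth false s j.+1
     then Some (set_nth false (set_nth false s j false) j.+1 true) else None)
  else if j.+1 == n then
    (if nth false s (n-2) && nth false s (n-1)
     then Some (set_nth false (set_nth false s (n-2) false) (n-1) false) else None)
  else None.

Definition e1 (j : nat) (s : seq bool) : option (seq bool) :=
  if j.+1 < n then
    (if ~~ nth false s j && nth false s j.+1
     then Some (set_nth false (set_nth false s j true) j.+1 false) else None)
  else if j.+1 == n then
    (if ~~ nth false s (n-2) && ~~ nth false s (n-1)
     then Some (set_nth false (set_nth false s (n-2) true) (n-1) true) else None)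
  else None.

Definition phi1 j (s : seq bool) := count_iter (f1 j) (size s).+1 s.

(* crystal operators (e, f) on tensors b_1 (x) ... (x) b_k of k factors,
   with the tensor product rule of the paper, b (x) b' where b is the
   first factor and b' the tensor of the remaining ones. *)
Fixpoint ef (k : nat) : (nat -> tens -> option tens) * (nat -> tens -> option tens) :=
  match k with
  | 0 => (fun _ _ => None, fun _ _ => None)
  | k'.+1 =>
    let E := (ef k').1 in let F := (ef k').2 in
    (fun j b => match b with
       | [::] => None
       | x :: xs => if phi1 j x < count_iter (E j) k'.+1 xs
                    then omap (cons x) (E j xs)
                    else omap (fun y => y :: xs) (e1 j x)
       end,
     fun j b => match b with
       | [::] => None
       | x :: xs => if phi1 j x <= count_iter (E j) k'.+1 xs
                    then omap (cons x) (F j xs)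
                    else omap (fun y => y :: xs) (f1 j x)
       end)
  end.

Definition eT j (b : tens) := (ef (size b)).1 j b.
Definition fT j (b : tens) := (ef (size b)).2 j b.

(* theta: w0 alpha_j = - alpha_theta(j); for D_n, theta = id if n even,
   and theta swaps alpha_{n-1}, alpha_n if n odd (0-based: n-2, n-1). *)
Definition theta (j : nat) : nat :=
  if odd n then (if j == n-2 then n-1 else if j == n-1 then n-2 else j) else j.

Fixpoint first_app (g : nat -> option tens) (js : seq nat) : option (nat * tens) :=
  match js with
  | [::] => None
  | j :: js' => if g j is Some y then Some (j, y) else first_app g js'
  end.

(* raise b to the highest weight element u of its component, recording
   the indices: b = f_{j1} f_{j2} ... f_{jr} u *)
Fixpoint raise (fuel : nat) (b : tens) : seq nat * tens :=
  match fuel with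
  | 0 => ([::], b)
  | m.+1 => if first_app (fun j => eT j b) (iota 0 n) is Some (j, b')
            then let: (p, u) := raise m b' in (j :: p, u)
            else ([::], b)
  end.

Fixpoint lower (fuel : nat) (b : tens) : tens :=
  match fuel with
  | 0 => b
  | m.+1 => if first_app (fun j => fT j b) (iota 0 n) is Some (_, b')
            then lower m b' else b
  end.

(* bound on the length of any raising/lowering chain (height w.r.t. rho) *)
Definition bound (b : tens) := (size b * n * n).+1.

(* Schuetzenberger involution on B_S^{(x) k}:
   xi (f_{j1} ... f_{jr} u) = e_{theta j1} ... e_{theta jr} (lowest element). *)
Definition xi (b : tens) : tens :=
  let: (p, u) := raise (bound b) b in
  odflt b (foldr (fun j acc => obind (eT (theta j)) acc)
                 (Some (lower (bound b) u)) p).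

Definition sigmaAB (m : nat) (l : tens) : tens :=
  xi (xi (drop m l) ++ xi (take m l)).

(* sigma_{p,r,q} acting on factors p..q (1-based) *)
Definition sigma_prq (p r q : nat) (l : tens) : tens :=
  take p.-1 l ++ sigmaAB (r - p + 1) (take (q - p + 1) (drop p.-1 l)) ++ drop q l.

Fixpoint s_aux (d p q : nat) (l : tens) : tens :=
  match d with
  | 0 => l
  | d'.+1 => sigma_prq p p q (s_aux d' p.+1 q l)
  end.

Definition s_pq (p q : nat) (l : tens) : tens := s_aux (q - p) p q l.

Definition T (i : nat) (l : tens) : tens :=
  if i == 1 then s_pq 1 2 l
  else if i == 2 then s_pq 1 2 (s_pq 1 3 (s_pq 1 2 l))
  else s_pq 1 i (s_pq 1 i.+1 (s_pq 1 i (s_pq 1 i.-1 l))).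

(* doubled partial sum 2*gamma_j (0-based j) of the first k factors *)
Definition nplus (pre : tens) (j : nat) := count (fun s => nth false s j) pre.
Definition nminus (pre : tens) (j : nat) := count (fun s => ~~ nth false s j) pre.
Definition g2 (pre : tens) (j : nat) : int := (nplus pre j)%:Z - (nminus pre j)%:Z.

(* gamma in P_+ (half-integrality and integral differences are automatic) *)
Definition dominant (pre : tens) : bool :=
  [forall j : 'I_n, (j.+1 < n) ==> (g2 pre j.+1 <= g2 pre j)%R]
  && (0 <= g2 pre (n-2) + g2 pre (n-1))%R.

Definition inT (b : tens) : bool :=
  all (fun k => dominant (take k b)) (iota 1 (size b)).

(* nu^(k): column lengths (left to right, n columns).
   l_j = k/2 - gamma_j = #minus signs in coordinate j among the first k
   factors, r_j = k/2 + gamma_j = #plus signs.  Columns: (l_n,...,l_1) for n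
   even, (r_n,l_{n-1},...,l_1) for n odd (1-based j). *)
Definition diag (pre : tens) : seq nat :=
  [seq (if odd n && (c == 1) then nplus pre (n-1) else nminus pre (n - c))
  | c <- iota 1 n].

Definition chain (b : tens) : seq (seq nat) :=
  [seq diag (take k b) | k <- iota 1 (size b)].

(* Young diagrams given by their n column lengths *)
Definition SYD (k : nat) (d : seq nat) : bool :=
  [&& size d == n, sorted geq d & nth 0 d 0 + nth 0 d 1 <= k].

Definition hstrip (d d' : seq nat) : bool :=
  all (fun c => (nth 0 d c <= nth 0 d' c) && (nth 0 d' c <= (nth 0 d c).+1))
      (iota 0 n).

Definition SSSYT (nu : seq nat) (N : nat) (x : seq (seq nat)) : bool :=
  [&& size x == N, last (nseq n 0) x == nu,
      all (fun k => SYD k (nth [::] x k.-1)) (iota 1 N)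
    & all (fun k => hstrip (nth (nseq n 0) (nseq n 0 :: x) k)
                            (nth (nseq n 0) (nseq n 0 :: x) k.+1))
          (iota 0 N)].

End Spinor.

(* --- tableau combinatorics on x = (nu^(1),...,nu^(N)) ---
   cells (r, c), 1-based row r (from the top) and column c *)
Definition col (d : seq nat) (c : nat) := nth 0 d c.-1.

(* entry of cell (r,c): the k with (r,c) in nu^(k) \ nu^(k-1); 0 if outside *)
Definition entry (x : seq (seq nat)) (r c : nat) : nat :=
  head 0 [seq k <- iota 1 (size x) | r <= col (nth [::] x k.-1) c].

Section Tab.
Variables (n i : nat) (x : seq (seq nat)).
Let N := size x.

Definition inS (r c : nat) : bool :=
  [&& 0 < r, 0 < c <= n & (entry x r c == i) || (entry x r c == i.+1)].

Definition free (r c : nat) : bool :=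
  inS r c && all (fun r' => (r' == r) || ~~ inS r' c) (iota 1 N).

Definition lastrow : nat :=
  foldr maxn 0 [seq r <- iota 1 N | has (inS r) (iota 1 n)].

Definition freecells (r : nat) : seq nat := [seq c <- iota 1 n | free r c].

(* Bender-Knuth on row r: b free i's then c free (i+1)'s become
   c free i's then b free (i+1)'s *)
Definition bk_entry (r c : nat) : nat :=
  if index c (freecells r) < count (fun c' => entry x r c' == i.+1) (freecells r)
  then i else i.+1.

Definition firstcell (r : nat) : nat := head 0 [seq c <- iota 1 n | inS r c].

Definition toggle (e : nat) : nat := if e == i then i.+1 else i.

Definition newentry (r c : nat) : nat :=
  if ~~ inS r c then entry x r c
  else if r != lastrow then (if free r c then bk_entry r c else entry x r c)
  else if (c == firstcell r) && odd (size (freecells r)) then toggle (entry x r c)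
  else entry x r c.

Definition type2 : bool :=
  [&& 2 <= count (fun c => entry x lastrow c == i.+1) (freecells lastrow),
      count (fun c => inS lastrow c && (entry x lastrow c == i)) (iota 1 n) < 2
    & col (nth [::] x i) 1 + col (nth [::] x i) 2 == i.+1].

End Tab.

(* Main.v *)
Require Import Defs.
From mathcomp Require Import all_boot all_order all_algebra zify.

(* The tensor powers of the spinor crystal satisfy Stembridge's local axioms
   for simply laced crystals.  Hence every connected component has a unique
   highest weight element and is determined by its weight, so the
   Schuetzenberger involution [xi] is well defined.  As [xi] is an involution,
   [s_{1,q}] is [xi] composed with the factorwise involution in reverse order
   ([eta]); on highest weight elements it takes the highest weight element of
   the component of [eta b].  Chasing [b = a (x) y (x) y' (x) ...] through the
   four factors of [T_i] shows that the first [i] factors of [T_i b] are the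
   highest weight element of the component of [a' (x) y'], for some [a'] in
   the component of [a] and some letter [v] such that [v (x) a' (x) y'] has
   highest weight.  Raising [a'] while lowering [v] by the same nodes shows
   that it is also the component of [a (x) y'].  So the new [i]-th factor is
   obtained from the old [(i+1)]-st by the simple reflections fixing the
   weight of [a]: inside each block of columns of equal length the cells move
   to the left, which is the Bender-Knuth rule; for a tableau of type 2 the
   block of the last row contains the first two columns, and there pairs of
   cells cancel as well, which leaves only the parity. *)

Set Implicit Arguments. Unset Strict Implicit. Unset Printing Implicit Defensive.
Import Order.TTheory GRing.Theory Num.Theory.

(** The operators are given factor by factor, and [xi] raises along one greedy path, so independence
    of the path has to be proved for tensors themselves. The local axioms do not pass from the tail
    of a tensor to the whole in terms of [ep] and [fp] alone: whether [e_i] raises [ep j] is further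
    information about the tail. For instance the zero weight elements of the two ten-dimensional
    crystals of type A_2 have all string lengths equal to 1 and differ in this respect. The integer
    [tt] carries the information and has a recursion of its own, which opens the axioms to induction
    on the number of factors; letters are minuscule, so only few kinds of letters occur for two
    adjacent nodes. Type 2 enters through the weight of the first [i - 1] factors: it forces the
    first two columns of the diagram before [i] to be equally long and to have [i - 1] cells
    together. Hence that weight is fixed both by the reflection exchanging the two columns and by
    the one that removes a pair of cells from them. Weights are doubled to stay integral. *)

Section Letters.
Variable n : nat.
Hypothesis n2 : 2 <= n.
Implicit Types (i j k : nat) (s : seq bool).

(** * Letters of the spinor crystal and the nodes of type D_n *)

Definition pos j := if j.+1 < n then j else n - 2.
(* [lhi j s - llo j s] is the pairing of the weight of [s] with the coroot of
   node [j]; [eb] and [pb] are the values of [epsilon_j] and [phi_j] on [s]. *)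
Definition lhi j s := nth false s (pos j).
Definition llo j s := nth false s (pos j).+1 (+) (j.+1 == n).
Definition eb j s := ~~ lhi j s && llo j s.
Definition pb j s := lhi j s && ~~ llo j s.
(** Raising and lowering at [j] change the same two signs, so one involution serves both operators;
    [eb] and [pb] tell which of them is defined. *)
Definition flip j s :=
  mkseq (fun k => nth false s k (+) ((k == pos j) || (k == (pos j).+1))) n.

(** The Dynkin diagram of type D_n, 0-based: a chain on the nodes up to [n - 2], with the last node
    [n - 1] attached to [n - 3]. *)
Definition adj i j :=
  [|| (i.+1 == j) && (j.+1 < n), (j.+1 == i) && (i.+1 < n),
      (i.+2 == j) && (j.+1 == n) | (j.+2 == i) && (i.+1 == n)].

Lemma adjC i j : adj i j = adj j i.
Proof. by clear n2; rewrite /adj; lia. Qed.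

Lemma ebpbF j s : eb j s -> pb j s = false.
Proof. by rewrite /eb /pb; case: (lhi j s); case: (llo j s). Qed.

Lemma pbebF j s : pb j s -> eb j s = false.
Proof. by rewrite /eb /pb; case: (lhi j s); case: (llo j s). Qed.

Lemma size_flip j s : size (flip j s) = n.
Proof. by rewrite size_mkseq. Qed.

Lemma nth_flip j s k : size s = n ->
  nth false (flip j s) k =
  nth false s k (+) ((k < n) && ((k == pos j) || (k == (pos j).+1))).
Proof.
move=> sn; rewrite /flip; case: (ltnP k n) => kn; first by rewrite nth_mkseq.
by rewrite nth_default ?size_mkseq // nth_default ?sn.
Qed.

Lemma flipK j s : size s = n -> flip j (flip j s) = s.
Proof.
move=> sn; apply: (@eq_from_nth _ false); rewrite ?size_flip ?sn // => k kn.
by rewrite !nth_flip ?size_flip // -addbA addbb addbF.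
Qed.

Lemma flipC i j s : size s = n -> flip i (flip j s) = flip j (flip i s).
Proof.
move=> sn; apply: (@eq_from_nth _ false); rewrite ?size_flip // => k kn.
by rewrite !nth_flip ?size_flip // addbAC.
Qed.

Lemma e1E j s : j < n -> size s = n ->
  e1 n j s = if eb j s then Some (flip j s) else None.
Proof.
move=> jn sn; rewrite /e1 /eb /lhi /llo /pos.
case: (ltnP j.+1 n) => [j1|j1].
  have ->: (j.+1 == n) = false by lia.
  rewrite addbF; case: ifP => //= /andP[h1 h2]; congr Some.
  apply: (@eq_from_nth _ false); first by rewrite size_flip !size_set_nth sn; lia.
  move=> k _; rewrite nth_flip // /pos j1 nth_set_nth /=.
  case: eqP => [->|ne1] /=; first by rewrite h2 j1 orbT.
  rewrite nth_set_nth /=; case: eqP => [->|ne2] /=; first by rewrite (negPf h1); lia.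
  by rewrite andbF addbF.
have jF : (j.+1 < n) = false by lia.
have ->: j.+1 == n by lia.
rewrite addbT; have ->: (n - 2).+1 = n - 1 by lia.
case: ifP => //= /andP[h1 h2]; congr Some.
apply: (@eq_from_nth _ false); first by rewrite size_flip !size_set_nth sn; lia.
move=> k _; rewrite nth_flip // /pos jF nth_set_nth /=.
have ->: (n - 2).+1 = n - 1 by lia.
case: eqP => [->|ne1] /=; first by rewrite (negPf h2); lia.
rewrite nth_set_nth /=; case: eqP => [->|ne2] /=; first by rewrite (negPf h1); lia.
by rewrite andbF addbF.
Qed.

Lemma f1E j s : j < n -> size s = n ->
  f1 n j s = if pb j s then Some (flip j s) else None.
Proof.
move=> jn sn; rewrite /f1 /pb /lhi /llo /pos.
case: (ltnP j.+1 n) => [j1|j1].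
  have ->: (j.+1 == n) = false by lia.
  rewrite addbF; case: ifP => //= /andP[h1 h2]; congr Some.
  apply: (@eq_from_nth _ false); first by rewrite size_flip !size_set_nth sn; lia.
  move=> k _; rewrite nth_flip // /pos j1 nth_set_nth /=.
  case: eqP => [->|ne1] /=; first by rewrite (negPf h2); lia.
  rewrite nth_set_nth /=; case: eqP => [->|ne2] /=; first by rewrite h1; lia.
  by rewrite andbF addbF.
have jF : (j.+1 < n) = false by lia.
have ->: j.+1 == n by lia.
rewrite addbT negbK; have ->: (n - 2).+1 = n - 1 by lia.
case: ifP => //= /andP[h1 h2]; congr Some.
apply: (@eq_from_nth _ false); first by rewrite size_flip !size_set_nth sn; lia.
move=> k _; rewrite nth_flip // /pos jF nth_set_nth /=.
have ->: (n - 2).+1 = n - 1 by lia.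
case: eqP => [->|ne1] /=; first by rewrite h2; lia.
rewrite nth_set_nth /=; case: eqP => [->|ne2] /=; first by rewrite h1; lia.
by rewrite andbF addbF.
Qed.

Lemma pos_lt j : j < n -> (pos j).+1 < n.
Proof. rewrite /pos; case: ifP; lia. Qed.

Lemma lhi_flip j s : j < n -> size s = n -> lhi j (flip j s) = ~~ lhi j s.
Proof.
move=> jn sn; rewrite /lhi nth_flip // eqxx /=.
by have := pos_lt jn; case: (ltnP (pos j) n) => h; [rewrite addbT|lia].
Qed.

Lemma llo_flip j s : j < n -> size s = n -> llo j (flip j s) = ~~ llo j s.
Proof.
move=> jn sn; rewrite /llo nth_flip // eqxx orbT andbT pos_lt //.
by rewrite addbT addNb.
Qed.

Lemma eb_flip j s : j < n -> size s = n -> eb j (flip j s) = pb j s.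
Proof. by move=> jn sn; rewrite /eb /pb lhi_flip // llo_flip // negbK. Qed.

Lemma pb_flip j s : j < n -> size s = n -> pb j (flip j s) = eb j s.
Proof. by move=> jn sn; rewrite /eb /pb lhi_flip // llo_flip // negbK. Qed.

Lemma phi1E j s : j < n -> size s = n -> phi1 n j s = pb j s.
Proof.
move=> jn sn; rewrite /phi1 /= f1E //; case: ifP => // h.
have: 0 < size s by rewrite sn; lia.
by case: (size s) => // m _ /=; rewrite f1E ?size_flip // pb_flip // (pbebF h).
Qed.

Ltac decide_nat := repeat match goal with
  | |- context [(?a < ?b)%N] =>
      first [replace (a < b)%N with true by lia | replace (a < b)%N with false by lia]
  | |- context [(?a == ?b :> nat)] =>
      first [replace (a == b :> nat) with true by lia | replace (a == b :> nat) with false by lia]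
  end.
Ltac case_nth := repeat match goal with
  | |- context [nth false ?s ?k] => case: (nth false s k)
  end.

(** The pairings of a letter with coroots are -1, 0 or 1, and raising at [i] lowers the pairing at
    an adjacent [j] by one: it was 0 or 1 and becomes -1 or 0. *)
Lemma flip_adj i j s : i < n -> j < n -> size s = n -> adj i j -> eb i s ->
  [/\ eb j s = false, eb j (flip i s) = ~~ pb j s & pb j (flip i s) = false].
Proof.
move=> ni nj sn aij; rewrite /eb /pb /lhi /llo !nth_flip // /pos.
case/or4P: aij => /andP[/eqP h1 h2].
- subst j; decide_nat; case_nth => //.
- subst i; decide_nat; case_nth => //.
- subst j; have -> : n - 2 = i.+1 by lia. decide_nat; case_nth => //.
- subst i; have -> : n - 2 = j.+1 by lia. decide_nat; case_nth => //.
Qed.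

Lemma flip_orth i j s : i < n -> j < n -> size s = n -> i != j -> ~~ adj i j ->
  eb i s -> (eb j (flip i s) = eb j s) * (pb j (flip i s) = pb j s).
Proof.
move=> ni nj sn ij aij; rewrite /eb /pb /lhi /llo !nth_flip // /pos.
have {aij} h : (i.+1 < j /\ ~~ ((i.+2 == j) && (j.+1 == n))) \/
  (j.+1 < i /\ ~~ ((j.+2 == i) && (i.+1 == n))) \/ (i.+1 = j /\ j.+1 = n) \/ (j.+1 = i /\ i.+1 = n).
  rewrite /adj in aij; lia.
case: h => [[h1 h2]|[[h1 h2]|[[h1 h2]|[h1 h2]]]].
- case: (ltnP j.+1 n) => hj.
    decide_nat; case_nth => //.
  decide_nat; case_nth => //.
- case: (ltnP i.+1 n) => hj.
    decide_nat; case_nth => //.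
  decide_nat; case_nth => //.
- subst j; have -> : n - 2 = i by lia. decide_nat; case_nth => //.
- subst i; have -> : n - 2 = j by lia. decide_nat; case_nth => //.
Qed.
End Letters.

(** * Tensors: string lengths, crystal operators, orthogonal nodes *)

Section Tensors.
Variable n : nat.
Hypothesis n2 : 2 <= n.
Implicit Types (i j k : nat) (s : seq bool) (b c d : tens).

Definition wf b := all (fun s => size s == n) b.

(** The tensor product rule for epsilon and phi, with truncated subtraction in place of maxima; as
    [eb] and [pb] are never both 1, the truncation in [ep] only concerns the tail. *)
Fixpoint ep j b := if b is s :: b' then eb n j s + ep j b' - pb n j s else 0.
Fixpoint fp j b := if b is s :: b' then fp j b' + (pb n j s - ep j b') else 0.

Fixpoint eM j b : option tens :=
  if b is s :: b' then
    if pb n j s < ep j b' then omap (cons s) (eM j b')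
    else if eb n j s then Some (flip n j s :: b') else None
  else None.

Fixpoint fM j b : option tens :=
  if b is s :: b' then
    if pb n j s <= ep j b' then omap (cons s) (fM j b')
    else if pb n j s then Some (flip n j s :: b') else None
  else None.

Lemma wf_cat b c : wf (b ++ c) = wf b && wf c. Proof. exact: all_cat. Qed.

Lemma eM_wf j b c : wf b -> eM j b = Some c -> wf c.
Proof.
elim: b c => // s b IH c /= /andP[ss wb]; case: ifP => h.
  by case E: (eM j b) => [d|] //= -[<-] /=; rewrite ss (IH d).
by case: ifP => // _ [<-] /=; rewrite size_flip eqxx.
Qed.

Lemma fM_wf j b c : wf b -> fM j b = Some c -> wf c.
Proof.
elim: b c => // s b IH c /= /andP[ss wb]; case: ifP => h.
  by case E: (fM j b) => [d|] //= -[<-] /=; rewrite ss (IH d).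
by case: ifP => // _ [<-] /=; rewrite size_flip eqxx.
Qed.

Lemma eM_size j b c : eM j b = Some c -> size c = size b.
Proof.
elim: b c => // s b IH c /=; case: ifP => h.
  by case E: (eM j b) => [d|] //= -[<-] /=; rewrite (IH d).
by case: ifP => // _ [<-].
Qed.

Lemma fM_size j b c : fM j b = Some c -> size c = size b.
Proof.
elim: b c => // s b IH c /=; case: ifP => h.
  by case E: (fM j b) => [d|] //= -[<-] /=; rewrite (IH d).
by case: ifP => // _ [<-].
Qed.

Lemma eM_ep j b c : j < n -> wf b -> eM j b = Some c -> ep j b = (ep j c).+1.
Proof.
move=> jn; elim: b c => // s b IH c /= /andP[/eqP ss wb]; case: ifP => h.
  case E: (eM j b) => [d|] //= -[<-] /=.
  have := IH d wb E; have := @ebpbF n j s; case: eb => /=; case: pb h => //; lia.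
case: ifP => // es [<-] /=; rewrite eb_flip // pb_flip // es (ebpbF es) in h *; lia.
Qed.

Lemma eM_epN j b : eM j b = None -> ep j b = 0.
Proof.
elim: b => // s b IH /=; case: ifP => h.
  by case E: (eM j b) => [d|] //= _; rewrite IH // in h.
case: ifP => // es _; lia.
Qed.

Lemma fM_fp j b c : j < n -> wf b -> fM j b = Some c -> fp j b = (fp j c).+1 /\ ep j c = (ep j b).+1.
Proof.
move=> jn; elim: b c => // s b IH c /= /andP[/eqP ss wb]; case: ifP => h.
  case E: (fM j b) => [d|] //= -[<-] /=.
  have := IH d wb E; have := @ebpbF n j s; case: eb => /=; case: pb h => //; lia.
case: ifP => // es [<-] /=; rewrite eb_flip // pb_flip // es (pbebF es) in h *; lia.
Qed.

Lemma fM_fpN j b : fM j b = None -> fp j b = 0.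
Proof.
elim: b => // s b IH /=; case: ifP => h.
  case E: (fM j b) => [d|] //= _; rewrite IH //; lia.
case: ifP => // es _; lia.
Qed.

Lemma eMK j b c : j < n -> wf b -> eM j b = Some c -> fM j c = Some b.
Proof.
move=> jn; elim: b c => // s b IH c /= /andP[/eqP ss wb]; case: ifP => h.
  case E: (eM j b) => [d|] //= -[<-] /=.
  by rewrite (IH d) //; have := eM_ep jn wb E; case: ifP => //=; lia.
case: ifP => // es [<-] /=; rewrite pb_flip // es flipK //.
by move: h; rewrite (ebpbF es) => h; case: ifP => //; lia.
Qed.

Lemma fMK j b c : j < n -> wf b -> fM j b = Some c -> eM j c = Some b.
Proof.
move=> jn; elim: b c => // s b IH c /= /andP[/eqP ss wb]; case: ifP => h.
  case E: (fM j b) => [d|] //= -[<-] /=.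
  by rewrite (IH d) //; have := fM_fp jn wb E; case: ifP => //=; lia.
case: ifP => // es [<-] /=; rewrite eb_flip // pb_flip // es flipK //.
by move: h; rewrite (pbebF es) => h; case: ifP => //; lia.
Qed.

Lemma ep_size j b : ep j b <= size b.
Proof. elim: b => //= s b; case: eb => /=; lia. Qed.

Lemma count_iter_ep g j m b : j < n -> wf b -> ep j b <= m ->
  (forall c, size c = size b -> wf c -> g c = eM j c) -> count_iter g m b = ep j b.
Proof.
move=> jn; elim: m b => [|m IH] b wb hm hg /=; first by case: (ep j b) hm.
rewrite hg //; case E: (eM j b) => [c|]; last by rewrite eM_epN.
have h := eM_ep jn wb E; rewrite h IH ?(eM_wf wb E) //; first lia.
by move=> d sd wd; apply: hg => //; rewrite sd (eM_size E).
Qed.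

Lemma ef_cons j m s b :
  let E := (ef n m).1 j in
  ((ef n m.+1).1 j (s :: b) = if phi1 n j s < count_iter E m.+1 b
     then omap (cons s) (E b) else omap (cons^~ b) (e1 n j s)) *
  ((ef n m.+1).2 j (s :: b) = if phi1 n j s <= count_iter E m.+1 b
     then omap (cons s) ((ef n m).2 j b) else omap (cons^~ b) (f1 n j s)).
Proof. by []. Qed.

(** The fuel in [ef] exceeds every string length, because [ep] is at most the number of factors; so
    the counted iterations are the true epsilon of the tail. *)
Lemma efE j m b : j < n -> wf b -> size b = m ->
  ((ef n m).1 j b = eM j b) * ((ef n m).2 j b = fM j b).
Proof.
move=> jn; elim: m b => [|m IH] [|s b] // /andP[/eqP ss wb] [sb].
have hc : count_iter ((ef n m).1 j) m.+1 b = ep j b.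
  apply: count_iter_ep => //; first by have := ep_size j b; lia.
  by move=> c sc wc; rewrite IH // sc.
rewrite !ef_cons hc !IH // phi1E // (e1E n2) // (f1E n2) //=.
by case: eb; case: pb.
Qed.

Lemma eTE j b : j < n -> wf b -> eT n j b = eM j b.
Proof. by move=> jn wb; rewrite /eT (efE jn wb). Qed.

Lemma fTE j b : j < n -> wf b -> fT n j b = fM j b.
Proof. by move=> jn wb; rewrite /fT (efE jn wb). Qed.

(* The weight is encoded by [fp i - ep i]; [adj i j] is minus the Cartan entry. *)
Lemma eM_wt i j b c : i < n -> j < n -> i != j -> wf b -> eM i b = Some c ->
  fp j c + ep j b + adj n i j = fp j b + ep j c.
Proof.
move=> ni nj ij; elim: b c => // s b IH c /= /andP[/eqP ss wb]; case: ifP => h.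
  case E: (eM i b) => [d|] //= -[<-] /=.
  have := IH d wb E; have := @ebpbF n j s; case: eb => /=; case: pb => //; lia.
case: ifP => // es [<-] /=.
case: (boolP (adj n i j)) => aij; last by rewrite !(flip_orth n2 ni nj ss ij aij es); lia.
by have [-> -> ->] := flip_adj n2 ni nj ss aij es; case: pb => /=; lia.
Qed.

Lemma eM_orth i j b c : i < n -> j < n -> i != j -> ~~ adj n i j -> wf b ->
  eM i b = Some c -> ep j c = ep j b.
Proof.
move=> ni nj ij aij; elim: b c => // s b IH c /= /andP[/eqP ss wb]; case: ifP => h.
  by case E: (eM i b) => [d|] //= -[<-] /=; rewrite (IH d).
by case: ifP => // es [<-] /=; rewrite !(flip_orth n2 ni nj ss ij aij es).
Qed.

Lemma sq_orth i j b c d : i < n -> j < n -> i != j -> ~~ adj n i j -> wf b ->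
  eM i b = Some c -> eM j b = Some d -> eM j c = eM i d.
Proof.
move=> ni nj ij aij; elim: b c d => // s b IH c d /= /andP[/eqP ss wb].
have ji : j != i by rewrite eq_sym.
have aji : ~~ adj n j i by rewrite adjC.
case: ifP => hi.
  case E: (eM i b) => [c'|] //= -[<-]; case: ifP => hj.
    case F: (eM j b) => [d'|] //= -[<-] /=.
    by rewrite (eM_orth ni nj ij aij wb E) (eM_orth nj ni ji aji wb F) hi hj (IH c' d').
  case: ifP => // es -[<-] /=.
  by rewrite (eM_orth ni nj ij aij wb E) hj es (flip_orth n2 nj ni ss ji aji es) hi E.
case: ifP => // es -[<-]; case: ifP => hj.
  case F: (eM j b) => [d'|] //= -[<-] /=.
  by rewrite (eM_orth nj ni ji aji wb F) hi es (flip_orth n2 ni nj ss ij aij es) hj F.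
case: ifP => // es' -[<-] /=.
rewrite !(flip_orth n2 ni nj ss ij aij es) !(flip_orth n2 nj ni ss ji aji es') hi hj.
by rewrite es es' flipC.
Qed.

Lemma eM_cons j s b : eM j (s :: b) =
  if pb n j s < ep j b then omap (cons s) (eM j b)
  else if eb n j s then Some (flip n j s :: b) else None.
Proof. by []. Qed.

Lemma fM_cons j s b : fM j (s :: b) =
  if pb n j s <= ep j b then omap (cons s) (fM j b)
  else if pb n j s then Some (flip n j s :: b) else None.
Proof. by []. Qed.
End Tensors.
Arguments eM : simpl never.
Arguments fM : simpl never.

Ltac clear_atoms := repeat match goal with
  | H : is_true (wf _ _) |- _ => clear H
  | H : is_true (adj _ _ _) |- _ => clear H
  | H : is_true (pb _ _ _) |- _ => clear H
  | H : is_true (eb _ _ _) |- _ => clear H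
  | H : pb _ _ _ = _ |- _ => clear H
  | H : eb _ _ _ = _ |- _ => clear H
  | H : _ = Some _ |- _ => clear H
  end.
Ltac if_true := match goal with
  | |- context [if ?c then _ else _] => have -> : c = true by clear_atoms; lia
  end.
Ltac if_false := match goal with
  | |- context [if ?c then _ else _] => have -> : c = false by clear_atoms; lia
  end.

(** * Adjacent nodes: the hidden integer and the square relation *)

Section AdjacentPairs.
Variable n : nat.
Hypothesis n2 : 2 <= n.
Implicit Types (i j k : nat) (s : seq bool) (b c d : tens).
Local Notation ep := (ep n).
Local Notation fp := (fp n).
Local Notation eM := (eM n).
Local Notation fM := (fM n).
Local Notation wf := (wf n).
Local Notation eb := (eb n).
Local Notation pb := (pb n).
Local Notation flip := (flip n).

(* On a component of type A_2 for the adjacent nodes [i] and [j], [tt i j b] is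
   the number of [f_j] minus the number of [f_i] leading from the highest weight
   element to [b]; its sign tells whether [e_i] raises [ep j]. *)
Fixpoint tt i j b : int :=
  if b is s :: b' then
    let t := tt i j b' in let x := ep i b' in let y := ep j b' in
    (if pb i s then
       if eb j s then t + 1 - ((- t < x%:Z) && (0 < x)%N)%:Z
       else t + ((0 < x)%N && (x%:Z + t == 0) || (x == 0%N) && (t < y%:Z))%:Z
     else if pb j s then
       if eb i s then t - 1 + ((t < y%:Z) && (0 < y)%N)%:Z
       else t - ((0 < y)%N && (y%:Z - t == 0) || (y == 0%N) && (- t < x%:Z))%:Z
     else t)%R
  else 0%R.

Lemma pb_adj i j s : i < n -> j < n -> size s = n -> adj n i j ->
  pb i s -> pb j s = false.
Proof.
move=> ni nj sn aij hp; have := flip_adj (i := i) (j := j) n2 ni nj _ aij (s := flip i s).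
rewrite eb_flip // hp flipK // size_flip => /(_ erefl isT) [_ _ ->] //.
Qed.

Lemma tt_anti i j b : i < n -> j < n -> wf b -> adj n i j -> tt j i b = (- tt i j b)%R.
Proof.
move=> ni nj wb aij; elim: b wb => //= s b IH /andP[/eqP ss wb].
rewrite IH //; have := pb_adj ni nj ss aij.
have := @flip_adj n n2 i j s ni nj ss aij.
have := @ebpbF n i s; have := @ebpbF n j s.
case: (pb i s); case: (pb j s); case: (eb i s); case: (eb j s) => //= h1 h2 h3 h4;
  try (by case: (h3 isT)); try (by move=> *; split; lia); try lia; by [have := h1 isT | have := h2 isT| have := h4 isT].
Qed.

(** At an element that neither node raises, the first two bounds force [tt] to vanish; this anchors
    the integer at highest weight elements. *)
Lemma tt_bound i j b : i < n -> j < n -> wf b -> adj n i j ->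
  [/\ 0 <= (ep i b)%:Z + tt i j b, 0 <= (ep j b)%:Z - tt i j b,
      0 <= (fp i b)%:Z - tt i j b & 0 <= (fp j b)%:Z + tt i j b]%R.
Proof.
move=> ni nj wb aij; elim: b wb => //= s b IH /andP[/eqP ss wb].
have [] := IH wb; have := pb_adj ni nj ss aij.
have := @flip_adj n n2 i j s ni nj ss aij.
have := @ebpbF n i s; have := @ebpbF n j s.
case: (pb i s); case: (pb j s); case: (eb i s); case: (eb j s) => //= h1 h2 h3 h4;
  try (by case: (h3 isT)); try (by move=> *; split; lia); try lia; by [have := h1 isT | have := h2 isT| have := h4 isT].
Qed.

(** If the operator acts on the tail, the bounds on [tt] before and after the step decide the
    truncated subtractions; if it acts on the letter, [flip_adj] describes the new letter. *)
Lemma eM_tt i j b c : i < n -> j < n -> adj n i j -> wf b -> eM i b = Some c ->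
  tt i j c = (tt i j b + 1)%R /\ ep j c = ep j b + (0 <= tt i j b)%R.
Proof.
move=> ni nj aij; elim: b c => // s b IH c /andP[/eqP ss wb]; rewrite eM_cons /=.
have hp := pb_adj ni nj ss aij.
have hf := @flip_adj n n2 i j s ni nj ss aij.
have hi := @ebpbF n i s. have hj := @ebpbF n j s.
have [b1 b2 b3 b4] := tt_bound ni nj wb aij.
case: ifP => h.
  case E: (eM i b) => [d|] //= -[<-] /=.
  have [hd1 hd2] := IH d wb E; have h3 := eM_ep n2 ni wb E.
  have [d1 d2 d3 d4] := tt_bound ni nj (eM_wf wb E) aij.
  move: hp hf hi hj h.
  case: (pb i s); case: (pb j s); case: (eb i s); case: (eb j s) => //= h1 h2 h4 h5;
  try (by case: (h2 isT)); try (by move=> *; split; lia); try lia; by [have := h1 isT | have := h4 isT| have := h5 isT].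
case: ifP => // es [<-] /=.
have [e1 e2 e3] := hf es.
rewrite eb_flip // pb_flip // es e1 e2 e3 (hi es) /=.
case: (pb j s) => /=; lia.
Qed.

Definition square i j b := forall c d, eM i b = Some c -> eM j b = Some d ->
  tt i j b != 0%R -> eM j c = eM i d.

(** Stembridge's relation of degree four, [e_i e_j^2 e_i = e_j e_i^2 e_j]; its two paths bound an
    eight-cycle of the crystal graph. *)
Definition octagon i j b := forall c d, eM i b = Some c -> eM j b = Some d ->
  tt i j b = 0%R ->
  obind (eM i) (obind (eM j) (eM j c)) = obind (eM j) (obind (eM i) (eM i d)).

Lemma square_sym i j b : i < n -> j < n -> adj n i j -> wf b -> square i j b -> square j i b.
Proof.
move=> ni nj aij wb sq c d ec ed; rewrite (tt_anti ni nj wb aij) oppr_eq0 => h.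
by rewrite (sq d c).
Qed.

Lemma octagon_sym i j b : i < n -> j < n -> adj n i j -> wf b -> octagon i j b -> octagon j i b.
Proof.
move=> ni nj aij wb sq c d ec ed; rewrite (tt_anti ni nj wb aij) => h.
by rewrite (sq d c) //; lia.
Qed.

Lemma eM_pair i j b c d : i < n -> j < n -> adj n i j -> wf b ->
    eM i b = Some c -> eM j b = Some d ->
  [/\ wf c, wf d, tt i j c = (tt i j b + 1)%R & tt i j d = (tt i j b - 1)%R] /\
  [/\ ep i b = (ep i c).+1, ep j c = ep j b + (0 <= tt i j b)%R,
      ep j b = (ep j d).+1 & ep i d = ep i b + (tt i j b <= 0)%R].
Proof.
move=> ni nj aij wb ec ed; have aji : adj n j i by rewrite adjC.
have [h1 h2] := eM_tt ni nj aij wb ec; have [h3 h4] := eM_tt nj ni aji wb ed.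
have wd := eM_wf wb ed.
rewrite (tt_anti ni nj wd aij) (tt_anti ni nj wb aij) in h3 h4.
have h5 := eM_ep n2 ni wb ec; have h6 := eM_ep n2 nj wb ed; have wc := eM_wf wb ec.
by split; split => //; lia.
Qed.

Lemma eM_some j b : 0 < ep j b -> exists c, eM j b = Some c.
Proof. by case E: (eM j b) => [c|]; [exists c | rewrite eM_epN]. Qed.

Lemma eM_cons0 j s b : j < n -> wf b -> pb j s = false -> eb j s = false ->
  eM j (s :: b) = omap (cons s) (eM j b).
Proof.
move=> nj wb; rewrite eM_cons => -> ->; case: ifP => // h.
by case E: (eM j b) => [c|] //; rewrite (eM_ep n2 nj wb E) in h.
Qed.

Lemma eM_consp j s b : pb j s -> eM j (s :: b) = if 1 < ep j b then omap (cons s) (eM j b) else None.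
Proof. by move=> h; rewrite eM_cons h pbebF. Qed.

Lemma eM_conse j s b : eb j s ->
  eM j (s :: b) = if 0 < ep j b then omap (cons s) (eM j b) else Some (flip j s :: b).
Proof. by move=> h; rewrite eM_cons h ebpbF. Qed.

(** For two adjacent nodes a letter belongs to a trivial crystal of type A_2 or to one of the two
    with three elements, which are exchanged by swapping [i] and [j]. So four kinds of letters
    remain: trivial (0), top (1), middle (2) and bottom (3). *)
Lemma square_cons0 i j s b : i < n -> j < n -> wf b ->
  pb i s = false -> pb j s = false -> eb i s = false ->
  eb j s = false -> square i j b -> square i j (s :: b).
Proof.
move=> ni nj wb h1 h2 h3 h4 sq c d; rewrite !eM_cons0 //.
case E: (eM i b) => [x|] //= -[<-]; case F: (eM j b) => [y|] //= -[<-].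
by rewrite !eM_cons0 ?(eM_wf wb E) ?(eM_wf wb F) // h1 h2 => /(sq _ _ E F) ->.
Qed.

Lemma octagon_cons0 i j s b : i < n -> j < n -> wf b ->
  pb i s = false -> pb j s = false -> eb i s = false ->
  eb j s = false -> octagon i j b -> octagon i j (s :: b).
Proof.
move=> ni nj wb h1 h2 h3 h4 sq c d; rewrite !eM_cons0 //.
have hh k o : k < n -> pb k s = false -> eb k s = false -> (forall x, o = Some x -> wf x) ->
    obind (eM k) (omap (cons s) o) = omap (cons s) (obind (eM k) o).
  by move=> nk hp he; case: o => //= x /(_ x erefl) wx; rewrite eM_cons0.
have ww k o : (forall x, o = Some x -> wf x) -> forall x, obind (eM k) o = Some x -> wf x.
  by case: o => //= x /(_ x erefl) wx y; apply: eM_wf.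
case E: (eM i b) => [x|] //= -[<-]; case F: (eM j b) => [y|] //= -[<-].
have wx := eM_wf wb E; have wy := eM_wf wb F.
rewrite !eM_cons0 // h1 h2 => /(sq _ _ E F) e.
by rewrite !hh ?e //; try apply: ww; move=> ?; apply: eM_wf.
Qed.

Lemma square_cons1 i j s b : i < n -> j < n -> adj n i j -> wf b ->
  pb i s -> pb j s = false -> eb j s = false -> square i j b -> square i j (s :: b).
Proof.
move=> ni nj aij wb h1 h2 h4 sq c d; rewrite eM_consp // [eM j _]eM_cons0 //.
case: ifP => // hi; case E: (eM i b) => [x|] //= -[<-]; case F: (eM j b) => [y|] //= -[<-].
rewrite h1 h4; have [[wx wy t1 t2] [x1 x2 x3 x4]] := eM_pair ni nj aij wb E F.
move=> ht; rewrite eM_cons0 // eM_consp //.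
by rewrite (sq _ _ E F); [if_true | lia].
Qed.

Lemma square_cons2 i j s b : i < n -> j < n -> adj n i j -> wf b -> size s = n ->
  eb i s -> pb j s -> square i j b -> square i j (s :: b).
Proof.
move=> ni nj aij wb ss h1 h2 sq c d; rewrite eM_conse // [eM j _]eM_consp //=.
rewrite (ebpbF h1) h2 h1; case: ifP => hi; case: ifP => // hj.
  case E: (eM i b) => [x|] //= -[<-]; case F: (eM j b) => [y|] //= -[<-].
  have [[wx wy t1 t2] [x1 x2 x3 x4]] := eM_pair ni nj aij wb E F.
  move=> ht; rewrite eM_consp // eM_conse // (sq _ _ E F); last lia.
  by do 2 if_true.
move=> -[<-]; case F: (eM j b) => [y|] //= -[<-] ht.
have [e1 e2 e3] := flip_adj n2 ni nj ss aij h1.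
rewrite h2 in e2; rewrite eM_cons0 // F eM_conse //.
have [t2 x4] := eM_tt nj ni (etrans (adjC n j i) aij) wb F.
have [? ? ? ?] := tt_bound ni nj wb aij.
rewrite (tt_anti ni nj wb aij) in t2 x4.
by if_false.
Qed.

Lemma square_cons3 i j s b : i < n -> j < n -> adj n i j -> wf b -> size s = n ->
  eb i s = false -> pb i s = false -> eb j s -> square i j b -> square i j (s :: b).
Proof.
move=> ni nj aij wb ss h1 h2 h3 sq c d; rewrite eM_cons0 // eM_conse //=.
rewrite h2 (ebpbF h3); case E: (eM i b) => [x|] //= -[<-]; case: ifP => hj.
  case F: (eM j b) => [y|] //= -[<-].
  have [[wx wy t1 t2] [x1 x2 x3 x4]] := eM_pair ni nj aij wb E F.
  move=> ht; rewrite eM_conse // eM_cons0 // (sq _ _ E F) //.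
  by if_true.
move=> -[<-] ht.
have [e1 e2 e3] := flip_adj n2 nj ni ss (etrans (adjC n j i) aij) h3.
have [t1 x2] := eM_tt ni nj aij wb E.
have [? ? ? ?] := tt_bound ni nj wb aij.
rewrite h2 in e2; rewrite !eM_conse // E.
by have := eM_ep n2 ni wb E; move=> ?; if_false; if_true.
Qed.

Lemma eM_step i j b : i < n -> j < n -> adj n i j -> wf b -> 0 < ep i b ->
  exists c, [/\ eM i b = Some c, wf c, tt i j c = (tt i j b + 1)%R,
    ep i b = (ep i c).+1 & ep j c = ep j b + (0 <= tt i j b)%R].
Proof.
move=> ni nj aij wb /eM_some[c ec]; exists c; have [h1 h2] := eM_tt ni nj aij wb ec.
by split; rewrite ?(eM_wf wb ec) ?(eM_ep n2 ni wb ec).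
Qed.

(** By [eM_tt] the integer takes the values 0, 1, 0, -1, 0 along the path, and each sign keeps the
    string length needed for the next step positive. *)
Lemma octagon_path i j b : i < n -> j < n -> adj n i j -> wf b ->
    tt i j b = 0%R -> 0 < ep i b -> 0 < ep j b ->
  exists c c1 c2 c3,
  [/\ eM i b = Some c, eM j c = Some c1, eM j c1 = Some c2 & eM i c2 = Some c3] /\
  [/\ wf c, wf c1, wf c2 & wf c3] /\
  [/\ ep i b = (ep i c).+1, ep i b = (ep i c1).+1 & ep i c2 = ep i b] /\
  [/\ ep j c = (ep j b).+1, ep j c1 = ep j b, (ep j c2).+1 = ep j b & ep j c3 = ep j c2] /\
  [/\ tt i j c = 1%R & tt i j c1 = 0%R].
Proof.
move=> ni nj aij wb t0 pi pj; have aji : adj n j i by rewrite adjC.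
have tn d (wd : wf d) := tt_anti ni nj wd aij.
have [c [ec wc tc ic jc]] := eM_step ni nj aij wb pi.
have [|c1 [ec1 wc1 tc1 jc1 ic1]] := eM_step nj ni aji wc; first by clear_atoms; lia.
have [|c2 [ec2 wc2 tc2 jc2 ic2]] := eM_step nj ni aji wc1; first by clear_atoms; lia.
rewrite !tn // in tc1 ic1 tc2 ic2.
have [|c3 [ec3 wc3 tc3 ic3 jc3]] := eM_step ni nj aij wc2; first by clear_atoms; lia.
exists c, c1, c2, c3; repeat split => //; clear_atoms; lia.
Qed.

End AdjacentPairs.

(** * The octagon relation for adjacent nodes *)

Section Octagon.
Variable n : nat.
Hypothesis n2 : 2 <= n.
Implicit Types (i j k : nat) (s : seq bool) (b c d : tens).
Local Notation ep := (ep n).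
Local Notation fp := (fp n).
Local Notation eM := (eM n).
Local Notation fM := (fM n).
Local Notation wf := (wf n).
Local Notation eb := (eb n).
Local Notation pb := (pb n).
Local Notation flip := (flip n).

Local Notation tt := (tt n).
Local Notation square := (square n).
Local Notation octagon := (octagon n).

Lemma octagon_cons1 i j s b : i < n -> j < n -> adj n i j -> wf b ->
  pb i s -> pb j s = false -> eb j s = false -> octagon i j b -> octagon i j (s :: b).
Proof.
move=> ni nj aij wb h1 h2 h4 oc c d; rewrite eM_consp // [eM j _](eM_cons0 n2) //.
case: ifP => // hi; case E: (eM i b) => [x|] //= -[<-]; case F: (eM j b) => [y|] //= -[<-].
have aji : adj n j i by rewrite adjC.
rewrite h1 h4 => ht; have [b1 b2 b3 b4] := tt_bound n2 ni nj wb aij.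
have ej := eM_ep n2 nj wb F.
have t0 : tt i j b = 0%R by clear_atoms; lia.
clear ht b1 b2 b3 b4; have t0' : tt j i b = 0%R by rewrite (tt_anti n2 ni nj wb aij) t0.
have ei0 : 0 < ep i b by clear_atoms; lia. have ej0 : 0 < ep j b by clear_atoms; lia.
have := oc _ _ E F t0.
have [x0 [x1 [x2 [x3 [[]]]]]] := octagon_path n2 ni nj aij wb t0 ei0 ej0.
rewrite E => -[<-] e1 e2 e3 [[w0 w1 w2 w3] [[i0 i1 i2] [[j0 j1 j2 j3] [tx tx1]]]].
have [y0 [y1 [y2 [y3 [[]]]]]] := octagon_path n2 nj ni aji wb t0' ej0 ei0.
rewrite F => -[<-] f1 f2 f3 [[u0 u1 u2 u3] [[k0 k1 k2] [[l0 l1 l2 l3] [ty ty1]]]].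
rewrite (eM_cons0 n2 nj) // e1 /= (eM_cons0 n2 nj) // e2 /= !eM_consp // e3 f1.
do 2 if_true; rewrite /= !eM_consp // f2; if_true; rewrite /= (eM_cons0 n2) // f3 /=.
by move=> [->].
Qed.

(** Where one side of the octagon raises the letter, a square of the tail at [e_j b] remains, and
    there [tt] is -1; this is why squares are assumed for all tails of the same size. *)
Lemma octagon_cons2 i j s b : i < n -> j < n -> adj n i j -> wf b -> size s = n ->
  eb i s -> pb j s -> (forall c, wf c -> size c = size b -> square i j c) -> octagon i j b -> octagon i j (s :: b).
Proof.
move=> ni nj aij wb ss h1 h2 sq oc c d; rewrite eM_conse // [eM j _]eM_consp //=.
have aji : adj n j i by rewrite adjC.
have [e1 e2 e3] := flip_adj n2 ni nj ss aij h1.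
have p1 : pb i (flip i s) by rewrite pb_flip.
rewrite h2 in e2.
rewrite (ebpbF h1) h2 h1; case: ifP => hi; case: ifP => // hj.
  case E: (eM i b) => [x|] //= -[<-]; case F: (eM j b) => [y|] //= -[<-] ht.
  have t0 : tt i j b = 0%R by clear_atoms; lia.
  clear ht; have t0' : tt j i b = 0%R by rewrite (tt_anti n2 ni nj wb aij) t0.
  have ei0 : 0 < ep i b by clear_atoms; lia. have ej0 : 0 < ep j b by clear_atoms; lia.
have := oc _ _ E F t0.
  have [x0 [x1 [x2 [x3 [[]]]]]] := octagon_path n2 ni nj aij wb t0 ei0 ej0.
  rewrite E => -[<-] a1 a2 a3 [[w0 w1 w2 w3] [[i0 i1 i2] [[j0 j1 j2 j3] [tx tx1]]]].
  have [y0 [y1 [y2 [y3 [[]]]]]] := octagon_path n2 nj ni aji wb t0' ej0 ei0.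
  rewrite F => -[<-] f1 f2 f3 [[u0 u1 u2 u3] [[k0 k1 k2] [[l0 l1 l2 l3] [ty ty1]]]].
  rewrite eM_consp // a1 eM_conse // f1; do 2 if_true; rewrite /= eM_consp // a2.
  if_true; rewrite /= !eM_conse // a3 f2; do 2 if_true; rewrite /= eM_consp // f3.
  by if_true => /= -[->].
move=> -[<-]; case F: (eM j b) => [y|] //= -[<-] ht.
have [b1 b2 b3 b4] := tt_bound n2 ni nj wb aij.
have t0 : tt i j b = 0%R by clear_atoms; lia.
clear ht b1 b2 b3 b4; have jy := eM_ep n2 nj wb F; have wy := eM_wf wb F.
have [ty iy] := eM_tt n2 nj ni aji wb F.
rewrite !(tt_anti n2 ni nj _ aij) // in ty iy.
have [|y1 [f1 wy1 ty1 jy1 iy1]] := eM_step n2 nj ni aji wy; first by clear_atoms; lia.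
have [|x1 [g1 wx1 tx1 ix1 jx1]] := eM_step n2 ni nj aij wy; first by clear_atoms; lia.
rewrite !(tt_anti n2 ni nj _ aij) // in ty1 iy1.
rewrite (eM_cons0 n2 nj) // F /= (eM_cons0 n2 nj) // f1 eM_conse // g1.
if_true; rewrite /= eM_consp // eM_conse //; if_true; if_false.
rewrite /= (eM_cons0 n2 nj) //.
rewrite (sq _ wy (eM_size F) _ _ g1 f1) //; clear_atoms; lia.
Qed.

Lemma octagon_cons3 i j s b : i < n -> j < n -> adj n i j -> wf b -> size s = n ->
  eb i s = false -> pb i s = false -> eb j s -> (forall c, wf c -> size c = size b -> square i j c) -> octagon i j b ->
  octagon i j (s :: b).
Proof.
move=> ni nj aij wb ss h1 h2 h3 sq oc c d; rewrite (eM_cons0 n2 ni) // eM_conse //=.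
have aji : adj n j i by rewrite adjC.
have [e1 e2 e3] := flip_adj n2 nj ni ss aji h3.
rewrite h2 (ebpbF h3); case E: (eM i b) => [x|] //= -[<-]; case: ifP => hj.
  case F: (eM j b) => [y|] //= -[<-] t0.
  have t0' : tt j i b = 0%R by rewrite (tt_anti n2 ni nj wb aij) t0.
  have ei0 : 0 < ep i b by rewrite (eM_ep n2 ni wb E).
  have := oc _ _ E F t0.
  have [x0 [x1 [x2 [x3 [[]]]]]] := octagon_path n2 ni nj aij wb t0 ei0 hj.
  rewrite E => -[<-] a1 a2 a3 [[w0 w1 w2 w3] [[i0 i1 i2] [[j0 j1 j2 j3] [tx tx1]]]].
  have [y0 [y1 [y2 [y3 [[]]]]]] := octagon_path n2 nj ni aji wb t0' hj ei0.
  rewrite F => -[<-] f1 f2 f3 [[u0 u1 u2 u3] [[k0 k1 k2] [[l0 l1 l2 l3] [ty ty1]]]].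
  rewrite eM_conse // a1 (eM_cons0 n2 ni u0) // f1 j0 /=.
  rewrite eM_conse // (eM_cons0 n2 ni) // a2 f2 j1 hj /=.
  by rewrite (eM_cons0 n2 ni) // eM_conse // a3 f3 k2 hj /= => -[->].
move=> -[<-] t0.
have f1p : pb j (flip j s) by rewrite pb_flip.
have [|g1 g2 g3] := flip_adj n2 ni nj (size_flip n j s) aij _; first by rewrite e2 h2.
rewrite f1p in g2.
have [tx jx] := eM_tt n2 ni nj aij wb E.
have wx := eM_wf wb E; have ix := eM_ep n2 ni wb E.
have [|y1 [f1 wy1 ty1 jy1 iy1]] := eM_step n2 nj ni aji wx; first by clear_atoms; lia.
rewrite !(tt_anti n2 ni nj _ aij) // in ty1 iy1.
rewrite !eM_conse ?e2 ?h2 // E f1.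
if_true; if_true => /=; rewrite [eM j (s :: y1)]eM_conse //; if_false.
rewrite /= !eM_conse ?e2 ?h2 //.
case: (posnP (ep i x)) => hx /=.
  rewrite (eM_cons0 n2 nj) // f1 /=; case G: (eM i y1) => [z|] /=; last by if_false.
  by have := eM_ep n2 ni wy1 G; clear_atoms; lia.
have [x1 [g1' wx1 tx1 ix1 jx1]] := eM_step n2 ni nj aij wx hx.
if_true; rewrite g1' /= eM_consp //; if_true.
by rewrite (sq _ wx (eM_size E) _ _ g1' f1) //; clear_atoms; lia.
Qed.

Lemma square_octagon i j b : i < n -> j < n -> adj n i j -> wf b ->
  square i j b /\ octagon i j b.
Proof.
move=> ni nj aij; have aji : adj n j i by rewrite adjC.
move: {2}(size b) (erefl (size b)) => m.
elim: m b => [|m IH] [|s b] // [sb] /andP[/eqP ss wb].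
have [sq oc] := IH b sb wb.
have sqs c : wf c -> size c = size b -> square i j c.
  by move=> wc sc; have [] := IH c (etrans sc sb) wc.
have sqs' c : wf c -> size c = size b -> square j i c.
  by move=> wc sc; apply: square_sym (sqs c wc sc).
have sq' : square j i b by apply: sqs'.
have oc' : octagon j i b by apply: octagon_sym.
have wsb : wf (s :: b) by rewrite /= ss eqxx.
have sym : square j i (s :: b) /\ octagon j i (s :: b) -> square i j (s :: b) /\ octagon i j (s :: b).
  by case=> h1 h2; split; [apply: square_sym | apply: octagon_sym].
have pij := pb_adj n2 ni nj ss aij.
case ei: (eb i s).
  have [ej _ _] := flip_adj n2 ni nj ss aij ei; have pi := ebpbF ei.
  case pj: (pb j s).
    by split; [apply: square_cons2 | apply: octagon_cons2].
  by apply: sym; split; [apply: square_cons3 | apply: octagon_cons3].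
case ej: (eb j s).
  have pj := ebpbF ej; case pi: (pb i s).
    by apply: sym; split; [apply: square_cons2 | apply: octagon_cons2].
  by split; [apply: square_cons3 | apply: octagon_cons3].
case pi: (pb i s).
  have pj := pij pi; by split; [apply: square_cons1 | apply: octagon_cons1].
case pj: (pb j s).
  by apply: sym; split; [apply: square_cons1 | apply: octagon_cons1].
by split; [apply: square_cons0 | apply: octagon_cons0].
Qed.
End Octagon.

(** * Simply laced crystals by local axioms *)

(* A variant of Stembridge's axioms on the elements satisfying [P], with nodes
   [i < N]; [t] is the hidden integer attached to adjacent nodes. *)
Record stembridge (X : Type) (P : X -> Prop) (N : nat) (adj : rel nat)
    (e f : nat -> X -> option X) (ep fp : nat -> X -> nat)
    (t : nat -> nat -> X -> int) (ht : X -> nat) : Prop := Stembridge {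
  st_eP : forall i x y, i < N -> P x -> e i x = Some y -> P y;
  st_fP : forall i x y, i < N -> P x -> f i x = Some y -> P y;
  st_eK : forall i x y, i < N -> P x -> e i x = Some y -> f i y = Some x;
  st_fK : forall i x y, i < N -> P x -> f i x = Some y -> e i y = Some x;
  st_ep : forall i x y, i < N -> P x -> e i x = Some y -> ep i x = (ep i y).+1;
  st_epN : forall i x, i < N -> P x -> e i x = None -> ep i x = 0;
  st_fp : forall i x y, i < N -> P x -> f i x = Some y -> fp i x = (fp i y).+1;
  st_fpN : forall i x, i < N -> P x -> f i x = None -> fp i x = 0;
  st_adjC : forall i j, adj i j = adj j i;
  st_wt : forall i j x y, i < N -> j < N -> i != j -> P x -> e i x = Some y ->
    fp j y + ep j x + adj i j = fp j x + ep j y;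
  st_orth : forall i j x y, i < N -> j < N -> i != j -> ~~ adj i j -> P x ->
    e i x = Some y -> ep j y = ep j x;
  st_sq_orth : forall i j x y z, i < N -> j < N -> i != j -> ~~ adj i j -> P x ->
    e i x = Some y -> e j x = Some z -> e j y = e i z;
  st_t : forall i j x y, i < N -> j < N -> adj i j -> P x -> e i x = Some y ->
    t i j y = (t i j x + 1)%R /\ ep j y = ep j x + (0 <= t i j x)%R;
  st_anti : forall i j x, i < N -> j < N -> adj i j -> P x -> t j i x = (- t i j x)%R;
  st_ebd : forall i j x, i < N -> j < N -> adj i j -> P x -> (0 <= (ep i x)%:Z + t i j x)%R;
  st_fbd : forall i j x, i < N -> j < N -> adj i j -> P x -> (0 <= (fp i x)%:Z - t i j x)%R;
  st_sq : forall i j x y z, i < N -> j < N -> i != j -> adj i j -> P x -> t i j x != 0%R ->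
    e i x = Some y -> e j x = Some z -> e j y = e i z;
  st_oct : forall i j x y z, i < N -> j < N -> i != j -> adj i j -> P x -> t i j x = 0%R ->
    e i x = Some y -> e j x = Some z -> exists y1 y2 z1 z2 w,
    [/\ e j y = Some y1, e j y1 = Some y2 & e i y2 = Some w] /\
    [/\ e i z = Some z1, e i z1 = Some z2 & e j z2 = Some w];
  st_ht : forall i x y, i < N -> P x -> e i x = Some y -> ht y < ht x
}.

(** * The dual crystal *)

Section Dual.
Variables (X : Type) (P : X -> Prop) (N : nat) (adj : rel nat).
Variables (e f : nat -> X -> option X) (ep fp : nat -> X -> nat).
Variables (t : nat -> nat -> X -> int) (ht ht' : X -> nat).
Hypothesis C : stembridge P N adj e f ep fp t ht.
Variable th : nat -> nat.
Hypotheses (th_lt : forall i, i < N -> th i < N) (thK : forall i, i < N -> th (th i) = i).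
Hypothesis th_adj : forall i j, i < N -> j < N -> adj (th i) (th j) = adj i j.
Hypothesis C_ht' : forall i x y, i < N -> P x -> f i x = Some y -> ht' y < ht' x.

Lemma e_some i x : i < N -> P x -> 0 < ep i x -> exists y, e i x = Some y.
Proof. by move=> ni px; case E: (e i x) => [y|]; [exists y | rewrite (st_epN C ni px E)]. Qed.

Lemma f_some i x : i < N -> P x -> 0 < fp i x -> exists y, f i x = Some y.
Proof. by move=> ni px; case E: (f i x) => [y|]; [exists y | rewrite (st_fpN C ni px E)]. Qed.

Lemma ep_f i x y : i < N -> P x -> f i x = Some y -> ep i y = (ep i x).+1.
Proof. by move=> ni px h; apply: (st_ep C ni (st_fP C ni px h) (st_fK C ni px h)). Qed.

Lemma ep_f_orth i j x y : i < N -> j < N -> i != j -> ~~ adj i j -> P x ->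
  f i x = Some y -> ep j y = ep j x /\ fp j y = fp j x.
Proof.
move=> ni nj ij aij px h; have py := st_fP C ni px h; have h' := st_fK C ni px h.
have := st_wt C ni nj ij py h'; have := st_orth C ni nj ij aij py h'.
by rewrite (negPf aij); lia.
Qed.

Lemma f_t i j x y : i < N -> j < N -> i != j -> adj i j -> P x -> f i x = Some y ->
  [/\ t i j y = (t i j x - 1)%R, fp j y = fp j x + (t i j x <= 0)%R &
      ep j y = ep j x - (0 < t i j x)%R].
Proof.
move=> ni nj ij aij px h; have py := st_fP C ni px h; have h' := st_fK C ni px h.
have := st_wt C ni nj ij py h'; have [] := st_t C ni nj aij py h'.
by rewrite aij => h1 h2 h3; split; lia.
Qed.

Lemma f_sq_orth i j x y z : i < N -> j < N -> i != j -> ~~ adj i j -> P x ->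
  f i x = Some y -> f j x = Some z -> f j y = f i z.
Proof.
move=> ni nj ij aij px hy hz; have ji : j != i by rewrite eq_sym.
have aji : ~~ adj j i by rewrite (st_adjC C).
have py := st_fP C ni px hy; have pz := st_fP C nj px hz.
have [w hw] : exists w, f j y = Some w.
  by apply: f_some => //; rewrite (ep_f_orth ni nj ij aij px hy).2 (st_fp C nj px hz).
have pw := st_fP C nj py hw; have hw' := st_fK C nj py hw.
have [v hv] : exists v, e i w = Some v.
  by apply: e_some => //; rewrite (ep_f_orth nj ni ji aji py hw).1 (ep_f ni px hy).
have pv := st_eP C ni pw hv.
have := st_sq_orth C nj ni ji aji pw hw' hv.
rewrite (st_fK C ni px hy) => /esym /(st_eK C nj pv); rewrite hz => -[->].
by rewrite hw (st_eK C ni pw hv).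
Qed.

(** The axioms speak of raising only. For positive [t] the path down through [y] exists, [t] has its
    old value at the bottom, and the upward square there closes the figure. *)
Lemma f_sq_pos i j x y z : i < N -> j < N -> i != j -> adj i j -> P x -> (0 < t i j x)%R ->
  f i x = Some y -> f j x = Some z -> f j y = f i z.
Proof.
move=> ni nj ij aij px tx hy hz; have ji : j != i by rewrite eq_sym.
have aji : adj j i by rewrite (st_adjC C).
have py := st_fP C ni px hy; have pz := st_fP C nj px hz.
have [ty fy _] := f_t ni nj ij aij px hy.
have [w hw] : exists w, f j y = Some w.
  by apply: f_some => //; rewrite fy (st_fp C nj px hz).
have pw := st_fP C nj py hw; have hw' := st_fK C nj py hw.
have [tw _ ew] := f_t nj ni ji aji py hw; rewrite !(st_anti C ni nj aij) // in tw ew.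
have [v hv] : exists v, e i w = Some v.
  by apply: e_some => //; have := ep_f ni px hy; lia.
have pv := st_eP C ni pw hv.
have : t i j w != 0%R by lia.
move=> /(st_sq C ni nj ij aij pw) /(_ hv hw').
rewrite (st_fK C ni px hy) => /(st_eK C nj pv); rewrite hz => -[->].
by rewrite hw (st_eK C ni pw hv).
Qed.

Lemma f_sq i j x y z : i < N -> j < N -> i != j -> adj i j -> P x -> t i j x != 0%R ->
  f i x = Some y -> f j x = Some z -> f j y = f i z.
Proof.
move=> ni nj ij aij px tx hy hz.
case: (ltrP 0%R (t i j x)) => [|tn]; first by move=> h; apply: f_sq_pos hy hz.
have aji : adj j i by rewrite (st_adjC C).
apply/esym; apply: f_sq_pos hz hy => //; first by rewrite eq_sym.
by rewrite (st_anti C ni nj aij px); lia.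
Qed.

Lemma f_oct i j x y z : i < N -> j < N -> i != j -> adj i j -> P x -> t i j x = 0%R ->
    f i x = Some y -> f j x = Some z -> exists y1 y2 z1 z2 w,
    [/\ f j y = Some y1, f j y1 = Some y2 & f i y2 = Some w] /\
    [/\ f i z = Some z1, f i z1 = Some z2 & f j z2 = Some w].
Proof.
move=> ni nj ij aij px tx hy hz; have ji : j != i by rewrite eq_sym.
have aji : adj j i by rewrite (st_adjC C).
have tn w (pw : P w) := st_anti C ni nj aij pw.
have py := st_fP C ni px hy.
have [ty fy gy] := f_t ni nj ij aij px hy; have fz := st_fp C nj px hz.
have fxi := st_fp C ni px hy.
have [|y1 h1] := f_some nj py; first lia.
have p1 := st_fP C nj py h1; have f1 := st_fp C nj py h1.
have [t1 g1 e1] := f_t nj ni ji aji py h1; rewrite !tn // in t1 g1.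
have [|y2 h2] := f_some nj p1; first lia.
have p2 := st_fP C nj p1 h2.
have [t2 g2 e2] := f_t nj ni ji aji p1 h2; rewrite !tn // in t2 g2.
have [|w h3] := f_some ni p2; first lia.
have p3 := st_fP C ni p2 h3.
have [t3 g3 e3] := f_t ni nj ij aij p2 h3.
have q1 := ep_f nj py h1; have q2 := ep_f nj p1 h2.
have [|v hv] := e_some nj p3; first lia.
have pv := st_eP C nj p3 hv.
have h3' := st_fK C ni p2 h3.
(* The integer is 0 again at the bottom [w], so the upward octagon at [w] leads back to [x], and its
   other side is the missing path through [z]. *)
have tw : t i j w = 0%R by lia.
have [y1' [y2' [v1 [v2 [u [[k1 k2 k3] [l1 l2 l3]]]]]]] := st_oct C ni nj ij aij p3 tw h3' hv.
move: k1; rewrite (st_fK C nj p1 h2) => -[E1]; rewrite -E1 (st_fK C nj py h1) in k2.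
move: k2 => -[E2]; rewrite -E2 (st_fK C ni px hy) in k3; move: k3 => -[E3].
have pv1 := st_eP C ni pv l1; have pv2 := st_eP C ni pv1 l2.
have := st_eK C nj pv2 l3; rewrite -E3 hz => -[E4].
exists y1, y2, v1, v, w; split; split => //.
- by rewrite E4; apply: (st_eK C).
- exact: (st_eK C).
- exact: (st_eK C).
Qed.

(** The diagram automorphism [th] lets this serve twice: the identity gives uniqueness of lowest
    weight elements, and [theta] gives the target crystal of the Schuetzenberger involution. *)
Lemma dual_stembridge : stembridge P N adj (f \o th) (e \o th) (fp \o th) (ep \o th)
  (fun i j x => (- t (th i) (th j) x)%R) ht'.
Proof.
have th_neq i j : i < N -> j < N -> i != j -> th i != th j.
  by move=> ni nj; apply: contra => /eqP E; rewrite -(thK ni) E thK.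
split=> /=.
- by move=> i x y ni; apply: (st_fP C); apply: th_lt.
- by move=> i x y ni; apply: (st_eP C); apply: th_lt.
- by move=> i x y ni; apply: (st_fK C); apply: th_lt.
- by move=> i x y ni; apply: (st_eK C); apply: th_lt.
- by move=> i x y ni; apply: (st_fp C); apply: th_lt.
- by move=> i x ni; apply: (st_fpN C); apply: th_lt.
- by move=> i x y ni; apply: (st_ep C); apply: th_lt.
- by move=> i x ni; apply: (st_epN C); apply: th_lt.
- exact: (st_adjC C).
- move=> i j x y ni nj ij px h; rewrite -th_adj //.
  have py := st_fP C (th_lt ni) px h; have h' := st_fK C (th_lt ni) px h.
  by have := st_wt C (th_lt ni) (th_lt nj) (th_neq _ _ ni nj ij) py h'; lia.
- move=> i j x y ni nj ij aij px h; rewrite -th_adj // in aij.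
  exact: (ep_f_orth (th_lt ni) (th_lt nj) (th_neq _ _ ni nj ij) aij px h).2.
- move=> i j x y z ni nj ij aij px; rewrite -th_adj // in aij.
  by apply: f_sq_orth aij px; [exact: th_lt | exact: th_lt | exact: th_neq].
- move=> i j x y ni nj aij px h; rewrite -th_adj // in aij.
  (* At a node adjacent to itself [t] would vanish by antisymmetry, although it changes by one along
     each step. *)
  have ij : th i != th j.
    apply/eqP => E; rewrite E in aij h.
    have := st_anti C (th_lt nj) (th_lt nj) aij px.
    have := (st_t C (th_lt nj) (th_lt nj) aij (st_fP C (th_lt nj) px h) (st_fK C (th_lt nj) px h)).1.
    have := st_anti C (th_lt nj) (th_lt nj) aij (st_fP C (th_lt nj) px h); lia.
  have [h1 h2 _] := f_t (th_lt ni) (th_lt nj) ij aij px h; split; lia.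
- move=> i j x ni nj aij px; rewrite -th_adj // in aij.
  by rewrite (st_anti C _ _ aij) ?th_lt.
- move=> i j x ni nj aij px; rewrite -th_adj // in aij.
  by apply: (st_fbd C) => //; apply: th_lt.
- move=> i j x ni nj aij px; rewrite -th_adj // in aij; rewrite opprK.
  by apply: (st_ebd C) => //; apply: th_lt.
- move=> i j x y z ni nj ij aij px; rewrite -th_adj // in aij; rewrite oppr_eq0 => tx.
  by apply: f_sq aij px tx; [exact: th_lt | exact: th_lt | exact: th_neq].
- move=> i j x y z ni nj ij aij px tx; rewrite -th_adj // in aij.
  apply: f_oct aij px _; [exact: th_lt | exact: th_lt | exact: th_neq | lia].
- by move=> i x y ni; apply: C_ht'; apply: th_lt.
Qed.
End Dual.

Inductive ups (X : Type) (N : nat) (e : nat -> X -> option X) (x : X) : X -> Prop :=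
| ups_refl : ups N e x x
| ups_step i y z : i < N -> e i x = Some y -> ups N e y z -> ups N e x z.

Definition extremal (X : Type) (N : nat) (e : nat -> X -> option X) (x : X) :=
  forall i, i < N -> e i x = None.

Lemma ups_trans X N e (x y z : X) : ups N e x y -> ups N e y z -> ups N e x z.
Proof. by elim=> // a i b c ni ey _ IH /IH; apply: ups_step ni ey. Qed.

Lemma ups1 X N e i (x y : X) : i < N -> e i x = Some y -> ups N e x y.
Proof. by move=> ni ey; apply: (ups_step ni ey); apply: ups_refl. Qed.

(** * Existence and uniqueness of extremal elements *)

Section Confluence.
Variables (X : Type) (P : X -> Prop) (N : nat) (adj : rel nat).
Variables (e f : nat -> X -> option X) (ep fp : nat -> X -> nat).
Variables (t : nat -> nat -> X -> int) (ht : X -> nat).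
Hypothesis C : stembridge P N adj e f ep fp t ht.
Local Notation ups := (ups N e).
Local Notation hw := (extremal N e).

Lemma ups_P x y : P x -> ups x y -> P y.
Proof. by move=> px u; elim: u px => // a i b c ni ey _ IH pa; apply/IH/(st_eP C ni pa ey). Qed.

Lemma join i j x y z : i < N -> j < N -> P x -> e i x = Some y -> e j x = Some z ->
  exists w, ups y w /\ ups z w.
Proof.
move=> ni nj px hy hz.
case: (eqVneq i j) => [E|ij].
  by rewrite E hz in hy; case: hy => <-; exists z; split; apply: ups_refl.
have py := st_eP C ni px hy; have pz := st_eP C nj px hz.
case aij: (adj i j); last first.
  have := st_sq_orth C ni nj ij (negbT aij) px hy hz.
  have [w ew] : exists w, e j y = Some w.
    apply: (e_some C) => //.
    by rewrite (st_orth C ni nj ij (negbT aij) px hy) (st_ep C nj px hz).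
  by rewrite ew => /esym hw'; exists w; split; [apply: (ups1 nj ew) | apply: (ups1 ni hw')].
case: (eqVneq (t i j x) 0%R) => tx.
  have [y1 [y2 [z1 [z2 [w [[a1 a2 a3] [b1 b2 b3]]]]]]] := st_oct C ni nj ij aij px tx hy hz.
  exists w; split.
    by apply: (ups_step nj a1); apply: (ups_step nj a2); apply: (ups1 ni a3).
  by apply: (ups_step ni b1); apply: (ups_step ni b2); apply: (ups1 nj b3).
have := st_sq C ni nj ij aij px tx hy hz.
have [w ew] : exists w, e j y = Some w.
  apply: (e_some C) => //.
  by rewrite (st_t C ni nj aij px hy).2 (st_ep C nj px hz).
by rewrite ew => /esym hw'; exists w; split; [apply: (ups1 nj ew) | apply: (ups1 ni hw')].
Qed.

Lemma ups_extremal x : P x -> exists2 y, ups x y & hw y.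
Proof.
have [m] := ubnP (ht x); elim: m x => // m IH x hm px.
case: (boolP (has (fun i => isSome (e i x)) (iota 0 N))) => [|/hasPn h].
  case/hasP=> i; rewrite mem_iota /= add0n => ni; case E: (e i x) => [y|] // _.
  have [|z uz hz] := IH y _ (st_eP C ni px E); first by have := st_ht C ni px E; lia.
  by exists z => //; apply: (ups_step ni E uz).
exists x; first exact: ups_refl.
by move=> i ni; have := h i; rewrite mem_iota /= add0n ni; case: (e i x) => // y /(_ isT).
Qed.

(** Newman's argument: local confluence is [join], and [ht] makes raising terminate. *)
Lemma extremal_unique x a b : P x -> ups x a -> ups x b -> hw a -> hw b -> a = b.
Proof.
have [m] := ubnP (ht x); elim: m x a b => // m IH x a b hm px ua.
case: ua px hm => [|i y z ni ey ua] px hm ub.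
  by case: ub => // i y z ni ey _ ha; rewrite ha in ey.
case: ub => [_ hb|j y' z' nj ey' ub ha hb]; first by rewrite hb in ey.
have [w [uw uw']] := join ni nj px ey ey'.
have py := st_eP C ni px ey; have py' := st_eP C nj px ey'.
have [c uc hc] := ups_extremal (ups_P py uw).
have zc : z = c.
  by apply: (IH y) => //; [have := st_ht C ni px ey; lia | apply: ups_trans uw uc].
by rewrite zc; apply/esym/(IH y') => //; [have := st_ht C nj px ey'; lia | apply: ups_trans uw' uc].
Qed.
End Confluence.

(** * Components with equal highest weights are isomorphic *)

Section Isomorphism.
Variables (X X' : Type) (P : X -> Prop) (P' : X' -> Prop) (N : nat) (adj : rel nat).
Variables (e f : nat -> X -> option X) (ep fp : nat -> X -> nat).
Variables (t : nat -> nat -> X -> int) (ht : X -> nat).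
Variables (e' f' : nat -> X' -> option X') (ep' fp' : nat -> X' -> nat).
Variables (t' : nat -> nat -> X' -> int) (ht' : X' -> nat).
Hypothesis C : stembridge P N adj e f ep fp t ht.
Hypothesis C' : stembridge P' N adj e' f' ep' fp' t' ht'.
Variables (u : X) (u' : X').
Hypotheses (pu : P u) (pu' : P' u') (hu : extremal N e u) (hu' : extremal N e' u').
Hypothesis fpu : forall i, i < N -> fp i u = fp' i u'.

(** Pairs of elements reached from [u] and [u'] by the same lowering word. That this is the graph of
    a map is proved in [iso_fun]; the length [d] of the word is the induction measure. *)
Inductive iso : nat -> X -> X' -> Prop :=
| iso0 : iso 0 u u'
| isoS d i x x' y y' : i < N -> iso d x x' -> f i x = Some y -> f' i x' = Some y' ->
    iso d.+1 y y'.

Lemma iso_P d x x' : iso d x x' -> P x /\ P' x'.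
Proof.
elim=> // {d x x'} d i x x' y y' ni _ [px px'] h h'.
by split; [apply: (st_fP C ni px h) | apply: (st_fP C' ni px' h')].
Qed.

Lemma ep_hw i : i < N -> ep i u = 0 /\ ep' i u' = 0.
Proof. by move=> ni; rewrite (st_epN C ni pu (hu ni)) (st_epN C' ni pu' (hu' ni)). Qed.

(** Let [x] be [f_k z]. String lengths at [x] follow from those at [z] and the sign of [t]. A
    raising of [x] at another node is reached by climbing from [z], where the induction hypothesis
    applies, to the top of a square or an octagon and descending on its other side. *)
Lemma iso_facts d x x' : iso d x x' ->
  [/\ forall i, i < N -> ep i x = ep' i x' /\ fp i x = fp' i x',
      forall i y, i < N -> e i x = Some y -> exists2 y', e' i x' = Some y' & iso d.-1 y y'
    & forall i j, i < N -> j < N -> adj i j -> i != j -> t i j x = t' i j x'].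
Proof.
have [m] := ubnP d; elim: m d x x' => // m IH d x x' dm xx.
have [px px'] := iso_P xx.
case: xx dm px px' => [|{}d k z z' {}x {}x' nk zz hx hx'] dm px px'.
  split.
  - by move=> i ni; have [-> ->] := ep_hw ni; rewrite fpu.
  - by move=> i y ni; rewrite hu.
  move=> i j ni nj aij ij; have aji : adj j i by rewrite (st_adjC C).
  have := st_ebd C ni nj aij pu; have := st_ebd C nj ni aji pu.
  have := st_ebd C' ni nj aij pu'; have := st_ebd C' nj ni aji pu'.
  rewrite (st_anti C ni nj aij pu) (st_anti C' ni nj aij pu').
  by have [-> ->] := ep_hw ni; have [-> ->] := ep_hw nj; lia.
have [epz ez tz] := IH d z z' dm zz.
have [pz pz'] := iso_P zz.
have ezx := st_fK C nk pz hx; have ezx' := st_fK C' nk pz' hx'.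
have epx i : i < N -> ep i x = ep' i x' /\ fp i x = fp' i x'.
  move=> ni; have [h1 h2] := epz i ni.
  case: (eqVneq k i) => [E|ki].
    subst i; rewrite (ep_f C ni pz hx) (ep_f C' ni pz' hx') h1.
    by have := st_fp C ni pz hx; have := st_fp C' ni pz' hx'; lia.
  case aki: (adj k i).
    have [_ -> ->] := f_t C nk ni ki aki pz hx.
    by have [_ -> ->] := f_t C' nk ni ki aki pz' hx'; rewrite h1 h2 tz.
  have [-> ->] := ep_f_orth C nk ni ki (negbT aki) pz hx.
  by have [-> ->] := ep_f_orth C' nk ni ki (negbT aki) pz' hx'.
have fiso d1 i a a' b b' : i < N -> iso d1 a a' -> e i b = Some a -> P b -> e' i b' = Some a' -> P' b' ->
    iso d1.+1 b b'.
  by move=> ni aa h pb h' pb'; apply: (isoS ni aa (st_eK C ni pb h) (st_eK C' ni pb' h')).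
have ex i y : i < N -> e i x = Some y -> exists2 y', e' i x' = Some y' & iso d y y'.
  move=> ni hy; case: (eqVneq k i) => [E|ki].
    by subst i; rewrite ezx in hy; case: hy => <-; exists z'.
  have ik : i != k by rewrite eq_sym.
  have py := st_eP C ni px hy.
  have [y' hy'] : exists y', e' i x' = Some y'.
    by apply: (e_some C') => //; rewrite -(epx i ni).1 (st_ep C ni px hy).
  have py' := st_eP C' ni px' hy'.
  exists y' => //.
  (* [w] is a common upper neighbour of [y] and [z]; [d > 0] as [e i z] is defined. *)
  have square w : e i z = Some w -> e k y = Some w -> e' k y' = e' i z' -> iso d y y'.
    move=> hw hw' E; have [w' e1 ww] := ez i w ni hw; rewrite e1 in E.
    case: d zz {dm IH ez} ww => [|d1] zz ww; last exact: (fiso _ _ _ _ _ _ nk ww hw' py E py').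
    by inversion zz; subst; rewrite hu in hw.
  case aki: (adj k i); last first.
    have := st_sq_orth C nk ni ki (negbT aki) px ezx hy.
    have [w hw] : exists w, e i z = Some w.
      apply: (e_some C) => //.
      by rewrite (st_orth C nk ni ki (negbT aki) px ezx) (st_ep C ni px hy).
    rewrite hw => /esym hw'; apply: (square w) => //.
    by rewrite (st_sq_orth C' nk ni ki (negbT aki) px' ezx' hy').
  have tx : t k i x = t' k i x'.
    have [-> _ _] := f_t C nk ni ki aki pz hx.
    by have [-> _ _] := f_t C' nk ni ki aki pz' hx'; rewrite tz.
  case: (eqVneq (t k i x) 0%R) => t0; last first.
    have := st_sq C nk ni ki aki px t0 ezx hy.
    have [w hw] : exists w, e i z = Some w.
      apply: (e_some C) => //.
      by rewrite (st_t C nk ni aki px ezx).2 (st_ep C ni px hy).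
    rewrite hw => /esym hw'; apply: (square w) => //.
    by rewrite tx in t0; rewrite (st_sq C' nk ni ki aki px' t0 ezx' hy').
  (* The top [w] of the octagon lies three raisings above [z], which the induction hypothesis
     mirrors; lowering from [w] along the other side gives the pair [y], [y']. *)
  have [z1 [z2 [y1 [y2 [w [[a1 a2 a3] [b1 b2 b3]]]]]]] := st_oct C nk ni ki aki px t0 ezx hy.
  rewrite tx in t0.
  have [z1' [z2' [y1' [y2' [w' [[a1' a2' a3'] [b1' b2' b3']]]]]]] :=
    st_oct C' nk ni ki aki px' t0 ezx' hy'.
  have [z3 c1 i1] := ez i z1 ni a1; rewrite a1' in c1; case: c1 => c1; subst z3.
  have [_ ez1 _] := IH d.-1 _ _ (leq_ltn_trans (leq_pred d) dm) i1.
  have [z3 c2 i2] := ez1 i z2 ni a2; rewrite a2' in c2; case: c2 => c2; subst z3.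
  have hd : d.-1.-1 < m by lia.
  have [_ ez2 _] := IH d.-1.-1 _ _ hd i2.
  have [z3 c3 i3] := ez2 k w nk a3; rewrite a3' in c3; case: c3 => c3; subst z3.
  have py1 := st_eP C nk py b1; have py2 := st_eP C nk py1 b2.
  have py1' := st_eP C' nk py' b1'; have py2' := st_eP C' nk py1' b2'.
  have := fiso _ _ _ _ _ _ ni i3 b3 py2 b3' py2'.
  move/(fiso _ _ _ _ _ _ nk) => /(_ _ _ b2 py1 b2' py1').
  move/(fiso _ _ _ _ _ _ nk) => /(_ _ _ b1 py b1' py').
  (* The predecessors are truncated, but an element that can be raised has positive depth, as [u]
     cannot be raised; the three raisings give [3 <= d]. *)
  suff -> : d.-1.-1.-1.+3 = d by [].
  have dep a a' d1 : iso d1 a a' -> (exists i0 c, i0 < N /\ e i0 a = Some c) -> 0 < d1.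
    by case: d1 => // h [i0 [c [n0]]]; inversion h; subst; rewrite hu.
  have := dep _ _ _ zz (ex_intro _ i (ex_intro _ z1 (conj ni a1))).
  have := dep _ _ _ i1 (ex_intro _ i (ex_intro _ z2 (conj ni a2))).
  have := dep _ _ _ i2 (ex_intro _ k (ex_intro _ w (conj nk a3))).
  lia.
split => // i j ni nj aij ij; have aji : adj j i by rewrite (st_adjC C).
have ji : j != i by rewrite eq_sym.
(* The value of [t] is read off after one raising; if neither node raises [x], the bounds force it
   to be 0 on both sides. *)
case Ei: (e i x) => [y|].
  have [y' Ei' yy] := ex i y ni Ei; have [_ _ ty] := IH d _ _ dm yy.
  have := ty i j ni nj aij ij; rewrite (st_t C ni nj aij px Ei).1 (st_t C' ni nj aij px' Ei').1.
  lia.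
case Ej: (e j x) => [y|].
  have [y' Ej' yy] := ex j y nj Ej; have [_ _ ty] := IH d _ _ dm yy.
  have := ty j i nj ni aji ji; rewrite (st_t C nj ni aji px Ej).1 (st_t C' nj ni aji px' Ej').1.
  rewrite (st_anti C ni nj aij px) (st_anti C' ni nj aij px'); lia.
have := st_ebd C ni nj aij px; have := st_ebd C nj ni aji px.
have := st_ebd C' ni nj aij px'; have := st_ebd C' nj ni aji px'.
rewrite (st_anti C ni nj aij px) (st_anti C' ni nj aij px').
rewrite -(epx i ni).1 -(epx j nj).1 (st_epN C ni px Ei) (st_epN C nj px Ej); lia.
Qed.

Lemma iso_fun d d1 x x' x'' : iso d x x' -> iso d1 x x'' -> x' = x''.
Proof.
move=> xx; elim: xx d1 x'' => [|{}d i z z' {}x {}x' ni zz IH h h'] d1 x'' xx'.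
  inversion xx' as [|d2 i x0 x0' y y' ni xx0 h h']; subst => //.
  by have := st_fK C ni (iso_P xx0).1 h; rewrite hu.
have [pz pz'] := iso_P zz; have [px px''] := iso_P xx'.
have [_ ex _] := iso_facts xx'.
have [z'' hz /IH E] := ex i z ni (st_fK C ni pz h).
have := st_eK C' ni px'' hz; rewrite -E h' => -[] //.
Qed.

Lemma iso_down d x x' i y : iso d x x' -> i < N -> f i x = Some y ->
  exists2 y', f' i x' = Some y' & iso d.+1 y y'.
Proof.
move=> xx ni h; have [ex _ _] := iso_facts xx; have [px px'] := iso_P xx.
have [y' h'] : exists y', f' i x' = Some y'.
  by apply: (f_some C') => //; rewrite -(ex i ni).2 (st_fp C ni px h).
by exists y' => //; apply: (isoS ni xx h h').
Qed.
End Isomorphism.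

(** * Weights and the crystal of tensors *)

Lemma nplus_size (b : tens) k : nplus b k + nminus b k = size b.
Proof. by rewrite /nplus /nminus count_predC. Qed.

Lemma g2_cons s (b : tens) k : g2 (s :: b) k = ((if nth false s k then 1 else -1) + g2 b k)%R.
Proof. by rewrite /g2 /nplus /nminus /=; case: nth => /=; lia. Qed.

Lemma g2_cat (b c : tens) k : g2 (b ++ c) k = (g2 b k + g2 c k)%R.
Proof. by rewrite /g2 /nplus /nminus !count_cat; lia. Qed.

Section Weights.
Variable n : nat.
Hypothesis n2 : 2 <= n.
Implicit Types (i j k : nat) (s : seq bool) (b c d : tens).

Lemma wt_g2 j b : j < n -> wf n b ->
  (2%:Z * ((fp n j b)%:Z - (ep n j b)%:Z) =
   g2 b (pos n j) + (if j.+1 == n then 1 else -1) * g2 b (pos n j).+1)%R.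
Proof.
move=> jn; elim: b => [|s b IH] /=; first by case: ifP.
move=> /andP[/eqP ss wb]; have := IH wb; rewrite !g2_cons.
rewrite /eb /pb /lhi /llo.
by case: (j.+1 == n); case: nth; case: nth => /=; lia.
Qed.

Lemma g2_flip j s b k : j < n -> size s = n -> eb n j s -> k < n ->
  (g2 (flip n j s :: b) k = g2 (s :: b) k + 2%:Z * (k == pos n j)%:Z +
    (if j.+1 == n then 2%:Z else -2%:Z) * (k == (pos n j).+1)%:Z)%R.
Proof.
move=> jn ss es kn; rewrite !g2_cons nth_flip // kn /=.
move: es; rewrite /eb /lhi /llo.
case: (eqVneq k (pos n j)) => [->|k1] /=.
  by case: nth => //=; rewrite (_ : pos n j == _ = false); [case: ifP; lia | lia].
case: (eqVneq k (pos n j).+1) => [->|k2] /=; last by rewrite addbF; case: ifP; lia.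
by case: nth => //=; case: nth; case: ifP => //=; lia.
Qed.

Lemma eM_g2 j b c k : j < n -> wf n b -> k < n -> eM n j b = Some c ->
  (g2 c k = g2 b k + 2%:Z * (k == pos n j)%:Z +
    (if j.+1 == n then 2%:Z else -2%:Z) * (k == (pos n j).+1)%:Z)%R.
Proof.
move=> jn wb kn; elim: b c wb => // s b IH c /andP[/eqP ss wb]; rewrite eM_cons.
case: ifP => _; last by case: ifP => // es [<-]; rewrite g2_flip.
by case E: (eM n j b) => [d|] //= -[<-]; rewrite !g2_cons (IH d) // !addrA.
Qed.

(* Twice the pairing with [rho] of the weight [g / 2]. *)
Definition hgt (g : nat -> int) : int := (\sum_(k < n) g k * (n.-1 - k)%:Z)%R.

Lemma hgt_ext (g h : nat -> int) : (forall k, k < n -> g k = h k) -> hgt g = hgt h.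
Proof. by move=> gh; apply: eq_bigr => k _; rewrite gh. Qed.

Lemma hgt_delta p (x : int) : p < n -> hgt (fun k => x * (k == p)%:Z)%R = (x * (n.-1 - p)%:Z)%R.
Proof.
move=> pn; rewrite /hgt (bigD1 (Ordinal pn)) //= eqxx mulr1 big1 ?addr0 // => k kp.
by have /negPf -> : (k : nat) != p by []; rewrite mulr0 mul0r.
Qed.

Lemma hgtD g h : hgt (fun k => g k + h k)%R = (hgt g + hgt h)%R.
Proof. by rewrite /hgt -big_split; apply: eq_bigr => k _; rewrite mulrDl. Qed.

(** Every simple root pairs to 1 with rho; the factor 2 comes from the doubled weights. *)
Lemma eM_hgt j b c : j < n -> wf n b -> eM n j b = Some c -> hgt (g2 c) = (hgt (g2 b) + 2%:Z)%R.
Proof.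
move=> jn wb h.
rewrite (hgt_ext (fun k kn => eM_g2 jn wb kn h)) 2!hgtD !hgt_delta ?pos_lt //; last first.
  exact: ltnW (pos_lt n2 jn).
have := pos_lt n2 jn; rewrite /pos.
by case: (ltnP j.+1 n) => jn1; case: eqP => e1; lia.
Qed.

Lemma hgt_bound b : (- (size b * n * n)%:Z <= hgt (g2 b) <= (size b * n * n)%:Z)%R.
Proof.
have h k : (k < n) -> (`|g2 b k * (n.-1 - k)%:Z| <= (size b * n)%:Z)%R.
  move=> kn; rewrite normrM PoszM; apply: ler_pM => //; last lia.
  by have := nplus_size b k; rewrite /g2; lia.
suff : (`|hgt (g2 b)| <= (size b * n * n)%:Z)%R by lia.
apply: (le_trans (ler_norm_sum _ _ _)).
apply: (@le_trans _ _ (\sum_(k < n) (size b * n)%:Z)%R); first by apply: ler_sum => k _; apply: h.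
by rewrite sumr_const card_ord; lia.
Qed.
End Weights.

Section TensorCrystal.
Variable n : nat.
Hypothesis n2 : 2 <= n.
Implicit Types (i j k : nat) (s : seq bool) (b c d u : tens).
Local Notation ep := (ep n).
Local Notation fp := (fp n).
Local Notation eM := (eM n).
Local Notation fM := (fM n).
Local Notation wf := (wf n).
Local Notation hgt b := (hgt n (g2 b)).

Lemma theta_lt i : i < n -> theta n i < n.
Proof. by rewrite /theta; case: odd; do ?[case: eqP => ?]; lia. Qed.

Lemma thetaK i : i < n -> theta n (theta n i) = i.
Proof.
rewrite /theta; case: odd => // ni.
by case: (eqVneq i (n - 2)) => i1; [|case: (eqVneq i (n - 1)) => i2]; do ?[case: eqP => ?]; lia.
Qed.

Lemma theta_adj i j : i < n -> j < n -> adj n (theta n i) (theta n j) = adj n i j.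
Proof.
move=> ni nj; rewrite /theta; case: (boolP (odd n)) => // on.
have n3 : n != 2 by apply: contraTneq on => ->.
rewrite /adj; case: (eqVneq i (n - 2)) => i1; [|case: (eqVneq i (n - 1)) => i2];
  (case: (eqVneq j (n - 2)) => j1; [|case: (eqVneq j (n - 1)) => j2]); lia.
Qed.

(** Distances of the height from its extreme values, used as termination measures; each step changes
    them by two, hence the doubled fuel in [raiseP] and [lowerP]. *)
Definition eht b := absz ((size b * n * n)%:Z - hgt b)%R.
Definition fht b := absz ((size b * n * n)%:Z + hgt b)%R.

Lemma eM_eht i b c : i < n -> wf b -> eM i b = Some c -> eht b = (eht c).+2.
Proof.
move=> ni wb h; rewrite /eht (eM_size h); have := eM_hgt n2 ni wb h.
have := hgt_bound n2 b; have := hgt_bound n2 c; rewrite (eM_size h); lia.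
Qed.

Lemma fM_fht i b c : i < n -> wf b -> fM i b = Some c -> fht b = (fht c).+2.
Proof.
move=> ni wb h; have wc := fM_wf wb h; have h' := fMK n2 ni wb h.
rewrite /fht (eM_size h'); have := eM_hgt n2 ni wc h'.
have := hgt_bound n2 b; have := hgt_bound n2 c; rewrite (eM_size h'); lia.
Qed.

Lemma tens_stembridge : stembridge wf n (adj n) eM fM ep fp (tt n) eht.
Proof.
split.
- by move=> i x y _; apply: eM_wf.
- by move=> i x y _; apply: fM_wf.
- by move=> i x y; apply: eMK.
- by move=> i x y; apply: fMK.
- by move=> i x y; apply: eM_ep.
- by move=> i x _ _; apply: eM_epN.
- by move=> i x y ni px /(fM_fp n2 ni px)[].
- by move=> i x _ _; apply: fM_fpN.
- exact: adjC.
- by move=> i j x y; apply: eM_wt.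
- by move=> i j x y; apply: eM_orth.
- by move=> i j x y z; apply: sq_orth.
- by move=> i j x y; apply: eM_tt.
- by move=> i j x ni nj aij px; apply: tt_anti.
- by move=> i j x ni nj aij px; have [] := tt_bound n2 ni nj px aij.
- by move=> i j x ni nj aij px; have [] := tt_bound n2 ni nj px aij.
- move=> i j x y z ni nj ij aij px tx hy hz.
  exact: (square_octagon n2 ni nj aij px).1 _ _ hy hz tx.
- move=> i j x y z ni nj ij aij px tx hy hz; have aji : adj n j i by rewrite adjC.
  have := (square_octagon n2 ni nj aij px).2 _ _ hy hz tx.
  have ei0 : 0 < ep i x by rewrite (eM_ep n2 ni px hy).
  have ej0 : 0 < ep j x by rewrite (eM_ep n2 nj px hz).
  have tx' : tt n j i x = 0%R by rewrite (tt_anti n2 ni nj px aij) tx.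
  have [c [y1 [y2 [y3 [[hc h1 h2 h3] _]]]]] := octagon_path n2 ni nj aij px tx ei0 ej0.
  have [d [z1 [z2 [z3 [[hd l1 l2 l3] _]]]]] := octagon_path n2 nj ni aji px tx' ej0 ei0.
  rewrite hy in hc; rewrite hz in hd; case: hc hd => <- [<-] in h1 l1 *.
  rewrite h1 l1 /= h2 l2 /= h3 l3 => -[E].
  by exists y1, y2, z1, z2, y3; rewrite E in h3 *.
by move=> i x y ni px h; have := eM_eht ni px h; lia.
Qed.

Lemma dual_theta : stembridge wf n (adj n) (fM \o theta n) (eM \o theta n) (fp \o theta n)
  (ep \o theta n) (fun i j x => (- tt n (theta n i) (theta n j) x)%R) fht.
Proof.
apply: (dual_stembridge tens_stembridge theta_lt thetaK theta_adj).
by move=> i x y ni px h; have := fM_fht ni px h; lia.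
Qed.

Lemma dual_id : stembridge wf n (adj n) (fM \o id) (eM \o id) (fp \o id)
  (ep \o id) (fun i j x => (- tt n (id i) (id j) x)%R) fht.
Proof.
apply: (dual_stembridge tens_stembridge (th := id)) => //.
by move=> i x y ni px h; have := fM_fht ni px h; lia.
Qed.

Definition hw b := extremal n eM b.
Definition lw b := extremal n fM b.
Definition high b := (raise n (bound n b) b).2.
Definition low b := lower n (bound n b) b.
Definition path_down (p : seq nat) (u : tens) := foldr (fun j acc => obind (fM j) acc) (Some u) p.

Lemma first_app_Some g js j b : first_app g js = Some (j, b) -> j \in js /\ g j = Some b.
Proof.
elim: js => //= k js IH; case E: (g k) => [y|].
  by move=> -[<- <-]; rewrite in_cons eqxx.
by move=> /IH[h1 h2]; rewrite in_cons h1 orbT.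
Qed.

Lemma first_app_None g js j : first_app g js = None -> j \in js -> g j = None.
Proof.
elim: js => //= k js IH; case E: (g k) => [y|] // /IH h.
by rewrite in_cons => /orP[/eqP ->|].
Qed.

Lemma raiseP m b : wf b -> eht b < m.*2 ->
  [/\ ups n eM b (raise n m b).2, hw (raise n m b).2, all (fun j => j < n) (raise n m b).1 &
      path_down (raise n m b).1 (raise n m b).2 = Some b].
Proof.
elim: m b => [|m IH] b wb hb; first by rewrite ltn0 in hb.
rewrite /=; case E: first_app => [[j c]|].
  have [] := first_app_Some E; rewrite mem_iota /= add0n => jn.
  rewrite eTE // => h; have wc := eM_wf wb h.
  have [|] := IH c wc; first by have := eM_eht jn wb h; lia.
  case: (raise n m c) => p u /= h1 h2 h3 h4; split => //.
  - exact: ups_step jn h h1.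
  - by rewrite jn.
  - by rewrite /path_down /= -/(path_down p u) h4 /= (eMK n2 jn wb h).
split => //; first exact: ups_refl.
move=> j jn; have := first_app_None E (j := j); rewrite mem_iota /= add0n jn eTE //.
by move=> ->.
Qed.

Lemma lowerP m b : wf b -> fht b < m.*2 -> ups n fM b (lower n m b) /\ lw (lower n m b).
Proof.
elim: m b => [|m IH] b wb hb; first by rewrite ltn0 in hb.
rewrite /=; case E: first_app => [[j c]|].
  have [] := first_app_Some E; rewrite mem_iota /= add0n => jn.
  rewrite fTE // => h; have wc := fM_wf wb h.
  have [|] := IH c wc; first by have := fM_fht jn wb h; lia.
  by move=> h1 h2; split => //; exact: ups_step jn h h1.
split => //; first exact: ups_refl.
move=> j jn; have := first_app_None E (j := j); rewrite mem_iota /= add0n jn fTE //.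
by move=> ->.
Qed.

Lemma eht_bound b : eht b < (bound n b).*2.
Proof. by rewrite /eht /bound; have := hgt_bound n2 b; lia. Qed.

Lemma fht_bound b : fht b < (bound n b).*2.
Proof. by rewrite /fht /bound; have := hgt_bound n2 b; lia. Qed.

Lemma high_ups b : wf b -> ups n eM b (high b).
Proof. by move=> wb; have [] := raiseP wb (eht_bound b). Qed.

Lemma high_hw b : wf b -> hw (high b).
Proof. by move=> wb; have [] := raiseP wb (eht_bound b). Qed.

Lemma low_ups b : wf b -> ups n fM b (low b).
Proof. by move=> wb; have [] := lowerP wb (fht_bound b). Qed.

Lemma low_lw b : wf b -> lw (low b).
Proof. by move=> wb; have [] := lowerP wb (fht_bound b). Qed.

Lemma ups_wf b c : wf b -> ups n eM b c -> wf c.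
Proof. exact: (ups_P tens_stembridge). Qed.

Lemma downs_wf b c : wf b -> ups n fM b c -> wf c.
Proof. exact: (ups_P dual_id). Qed.

Lemma high_wf b : wf b -> wf (high b).
Proof. by move=> wb; apply: ups_wf (high_ups wb). Qed.

Lemma low_wf b : wf b -> wf (low b).
Proof. by move=> wb; apply: downs_wf (low_ups wb). Qed.

Lemma ups_size b c : ups n eM b c -> size c = size b.
Proof. by elim=> // x i y z _ /eM_size <- _ ->. Qed.

Lemma downs_size b c : ups n fM b c -> size c = size b.
Proof. by elim=> // x i y z _ /fM_size <- _ ->. Qed.

Lemma size_high b : wf b -> size (high b) = size b.
Proof. by move=> wb; apply: ups_size (high_ups wb). Qed.

Lemma size_low b : wf b -> size (low b) = size b.
Proof. by move=> wb; apply: downs_size (low_ups wb). Qed.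

Lemma high_unique b u : wf b -> ups n eM b u -> hw u -> high b = u.
Proof.
by move=> wb bu hu; apply: (extremal_unique tens_stembridge wb (high_ups wb) bu (high_hw wb) hu).
Qed.

Lemma low_unique b u : wf b -> ups n fM b u -> lw u -> low b = u.
Proof.
by move=> wb bu hu; apply: (extremal_unique dual_id wb (low_ups wb) bu (low_lw wb) hu).
Qed.

Lemma high_id u : wf u -> hw u -> high u = u.
Proof. by move=> wu; apply: high_unique => //; apply: ups_refl. Qed.

Lemma low_id u : wf u -> lw u -> low u = u.
Proof. by move=> wu; apply: low_unique => //; apply: ups_refl. Qed.

Lemma high_e i b c : i < n -> wf b -> eM i b = Some c -> high b = high c.
Proof.
move=> ni wb h; have wc := eM_wf wb h; apply: high_unique (high_hw wc) => //.
exact: ups_step ni h (high_ups wc).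
Qed.

Lemma high_f i b c : i < n -> wf b -> fM i b = Some c -> high b = high c.
Proof.
by move=> ni wb h; rewrite (high_e ni (fM_wf wb h) (fMK n2 ni wb h)).
Qed.

Lemma low_f i b c : i < n -> wf b -> fM i b = Some c -> low b = low c.
Proof.
move=> ni wb h; have wc := fM_wf wb h; apply: low_unique (low_lw wc) => //.
exact: ups_step ni h (low_ups wc).
Qed.

Lemma low_e i b c : i < n -> wf b -> eM i b = Some c -> low b = low c.
Proof.
by move=> ni wb h; rewrite (low_f ni (eM_wf wb h) (eMK n2 ni wb h)).
Qed.

Lemma high_downs_eq b c : wf b -> ups n fM b c -> high b = high c.
Proof. by move=> wb u; elim: u wb => // x i y z ni h _ IH wx; rewrite (high_f ni wx h) IH // (fM_wf wx h). Qed.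

Lemma low_ups_eq b c : wf b -> ups n eM b c -> low b = low c.
Proof. by move=> wb u; elim: u wb => // x i y z ni h _ IH wx; rewrite (low_e ni wx h) IH // (eM_wf wx h). Qed.

Lemma high_low b : wf b -> high (low b) = high b.
Proof. by move=> wb; rewrite (high_downs_eq wb (low_ups wb)). Qed.

Lemma low_high b : wf b -> low (high b) = low b.
Proof. by move=> wb; rewrite (low_ups_eq wb (high_ups wb)). Qed.
End TensorCrystal.

(** * The weight of the lowest weight element *)

Section LowestWeight.
Variable n : nat.
Hypothesis n2 : 2 <= n.
Implicit Types (i j k : nat) (s : seq bool) (b c d u : tens).
Local Notation ep := (ep n).
Local Notation fp := (fp n).
Local Notation eM := (eM n).
Local Notation fM := (fM n).
Local Notation wf := (wf n).
Local Notation high := (high n).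
Local Notation low := (low n).
Local Notation hw := (hw n).
Local Notation lw := (lw n).

Definition weight_of u (g : nat -> int) :=
  exists x, [/\ wf x, high x = u, size x = size u & forall k, k < n -> g2 x k = g k].

Lemma weight_of_ext u g h : (forall k, k < n -> g k = h k) -> weight_of u g -> weight_of u h.
Proof. by move=> gh [x [wx hx sx wt]]; exists x; split=> // k kn; rewrite wt ?gh. Qed.

(* The effect of [m] steps up the [j]-string on (doubled) weights. *)
Definition shift j (m : int) (g : nat -> int) k : int :=
  (g k + 2%:Z * m * (k == pos n j)%:Z +
    (if j.+1 == n then 2%:Z else -2%:Z) * m * (k == (pos n j).+1)%:Z)%R.

Lemma string_up j m x : j < n -> wf x -> m <= ep j x ->
  exists y, [/\ wf y, high y = high x, size y = size x & forall k, k < n -> g2 y k = shift j m%:Z (g2 x) k].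
Proof.
move=> jn; elim: m x => [|m IH] x wx hm.
  by exists x; split=> // k kn; rewrite /shift !mulr0 !mul0r !addr0.
have [y hy] : exists y, eM j x = Some y by apply: eM_some; lia.
have wy := eM_wf wx hy; have ey := eM_ep n2 jn wx hy.
have [|z [wz hz sz gz]] := IH y wy; first lia.
exists z; split=> //; first by rewrite hz (high_e n2 jn wx hy).
  by rewrite sz (eM_size hy).
move=> k kn; rewrite gz // /shift (eM_g2 n2 jn wx kn hy).
by case: (k == _); case: (k == _); case: ifP; lia.
Qed.

Lemma string_down j m x : j < n -> wf x -> m <= fp j x ->
  exists y, [/\ wf y, high y = high x, size y = size x & forall k, k < n -> g2 y k = shift j (- m%:Z)%R (g2 x) k].
Proof.
move=> jn; elim: m x => [|m IH] x wx hm.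
  by exists x; split=> // k kn; rewrite /shift !mulr0 !mul0r !addr0.
have [y hy] : exists y, fM j x = Some y.
  by case E: (fM j x) => [y|]; [exists y | rewrite fM_fpN in hm].
have wy := fM_wf wx hy; have [fy _] := fM_fp n2 jn wx hy.
have [|z [wz hz sz gz]] := IH y wy; first lia.
exists z; split=> //; first by rewrite hz (high_f n2 jn wx hy).
  by rewrite sz (fM_size hy).
move=> k kn; rewrite gz //.
have := eM_g2 n2 jn wy kn (fMK n2 jn wx hy); rewrite /shift => ->.
by case: (k == _); case: (k == _); case: ifP; lia.
Qed.

(** The reflection is realised inside the component by walking along the [j]-string to the mirror
    image of [x], which is [|fp - ep|] steps away. *)
Lemma weight_reflect u j g : j < n -> weight_of u g ->
  exists m : int, weight_of u (shift j m g) /\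
  (2%:Z * m = - (g (pos n j) + (if j.+1 == n then 1 else -1) * g (pos n j).+1))%R.
Proof.
move=> jn [x [wx hx sx gx]].
have pn := pos_lt n2 jn.
have := wt_g2 n2 jn wx; rewrite !gx ?(ltnW pn) // => hw.
exists ((ep j x)%:Z - (fp j x)%:Z)%R; split; last lia.
case: (leqP (ep j x) (fp j x)) => le.
  have [|y [wy hy sy gy]] := @string_down j (fp j x - ep j x) x jn wx; first lia.
  exists y; split; rewrite ?hy ?sy // => k kn; rewrite gy //.
  have -> : (- (fp j x - ep j x)%N%:Z = (ep j x)%:Z - (fp j x)%:Z)%R by lia.
  by rewrite /shift gx.
have [|y [wy hy sy gy]] := @string_up j (ep j x - fp j x) x jn wx; first lia.
exists y; split; rewrite ?hy ?sy // => k kn; rewrite gy //.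
have -> : ((ep j x - fp j x)%N%:Z = (ep j x)%:Z - (fp j x)%:Z)%R by lia.
by rewrite /shift gx.
Qed.

Lemma weight_swap u j g : j.+1 < n -> weight_of u g ->
  weight_of u (fun k => if k == j then g j.+1 else if k == j.+1 then g j else g k).
Proof.
move=> jn /(weight_reflect (ltnW jn))[m []].
have pj : pos n j = j by rewrite /pos jn.
have jF : (j.+1 == n) = false by lia.
rewrite pj jF => w hm; apply: weight_of_ext w => k kn; rewrite /shift pj jF.
case: (eqVneq k j) => [->|kj]; first by rewrite (ltn_eqF (ltnSn j)); lia.
by case: (eqVneq k j.+1) => [->|kj1]; lia.
Qed.

Lemma weight_negswap u g : weight_of u g ->
  weight_of u (fun k => if k == (n - 2)%N then - g (n - 1)%N else if k == (n - 1)%N then - g (n - 2)%N else g k)%R.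
Proof.
have jn : n - 1 < n by lia.
move=> /(weight_reflect jn)[m []].
have pj : pos n (n - 1) = n - 2 by rewrite /pos; case: ifP; lia.
have pj1 : (n - 2).+1 = n - 1 by lia.
have jT : ((n - 1).+1 == n) by lia.
rewrite pj jT pj1 => w hm; apply: weight_of_ext w => k kn; rewrite /shift pj jT pj1.
case: (eqVneq k (n - 2)) => [->|kj].
  have -> : (n - 2 == n - 1) = false by lia.
  lia.
by case: (eqVneq k (n - 1)) => [->|kj1]; lia.
Qed.

(** The last two coordinates are treated by a swap and [weight_negswap]; every other adjacent pair
    is carried there and back by transpositions. *)
Lemma weight_negpair u (d : nat) (g : nat -> int) k : k + d.+2 = n -> weight_of u g ->
  weight_of u (fun m => if (m == k) || (m == k.+1) then - g m else g m)%R.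
Proof.
elim: d k g => [|d IH] k g kd w.
  have [kn k1n] : k = n - 2 /\ k.+1 = n - 1 by lia.
  have k1 : k.+1 < n by lia.
  have := weight_swap k1 (weight_negswap w); apply: weight_of_ext => m mn.
  rewrite -kn -k1n; case: (eqVneq m k) => [->|mk] /=; first by rewrite !eqxx gtn_eqF.
  by case: (eqVneq m k.+1) => [->|mk1] /=; rewrite ?eqxx.
have k1 : k.+1 < n by lia. have k2 : k.+2 < n by lia.
have kd' : k.+1 + d.+2 = n by lia.
have := weight_swap k2 (weight_swap k1 (IH _ _ kd' (weight_swap k1 (weight_swap k2 w)))).
apply: weight_of_ext => m mn.
have e1 : (k == k.+1) = false by lia. have e2 : (k == k.+2) = false by lia.
have e3 : (k.+1 == k.+2) = false by lia. have e1' : (k.+1 == k) = false by lia.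
have e2' : (k.+2 == k) = false by lia. have e3' : (k.+2 == k.+1) = false by lia.
case: (eqVneq m k) => [->|mk]; rewrite ?(eqxx, e1, e2, e3, e1', e2', e3') //=.
case: (eqVneq m k.+1) => [->|mk1]; rewrite ?(eqxx, e1, e2, e3, e1', e2', e3') //=.
case: (eqVneq m k.+2) => [->|mk2]; rewrite ?(eqxx, e1, e2, e3, e1', e2', e3') //=.
Qed.

(** The longest element of the Weyl group of type D_n. Only even numbers of signs can change, so for
    odd [n] the last coordinate is kept. *)
Definition w0 (g : nat -> int) k : int := (if odd n && (k == (n - 1)%N) then g k else - g k)%R.

Lemma weight_w0 u g : weight_of u g -> weight_of u (w0 g).
Proof.
move=> w.
have H m : m.*2 <= n -> weight_of u (fun k => if (k < m.*2)%N then - g k else g k)%R.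
  elim: m => [|m IH] hm; first by apply: weight_of_ext w.
  have E : m.*2 + (n - m.*2 - 2).+2 = n by lia.
  have := weight_negpair E (IH _); move=> /(_ ltac:(lia)).
  apply: weight_of_ext => k kn; case: ltnP => h1; case: ltnP => h2 //=; try lia.
    by rewrite ifF //; lia.
  - by rewrite ifT //; lia.
  by rewrite ifF //; lia.
have := H n./2; rewrite -[X in _ <= X](odd_double_half n) leq_addl => /(_ isT).
apply: weight_of_ext => k kn; rewrite /w0; case: ltnP => h.
  by rewrite ifF //; apply/negbTE/negP => /andP[on]; lia.
by rewrite ifT //; lia.
Qed.

Lemma hgt_w0 g : hgt n (w0 g) = (- hgt n g)%R.
Proof.
rewrite /hgt -sumrN; apply: eq_bigr => k _; rewrite /w0; case: ifP => [/andP[_ /eqP ->]|_].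
  by rewrite (_ : n.-1 - (n - 1) = 0)%N; lia.
by rewrite mulNr.
Qed.

Lemma hgt_ups b c : wf b -> ups n eM b c -> (hgt n (g2 b) <= hgt n (g2 c))%R.
Proof.
move=> wb u; elim: u wb => // x i y z ni h _ IH wx.
by apply: le_trans (IH (eM_wf wx h)); rewrite (eM_hgt n2 ni wx h); lia.
Qed.

Lemma hgt_downs b c : wf b -> ups n fM b c -> (hgt n (g2 c) <= hgt n (g2 b))%R.
Proof.
move=> wb u; elim: u wb => // x i y z ni h _ IH wx.
apply: le_trans (IH (fM_wf wx h)) _.
by rewrite (eM_hgt n2 ni (fM_wf wx h) (fMK n2 ni wx h)); lia.
Qed.

(** The weight [w0] of [u] occurs at some [x] of the component, and [w0] of the weight of [low u]
    occurs too, at height at most that of [u]. As [w0] negates heights, [low u] is not lower than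
    [x], so the lowering path from [x] to [low u] is empty. *)
Lemma g2_low u k : wf u -> hw u -> k < n -> g2 (low u) k = w0 (g2 u) k.
Proof.
move=> wu hu kn; have wl := low_wf n2 wu.
have hl : high (low u) = u by rewrite high_low // high_id.
have sl := size_low n2 wu.
have [x [wx hx sx gx]] : weight_of u (w0 (g2 u)).
  by apply: weight_w0; exists u; split=> //; apply: high_id.
have [y [wy hy sy gy]] : weight_of u (w0 (g2 (low u))).
  by apply: weight_w0; exists (low u); split=> //.
have h1 : (hgt n (g2 y) <= hgt n (g2 u))%R by rewrite -hy; apply: hgt_ups (high_ups n2 wy).
rewrite (hgt_ext gy) hgt_w0 in h1.
have lx : low x = low u by rewrite -hx low_high.
have := low_ups n2 wx; rewrite lx => dx.
suff <- : x = low u by apply: gx.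
have hh : (hgt n (g2 x) <= hgt n (g2 (low u)))%R by rewrite (hgt_ext gx) hgt_w0; lia.
case: dx wx hh => // i b c ni h d wa hh; have wb := fM_wf wa h.
have := hgt_downs wb d; have := eM_hgt n2 ni wb (fMK n2 ni wa h); lia.
Qed.

(** Both sides are pairings of weights, since [ep] vanishes at [u] and [fp] at [low u]; and [w0]
    carries the coroot of [i] to minus that of [theta n i]. *)
Lemma fp_low u i : i < n -> wf u -> hw u -> ep (theta n i) (low u) = fp i u.
Proof.
move=> ni wu hu; have wl := low_wf n2 wu; have nt := theta_lt n2 ni.
have := wt_g2 n2 nt wl; have := wt_g2 n2 ni wu.
have -> : fp (theta n i) (low u) = 0 by exact: (fM_fpN n2 (low_lw n2 wu nt)).
have -> : ep i u = 0 by exact: (eM_epN n2 (hu i ni)).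
have p1 := pos_lt n2 ni; have p2 := pos_lt n2 nt.
rewrite !(g2_low wu hu) ?(ltnW p2) // /w0 /theta.
case: (boolP (odd n)) => on /=; last by lia.
have n3 : n != 2 by apply: contraTneq on => ->.
have e1 : (n - 2).+1 = n - 1 by lia. have e2 : (n - 1).+1 = n by lia.
have e3 : (n - 2 == n - 1) = false by lia.
have e4 : (n - 1 == n) = false by lia. have e5 : n - 1 < n by lia.
case: (eqVneq i (n - 2)) => i1.
  rewrite i1 /pos ?(e1, e2, e5, ltnn, eqxx, e3, e4); lia.
case: (eqVneq i (n - 1)) => i2.
  rewrite i2 /pos ?(e1, e2, e5, ltnn, eqxx, e3, e4); lia.
have i3 : i.+1 < n by lia.
rewrite /pos i3; have -> : (i == n - 1) = false by lia.
have -> : (i.+1 == n - 1) = false by lia. have -> : (i.+1 == n) = false by lia. lia.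
Qed.
End LowestWeight.

(** * The Schuetzenberger involution *)

Section Involution.
Variable n : nat.
Hypothesis n2 : 2 <= n.
Implicit Types (i j k : nat) (s : seq bool) (a b c d u : tens).
Local Notation ep := (ep n).
Local Notation fp := (fp n).
Local Notation eM := (eM n).
Local Notation fM := (fM n).
Local Notation wf := (wf n).
Local Notation high := (high n).
Local Notation low := (low n).
Local Notation hw := (hw n).
Local Notation lw := (lw n).
Local Notation theta := (theta n).

Lemma ep_fp_cat j a b : ep j (a ++ b) = ep j a + (ep j b - fp j a) /\
  fp j (a ++ b) = fp j b + (fp j a - ep j b).
Proof.
elim: a => [|s a [IH1 IH2]] /=; first by split; lia.
have := @ebpbF n j s; rewrite IH1 IH2.
case: eb => /= h; [rewrite h // | case: pb]; split; lia.
Qed.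

Lemma ep_cat j a b : ep j (a ++ b) = ep j a + (ep j b - fp j a).
Proof. by have [] := ep_fp_cat j a b. Qed.

Lemma fp_cat j a b : fp j (a ++ b) = fp j b + (fp j a - ep j b).
Proof. by have [] := ep_fp_cat j a b. Qed.

Lemma ep0_eM j b : ep j b = 0 -> eM j b = None.
Proof.
case: b => // s b; rewrite eM_cons /= => h.
have := @ebpbF n j s; case he: (eb n j s) => hp; rewrite ?he ?(hp isT) in h *; first by lia.
by case: ltnP => //; lia.
Qed.

(** Associativity of the tensor product: the recursion defining [eM] splits off a single letter
    only. *)
Lemma eM_cat j a b : eM j (a ++ b) =
  if fp j a < ep j b then omap (cat a) (eM j b) else omap (cat^~ b) (eM j a).
Proof.
elim: a => [|s a IH].
  rewrite [_ ++ _]/= [fp j _]/=; case: (posnP (ep j b)) => [/ep0_eM -> //|_].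
  by case: (eM j b).
rewrite cat_cons !eM_cons IH ep_cat /=.
have := @ebpbF n j s; case he: (eb n j s) => h.
  rewrite (h isT) /=.
  case: (ltnP (fp j a) (ep j b)) => h1.
    have -> : 0 < ep j a + (ep j b - fp j a) by lia.
    have -> : fp j a + (0 - ep j a) < ep j b by lia.
    by case: (eM j b).
  have -> : fp j a + (0 - ep j a) < ep j b = false by lia.
  have -> : (0 < ep j a + (ep j b - fp j a)) = (0 < ep j a) by lia.
  by case: ltnP => //; case: (eM j a).
case hp: (pb n j s) => /=.
  case: (ltnP (fp j a) (ep j b)) => h1.
    case: (ltnP (fp j a + (1 - ep j a)) (ep j b)) => h2.
      have -> : 1 < ep j a + (ep j b - fp j a) by lia.
      by case: (eM j b).
    have -> : 1 < ep j a + (ep j b - fp j a) = false by lia.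
    by have -> : 1 < ep j a = false by lia.
  have -> : fp j a + (1 - ep j a) < ep j b = false by lia.
  have -> : 1 < ep j a + (ep j b - fp j a) = (1 < ep j a) by lia.
  by case: ltnP => //; case: (eM j a).
rewrite addn0; case: (ltnP (fp j a) (ep j b)) => h1.
  have -> : 0 < ep j a + (ep j b - fp j a) by lia.
  by case: (eM j b).
have -> : (0 < ep j a + (ep j b - fp j a)) = (0 < ep j a) by lia.
by case: ltnP => //; case: (eM j a).
Qed.

(** The letter of weight [w0] of the weight of [s]; by [xi1] this is the Schuetzenberger involution
    on one factor. *)
Definition neg s : seq bool :=
  mkseq (fun k => nth false s k (+) ~~ (odd n && (k == n - 1))) n.

Definition eta b : tens := rev (map neg b).

Lemma size_neg s : size (neg s) = n.
Proof. by rewrite size_mkseq. Qed.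

Lemma nth_neg s k : k < n -> nth false (neg s) k = nth false s k (+) ~~ (odd n && (k == n - 1)).
Proof. by move=> kn; rewrite nth_mkseq. Qed.

Lemma negK s : size s = n -> neg (neg s) = s.
Proof.
move=> ss; apply: (@eq_from_nth _ false); rewrite ?size_neg ?ss // => k kn.
by rewrite !nth_neg // -addbA addbb addbF.
Qed.

Lemma flip_neg j s : j < n -> size s = n -> flip n j (neg s) = neg (flip n (theta j) s).
Proof.
move=> jn ss; apply: (@eq_from_nth _ false); rewrite ?size_neg ?size_flip // => k kn.
rewrite nth_flip ?size_neg // !nth_neg // nth_flip // addbAC; congr (_ (+) _ (+) _).
congr (_ && _); rewrite /theta; case: odd => //.
by rewrite /pos; case: (eqVneq j (n - 2)) => [->|j1]; last case: (eqVneq j (n - 1)) => [->|j2] //;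
  do 2 case: ifP => //; lia.
Qed.

Lemma lhi_llo_neg j s : j < n -> size s = n ->
  (lhi n j (neg s) = ~~ lhi n (theta j) s) /\ (llo n j (neg s) = ~~ llo n (theta j) s).
Proof.
move=> jn ss; have p1 := pos_lt n2 jn.
rewrite /lhi /llo !nth_neg ?(ltnW p1) // /theta.
case: (boolP (odd n)) => on /=; last by rewrite !addbT addNb.
have n3 : n != 2 by apply: contraTneq on => ->.
case: (eqVneq j (n - 2)) => j1.
  have -> : pos n j = n - 2 by rewrite /pos; case: ifP; lia.
  have -> : pos n (n - 1) = n - 2 by rewrite /pos; case: ifP; lia.
  have -> : (n - 2).+1 = n - 1 by lia.
  have -> : n - 2 == n - 1 = false by lia.
  rewrite eqxx j1; have -> : (n - 2).+1 == n = false by lia.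
  have -> : (n - 1).+1 == n by lia.
  by rewrite !addbT !addbF negbK.
case: (eqVneq j (n - 1)) => j2.
  have -> : pos n j = n - 2 by rewrite /pos; case: ifP; lia.
  have -> : pos n (n - 2) = n - 2 by rewrite /pos; case: ifP; lia.
  have -> : (n - 2).+1 = n - 1 by lia.
  have -> : n - 2 == n - 1 = false by lia.
  rewrite eqxx j2; have -> : n - 1 == n = false by lia.
  have -> : (n - 1).+1 == n by lia.
  by rewrite !addbT !addbF.
have -> : pos n j == n - 1 = false by rewrite /pos; case: ifP; lia.
have -> : (pos n j).+1 == n - 1 = false by rewrite /pos; case: ifP; lia.
by rewrite !addbT addNb.
Qed.

Lemma eb_neg j s : j < n -> size s = n -> eb n j (neg s) = pb n (theta j) s.
Proof. by move=> jn ss; rewrite /eb /pb; have [-> ->] := lhi_llo_neg jn ss; rewrite negbK. Qed.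

Lemma pb_neg j s : j < n -> size s = n -> pb n j (neg s) = eb n (theta j) s.
Proof. by move=> jn ss; rewrite /eb /pb; have [-> ->] := lhi_llo_neg jn ss; rewrite negbK. Qed.

Lemma eta_cons s b : eta (s :: b) = eta b ++ [:: neg s].
Proof. by rewrite /eta /= rev_cons -cats1. Qed.

Lemma eta_cat a b : eta (a ++ b) = eta b ++ eta a.
Proof. by rewrite /eta map_cat rev_cat. Qed.

Lemma eta_wf b : wf (eta b).
Proof. by rewrite /wf /eta all_rev all_map; apply/allP => s _ /=; rewrite size_neg. Qed.

Lemma size_eta b : size (eta b) = size b.
Proof. by rewrite size_rev size_map. Qed.

Lemma etaK b : wf b -> eta (eta b) = b.
Proof.
rewrite /eta map_rev revK -map_comp => wb; rewrite -[RHS]map_id; apply/eq_in_map => s sb /=.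
by apply: negK; apply/eqP; apply: (allP wb).
Qed.

Lemma ep_fp_eta j b : j < n -> wf b -> ep j (eta b) = fp (theta j) b /\ fp j (eta b) = ep (theta j) b.
Proof.
move=> jn; elim: b => // s b IH /andP[/eqP ss wb]; have [h1 h2] := IH wb.
rewrite eta_cons ep_cat fp_cat /= h1 h2 eb_neg // pb_neg //.
have := @ebpbF n (theta j) s; case: eb => /= h; [rewrite h // | case: pb]; split; lia.
Qed.

(** Reversing the factors exchanges the two alternatives of the tensor rule, and [neg] turns phi at
    [theta j] into epsilon at [j]. *)
Lemma eM_eta j b : j < n -> wf b -> eM j (eta b) = omap eta (fM (theta j) b).
Proof.
move=> jn; elim: b => // s b IH /andP[/eqP ss wb]; have [h1 h2] := ep_fp_eta jn wb.
rewrite eta_cons eM_cat h2 /= eb_neg // pb_neg // fM_cons IH // eM_cons /= ?eb_neg ?pb_neg //.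
case hp: (pb n (theta j) s) => /=.
  rewrite (pbebF hp) addn0 subn0; case: (ep _ b) => [|m] /=.
    by rewrite eta_cons flip_neg.
  by case: (fM _ b) => //= c; rewrite eta_cons.
by case: (fM _ b) => //= c; rewrite eta_cons.
Qed.

Lemma fM_eta j b : j < n -> wf b -> fM j (eta b) = omap eta (eM (theta j) b).
Proof.
move=> jn wb; have nt := theta_lt n2 jn.
have := eM_eta nt (eta_wf b); rewrite etaK // thetaK // => ->.
case E: (fM j (eta b)) => [c|] //=; rewrite etaK //.
exact: fM_wf (eta_wf b) E.
Qed.

Lemma eta_downs b c : wf b -> ups n fM b c -> ups n eM (eta b) (eta c).
Proof.
move=> wb u; elim: u wb => [x|x i y z ni h _ IH] wx; first exact: ups_refl.
have nt := theta_lt n2 ni; apply: (ups_step nt _ (IH (fM_wf wx h))).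
by rewrite eM_eta // thetaK // h.
Qed.

Lemma high_eta b : wf b -> high (eta b) = eta (low b).
Proof.
move=> wb; apply: high_unique => //; first exact: eta_wf.
  by apply: eta_downs => //; apply: low_ups.
by move=> i ni; rewrite eM_eta ?low_wf // (low_lw n2 wb (theta_lt n2 ni)).
Qed.
End Involution.

(** * The involution [xi] and the cactus generators *)

Section Cactus.
Variable n : nat.
Hypothesis n2 : 2 <= n.
Implicit Types (i j k : nat) (s : seq bool) (a b c u l x y : tens) (d : nat).
Local Notation ep := (ep n).
Local Notation fp := (fp n).
Local Notation eM := (eM n).
Local Notation fM := (fM n).
Local Notation wf := (wf n).
Local Notation high := (high n).
Local Notation low := (low n).
Local Notation hw := (hw n).
Local Notation lw := (lw n).
Local Notation theta := (theta n).
Local Notation eta := (eta n).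
Local Notation xi := (xi n).

(* The graph of the involution on the component of [u]. *)
Definition twist u := iso n fM (eM \o theta) u (low u).

Section Component.
Variable u : tens.
Hypotheses (wu : wf u) (hu : hw u).

Let hl : extremal n (fM \o theta) (low u).
Proof. by move=> i ni; apply: (low_lw n2 wu (theta_lt n2 ni)). Qed.

Let fpl i : i < n -> fp i u = (ep \o theta) i (low u).
Proof. by move=> ni; rewrite /= fp_low. Qed.

Let C := tens_stembridge n2.
Let C' := dual_theta n2.
Let wl := low_wf n2 wu.

Lemma twist_facts d x x' : twist u d x x' -> [/\ wf x, wf x', high x = u, high x' = u & size x' = size x].
Proof.
elim=> [|{x x'}d' i x x' y y' ni _ [wx wx' hx hx' sx] h h'].
  by split; rewrite ?high_low ?high_id ?size_low.
have nt := theta_lt n2 ni.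
split; first exact: fM_wf h.
- exact: eM_wf h'.
- by rewrite -(high_f n2 ni wx h).
- by rewrite -(high_e n2 nt wx' h').
by rewrite (eM_size h') (fM_size h).
Qed.

Lemma twist_fun d d1 x x' x'' : twist u d x x' -> twist u d1 x x'' -> x' = x''.
Proof. exact: (iso_fun C C' wu wl hu hl fpl). Qed.

Lemma twist_down d x x' i y : twist u d x x' -> i < n -> fM i x = Some y ->
  exists2 y', eM (theta i) x' = Some y' & twist u d.+1 y y'.
Proof. exact: (iso_down C C' wu wl hu hl fpl). Qed.

Lemma twist_fp d x x' i : twist u d x x' -> i < n -> ep i x = fp (theta i) x' /\ fp i x = ep (theta i) x'.
Proof. by case/(iso_facts C C' wu wl hu hl fpl)=> h _ _; apply: h. Qed.

Lemma twist_path p x : all (fun j => j < n) p -> path_down n p u = Some x ->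
  exists d x', foldr (fun j acc => obind (eT n (theta j)) acc) (Some (low u)) p = Some x' /\ twist u d x x'.
Proof.
elim: p x => [|j p IH] x /=.
  by move=> _ [<-]; exists 0, (low u); split => //; apply: iso0.
case/andP=> jn pn; rewrite -/(path_down n p u); case E: (path_down n p u) => [y|] //= hx.
have [d [y' [-> yy]]] := IH y pn E.
have [x' hx' xx] := twist_down yy jn hx; have [_ wy' _ _ _] := twist_facts yy.
by exists d.+1, x'; rewrite /= eTE ?theta_lt.
Qed.

(** Induction along the word leading to [x]. At its start [x' = low u], which no node lowers, so no
    node raises [x''] and [x''] is the highest weight element. *)
Lemma twistK d x x' d1 x'' : twist u d x x' -> twist u d1 x' x'' -> x'' = x.
Proof.
move=> xx; elim: xx d1 x'' => [|{x x'}{}d i z z' x x' ni zz IH h h'] d1 x'' xx'.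
  have [_ wx _ <- _] := twist_facts xx'; apply/esym; apply: high_id => // i ni.
  have nt := theta_lt n2 ni.
  have [_] := twist_fp xx' nt; rewrite thetaK // (fM_fpN n2 (low_lw n2 wu nt)) => /esym.
  exact: ep0_eM.
have [_ wx' _ _ _] := twist_facts xx'; have [_ wx'' _ _ _] := twist_facts xx'.
have nt := theta_lt n2 ni.
have [wz wz' _ _ _] := twist_facts zz.
have [_ wxx _ _ _] := twist_facts xx'.
have [z'' hz'' zz''] := twist_down xx' nt (eMK n2 nt wz' h').
rewrite thetaK // in hz''; have E := IH _ _ zz''; subst z''.
have := eMK n2 ni wxx hz''; rewrite h => -[] //.
Qed.
End Component.

(** [raise] records a word down from the highest weight element, and [twist_path] replays it upwards
    from the lowest one; so the default value in [xi] is never taken here. *)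
Lemma xi_twist b : wf b -> exists d, twist (high b) d b (xi b).
Proof.
move=> wb; rewrite /xi.
have [h1 h2 h3] := raiseP n2 wb (eht_bound n2 b); rewrite -/(high b) => h4.
have wu := high_wf n2 wb.
have [d [x' [e xx]]] := twist_path wu h2 h3 h4.
exists d; move: e xx; rewrite /high; case: (raise n (bound n b) b) h1 h2 wu => p u /= h1 h2 wu.
(* [xi] lowers [u] with the fuel [bound n b], while [low u] has fuel [bound n u]; the two agree
   because raising keeps the number of factors. *)
rewrite /low /bound -(ups_size h1) => -> //.
Qed.

Lemma xi_facts b : wf b -> [/\ wf (xi b), high (xi b) = high b & size (xi b) = size b].
Proof.
move=> wb; have wu := high_wf n2 wb; have [d xx] := xi_twist wb.
by have [_ h1 _ h2 h3] := twist_facts wu (high_hw n2 wb) xx.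
Qed.

Lemma xi_wf b : wf b -> wf (xi b). Proof. by case/xi_facts. Qed.

Lemma high_xi b : wf b -> high (xi b) = high b. Proof. by case/xi_facts. Qed.

Lemma size_xi b : wf b -> size (xi b) = size b. Proof. by case/xi_facts. Qed.

Lemma xiK b : wf b -> xi (xi b) = b.
Proof.
move=> wb; have wu := high_wf n2 wb; have hu := high_hw n2 wb.
have [d xx] := xi_twist wb; have [d1] := xi_twist (xi_wf wb).
by rewrite high_xi // => /(twistK wu hu xx).
Qed.

Lemma xi_hw u : wf u -> hw u -> xi u = low u.
Proof.
move=> wu hu; have [d xx] := xi_twist wu; rewrite high_id // in xx.
by apply: (twist_fun wu hu xx); apply: iso0.
Qed.

Lemma xi_lw b : wf b -> lw b -> xi b = high b.
Proof.
move=> wb lb; have wh := high_wf n2 wb.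
have E : xi (high b) = b by rewrite (xi_hw wh (high_hw n2 wb)) low_high // low_id.
by rewrite -{1}E xiK.
Qed.

(** On one factor [eta] intertwines raising and lowering just as [xi] does, so it is enough to
    compare them at the highest weight element, where the weight determines the letter. *)
Lemma xi1 s : size s = n -> xi [:: s] = [:: neg n s].
Proof.
move=> ss; have wb : wf [:: s] by rewrite /= ss eqxx.
have wu := high_wf n2 wb; have hu := high_hw n2 wb.
have [d] := xi_twist wb; have := size_high n2 wb.
move: (high [:: s]) wu hu => u wu hu su xx.
have [_ _ hx _ _] := twist_facts wu hu xx.
suff [d1 h1] : exists d1, twist u d1 [:: s] (eta [:: s]) by rewrite (twist_fun wu hu xx h1).
have E : low u = eta u.
  have wl := low_wf n2 wu; have := size_low n2 wu; rewrite su.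
  case: u su wu hu wl {xx hx} => [|t [|]] // _ wu hu; case El: (low _) => [|t' [|]] // wl _.
  rewrite /eta /= /rev /=; congr [:: _].
  move: wu wl => /= /andP[/eqP st _] /andP[/eqP st' _].
  apply: (@eq_from_nth _ false); rewrite ?size_neg // st' => k kn.
  have wt' : wf [:: t] by rewrite /= st eqxx.
  have := g2_low n2 wt' hu kn; rewrite El !g2_cons /w0 !g2_cons nth_neg //.
  by case: (odd n && _); case: nth; case: nth.
elim: xx => [|{}d i x x' y y' ni xx [d1 IH] h h'].
  by exists 0; rewrite -E; apply: iso0.
have [wx _ _ _ _] := twist_facts wu hu xx; have nt := theta_lt n2 ni.
exists d1.+1; apply: (isoS ni IH h).
by rewrite /= eM_eta // thetaK // h.
Qed.

(** In each step the inner [xi] of the commutor cancels the outer [xi] left by the previous step,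
    and on the new single factor [xi] is [neg]; only [eta] grows. *)
Lemma s_aux_eta m p q b : wf b -> 0 < p -> p + m = q -> q <= size b ->
  s_aux n m p q b = take p.-1 b ++ xi (eta (take m.+1 (drop p.-1 b))) ++ drop q b.
Proof.
elim: m p => [|m IH] p wb p0 pq qb.
  have hp : p.-1 < size b by lia.
  have sz : size (nth [::] b p.-1) = n by apply/eqP/(allP wb)/mem_nth.
  rewrite /= -{1}(cat_take_drop p.-1 b) (drop_nth [::] hp) prednK // /= take0.
  rewrite (_ : eta [:: nth [::] b p.-1] = [:: neg n (nth [::] b p.-1)]) //.
  by rewrite xi1 ?size_neg // negK //; have -> : q = p by lia.
rewrite /= IH //; try lia.
set t := take m.+1 _; have wdrop r : wf (drop r b).
  by apply/allP => x /mem_drop; apply: (allP wb).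
have wt : wf t by apply/allP => x /mem_take; apply: (allP (wdrop _)).
have st : size t = m.+1 by rewrite size_take size_drop; case: ltnP; lia.
have wet := eta_wf n t; have wxt := xi_wf wet.
have sxt : size (xi (eta t)) = m.+1 by rewrite size_xi // size_eta.
have hp : p.-1 < size b by lia.
have sz : size (nth [::] b p.-1) = n by apply/eqP/(allP wb)/mem_nth.
have sp : size (take p.-1 b) = p.-1 by rewrite size_take; case: ltnP; lia.
have Et : take p b = take p.-1 b ++ [:: nth [::] b p.-1].
  by rewrite -{1}(prednK p0) (take_nth [::] hp) cats1.
have Ed : take m.+2 (drop p.-1 b) = nth [::] b p.-1 :: t.
  by rewrite (drop_nth [::] hp) prednK.
rewrite Ed /sigma_prq Et -!catA take_size_cat // drop_size_cat //; congr (_ ++ _).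
rewrite catA catA [X in _ ++ X]drop_size_cat; last by rewrite !size_cat sp sxt /=; lia.
have -> : q - p + 1 = m.+2 by lia.
have -> : p - p + 1 = 1 by lia.
rewrite take_size_cat; last by rewrite /= sxt.
congr (_ ++ _); rewrite /sigmaAB /= drop0 take0 xiK // xi1 // -eta_cons //.
Qed.

(* [s_{1,q}], acting on the first [q] factors. *)
Lemma s_pq_eta q b : wf b -> q <= size b -> s_pq n 1 q b = xi (eta (take q b)) ++ drop q b.
Proof.
move=> wb qb; rewrite /s_pq; case: q qb => [|q] qb.
  by rewrite take0 drop0; have /size0nil -> : size (xi (eta [::])) = 0 by rewrite size_xi.
by rewrite subn1 s_aux_eta //= take0 drop0.
Qed.

(** [s_pq n 1 0] and [s_pq n 1 1] are identities, so the exceptional formulas for [i = 1] and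
    [i = 2] are instances of the general one. *)
Lemma T_s_pq i b : 0 < i -> wf b -> i < size b ->
  T n i b = s_pq n 1 i (s_pq n 1 i.+1 (s_pq n 1 i (s_pq n 1 i.-1 b))).
Proof.
move=> i0 wb ib; have s11 c : s_pq n 1 1 c = c by [].
have s10 c : s_pq n 1 0 c = c by [].
rewrite /T; case: (eqVneq i 1) => [->|i1]; first by rewrite s11 s11 s10.
by case: (eqVneq i 2) => [->|i2] //; rewrite s11.
Qed.

End Cactus.

(** * The operators T_i on tensors with a highest weight prefix *)

Section LocalRule.
Variable n : nat.
Hypothesis n2 : 2 <= n.
Implicit Types (i j k : nat) (s : seq bool) (a b c u l x y : tens) (d : nat).
Local Notation ep := (ep n).
Local Notation fp := (fp n).
Local Notation eM := (eM n).
Local Notation fM := (fM n).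
Local Notation wf := (wf n).
Local Notation high := (high n).
Local Notation low := (low n).
Local Notation hw := (hw n).
Local Notation lw := (lw n).
Local Notation theta := (theta n).
Local Notation eta := (eta n).
Local Notation xi := (xi n).

Lemma hwP b : hw b <-> forall j, j < n -> ep j b = 0.
Proof.
split=> h j jn; first exact: (eM_epN n2 (h j jn)).
exact: ep0_eM (h j jn).
Qed.

Lemma hw_catl a b : hw (a ++ b) -> hw a.
Proof. by move/hwP=> h; apply/hwP => j /h; rewrite (ep_cat n2); lia. Qed.

Lemma hw_catr a b : hw (a ++ b) <-> hw a /\ forall j, j < n -> ep j b <= fp j a.
Proof.
split=> [h|[/hwP h1 h2]].
  have ha := hw_catl h; split=> // j jn; move/hwP: h => /(_ j jn).
  by rewrite (ep_cat n2); lia.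
by apply/hwP => j jn; rewrite (ep_cat n2) h1 //; have := h2 j jn; lia.
Qed.

(** Each raising acts on one of the two parts and leaves both of them in their components. *)
Lemma high_cat a b : wf a -> wf b -> exists a' b',
  [/\ high (a ++ b) = a' ++ b', wf a' /\ wf b', size a' = size a /\ size b' = size b,
      high a' = high a & high b' = high b].
Proof.
move=> wa wb; have wab : wf (a ++ b) by rewrite wf_cat wa.
have := high_ups n2 wab; move: (high _) => z.
move E: (a ++ b) => ab u; elim: u a b wa wb E {wab} => [x|x i y {}z ni h _ IH] a b wa wb E.
  by exists a, b.
move: h; rewrite -E (eM_cat n2); case: ifP => _.
  case h: (eM i b) => [c|] //= -[Ey]; have wc := eM_wf wb h.
  have [a' [b' [h1 h2 h3 h4 h5]]] := IH a c wa wc Ey.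
  by exists a', b'; rewrite -(eM_size h) (high_e n2 ni wb h).
case h: (eM i a) => [c|] //= -[Ey]; have wc := eM_wf wa h.
have [a' [b' [h1 h2 h3 h4 h5]]] := IH c b wc wb Ey.
by exists a', b'; rewrite -(eM_size h) (high_e n2 ni wa h).
Qed.

Lemma lw_eta b : wf b -> hw b -> lw (eta b).
Proof. by move=> wb hb j jn; rewrite fM_eta // (hb _ (theta_lt n2 jn)). Qed.

(* [s_{1,q}] on highest weight elements with [q] factors. *)
Definition rot b := eta (low b).

Lemma xi_eta b : wf b -> hw b -> xi (eta b) = rot b.
Proof. by move=> wb hb; rewrite xi_lw ?high_eta //; [apply: eta_wf | apply: lw_eta]. Qed.

Lemma rot_wf b : wf (rot b).
Proof. exact: eta_wf. Qed.

Lemma rot_hw b : wf b -> hw b -> hw (rot b).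
Proof. by move=> wb hb j jn; rewrite eM_eta ?low_wf // (low_lw n2 wb (theta_lt n2 jn)). Qed.

Lemma size_rot b : wf b -> size (rot b) = size b.
Proof. by move=> wb; rewrite size_eta size_low. Qed.

Lemma fp_rot j b : j < n -> wf b -> hw b -> fp j (rot b) = fp j b.
Proof.
move=> jn wb hb; have [_ ->] := ep_fp_eta n2 jn (low_wf n2 wb).
exact: fp_low.
Qed.

Lemma g2_eta b k : k < n -> wf b -> g2 (eta b) k = w0 n (g2 b) k.
Proof.
move=> kn; elim: b => [|s b IH] /=; first by rewrite /w0; case: ifP.
move=> /andP[/eqP ss wb]; rewrite eta_cons g2_cat IH // /w0 !g2_cons nth_neg //.
by case: (odd n && _); case: nth; rewrite /= /g2 /=; lia.
Qed.

Lemma g2_rot b k : k < n -> wf b -> hw b -> g2 (rot b) k = g2 b k.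
Proof.
move=> kn wb hb; rewrite g2_eta ?low_wf // /w0 !(g2_low n2 wb hb) // /w0.
by case: (odd n && _) => /=; lia.
Qed.

Lemma rot_high_eta x : wf x -> rot (high (eta x)) = high x.
Proof. by move=> wx; rewrite /rot low_high ?eta_wf // -high_eta ?eta_wf // etaK. Qed.

(** All four operators [s_pq] act by [rot] on a prefix of highest weight. The last two clauses hold
    because [rot] preserves weights and the values of [fp] of such prefixes. *)
Lemma T_rot a (y y' : seq bool) l i : i = (size a).+1 -> wf (a ++ y :: y' :: l) -> hw (a ++ [:: y; y']) ->
  exists v a' z,
  [/\ T n i (a ++ y :: y' :: l) = high (a' ++ [:: y']) ++ z :: l,
      [/\ size v = n, wf a', size a' = size a & high a' = a], hw (v :: a') /\ size z = n,
      forall j, j < n -> fp j (v :: a') = fp j (a ++ [:: y])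
    & forall k, k < n -> (g2 (high (a' ++ [:: y'])) k + g2 [:: z] k = g2 (a ++ [:: y; y']) k)%R].
Proof.
have l0 m k : m <= m + k by lia.
have l2 m k : m.+1 < m + k.+2 by lia.
move=> si wb hb; have hay : hw (a ++ [:: y]) by apply: (@hw_catl _ [:: y']); rewrite -catA.
have ha : hw a by apply: hw_catl hay.
have [wa [sy [sy' wl]]] : wf a /\ size y = n /\ size y' = n /\ wf l.
  by move: wb; rewrite wf_cat => /andP[? /= /and3P[/eqP ? /eqP ? ?]].
have w1 s : size s = n -> wf [:: s] by move=> /= ->; rewrite eqxx.
have way : wf (a ++ [:: y]) by rewrite wf_cat wa w1.
set ra := rot a; have wra : wf ra := rot_wf a.
have hra : hw (ra ++ [:: y]).
  apply/hw_catr; split; first exact: rot_hw.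
  by move=> j jn; rewrite fp_rot //; apply: ((hw_catr _ _).1 hay).2.
have wray : wf (ra ++ [:: y]) by rewrite wf_cat wra w1.
set U := rot (ra ++ [:: y]).
have wU : wf U := rot_wf _.
have fray j : j < n -> fp j (ra ++ [:: y]) = fp j (a ++ [:: y]).
  by move=> jn; rewrite !(fp_cat n2) fp_rot.
have fU j : j < n -> fp j U = fp j (a ++ [:: y]).
  by move=> jn; rewrite fp_rot // fray.
have hUy : hw (U ++ [:: y']).
  apply/hw_catr; split; first exact: rot_hw.
  move=> j jn; rewrite fU //; apply: ((hw_catr (a ++ [:: y]) [:: y']).1 _).2 => //.
  by rewrite -catA.
have wUy : wf (U ++ [:: y']) by rewrite wf_cat wU w1.
(* The outer [eta] undoes the one in [rot a] and carries [y] to the front as [neg n y]. *)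
have EU : U = high ([:: neg n y] ++ low a).
  by rewrite /U /rot -high_eta // eta_cat /ra /rot etaK // low_wf.
have [|u' [a' [E1 [wu' wa'] [su' sa'] _ ha']]] := @high_cat [:: neg n y] (low a) _ (low_wf n2 wa).
  by rewrite w1 ?size_neg.
rewrite -EU in E1; case: u' su' wu' E1 => [|v [|]] // _ /andP[/eqP sv _] E1.
have {}ha' : high a' = a by rewrite ha' high_low // high_id.
rewrite (size_low n2 wa) in sa'.
have wx : wf (a' ++ [:: y']) by rewrite wf_cat wa' w1.
(* Now [v] is carried to the right end, so the first [i] factors stay in the component of [eta (a'
   ++ [:: y'])], and the final [rot] turns this into the component of [a' ++ [:: y']]. *)
have E2 : rot (U ++ [:: y']) = high (eta (a' ++ [:: y']) ++ [:: neg n v]).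
  by rewrite /rot -high_eta // E1 -eta_cons -cat_cons.
have [|w' [z [E3 [ww wz] [sw sz] hhw _]]] := @high_cat (eta (a' ++ [:: y'])) [:: neg n v] (eta_wf _ _).
  by rewrite w1 ?size_neg.
case: z sz wz E3 => [|z [|]] // _ /andP[/eqP sz _] E3.
have hw' : hw w' by apply: (@hw_catl _ [:: z]); rewrite -E3; apply: high_hw => //; rewrite wf_cat eta_wf w1 ?size_neg.
have Er : rot w' = high (a' ++ [:: y']).
  by rewrite -rot_high_eta // -hhw high_id.
have sU : size U = i by rewrite size_rot // size_cat size_rot // si addn1.
have sw' : size w' = i by rewrite sw size_eta size_cat sa' si addn1.
have hv : hw (v :: a') by have := rot_hw wray hra; rewrite -/U E1.
exists v, a', z; split; [| by split | by split | by move=> j jn; rewrite -fU // E1|].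
- rewrite T_s_pq ?si //; last by rewrite size_cat l2.
  rewrite [s_pq n 1 (size a).+1.-1 _](s_pq_eta n2) //; last by rewrite size_cat l0.
  rewrite /= take_size_cat // drop_size_cat // xi_eta // -/ra.
  have sra : size ra = size a by rewrite size_rot.
  have sray : size (ra ++ [:: y]) = (size a).+1 by rewrite size_cat sra addn1.
  have sUy : size (U ++ [:: y']) = (size a).+2 by rewrite size_cat sU si addn1.
  rewrite -(cat1s y (y' :: l)) catA [s_pq _ _ _ (_ ++ y' :: l)](s_pq_eta n2); first last.
  + by rewrite size_cat sray l0.
  + by rewrite wf_cat wray /= sy' eqxx.
  rewrite take_size_cat // drop_size_cat // xi_eta // -/U.
  rewrite -(cat1s y' l) catA [s_pq _ _ (size a).+2 _](s_pq_eta n2); first last.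
  + by rewrite size_cat sUy l0.
  + by rewrite wf_cat wUy.
  rewrite take_size_cat // drop_size_cat // xi_eta // E2 E3.
  rewrite -catA (s_pq_eta n2); first last.
  + by rewrite size_cat sw' si l0.
  + by rewrite wf_cat ww /= sz eqxx.
  by rewrite take_size_cat ?drop_size_cat ?sw' ?si // xi_eta // Er.
move=> k kn; rewrite -Er g2_rot // -g2_cat -E3 -E2 g2_rot // g2_cat g2_rot // g2_cat g2_rot //.
by rewrite -[[:: y; y']]/([:: y] ++ [:: y']) catA !g2_cat.
Qed.
End LocalRule.

(** * Eliminating the auxiliary letter in front *)

Section Straightening.
Variable n : nat.
Hypothesis n2 : 2 <= n.
Implicit Types (i j k : nat) (s : seq bool) (a b c u l x y : tens) (d : nat).
Local Notation ep := (ep n).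
Local Notation fp := (fp n).
Local Notation eM := (eM n).
Local Notation fM := (fM n).
Local Notation wf := (wf n).
Local Notation high := (high n).
Local Notation low := (low n).
Local Notation hw := (hw n).
Local Notation lw := (lw n).
Local Notation theta := (theta n).
Local Notation eta := (eta n).
Local Notation xi := (xi n).


(* For a highest weight element [v :: x], lowering [v] and raising [x] by the
   same node keeps [ep k x <= pb k v]; the invariant also records that every
   shorter way of lowering the initial letter to [v] is mirrored on [x]. *)
Fixpoint mirror (m : nat) (v : seq bool) x : Prop :=
  (forall k, k < n -> ep k x <= pb n k v) /\
  if m is m'.+1 then
    forall k, k < n -> eb n k v -> exists2 x', fM k x = Some x' & mirror m' (flip n k v) x'
  else True.

Lemma mirror_ep m v x k : mirror m v x -> k < n -> ep k x <= pb n k v.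
Proof. by case: m => [|m] [h _]; apply: h. Qed.

Lemma mirror_le m v x : mirror m.+1 v x -> mirror m v x.
Proof.
elim: m v x => [|m IH] v x [h1 h2]; split=> // k kn ek.
by have [x' h /IH h'] := h2 k kn ek; exists x'.
Qed.

Lemma mirror_hw m v a : hw (v :: a) -> mirror m v a.
Proof.
move=> /(hwP n2) h; have h1 k : k < n -> eb n k v = false /\ ep k a <= pb n k v.
  by move=> /h /=; have := @ebpbF n k v; case: eb => [->//|_]; case: pb; split; lia.
case: m => [|m]; split=> // k kn; first exact: (h1 k kn).2.
- exact: (h1 k kn).2.
- by rewrite (h1 k kn).1.
Qed.

Lemma mirror_step_ep m v x j y k : size v = n -> wf x -> j < n -> pb n j v -> eM j x = Some y ->
  mirror m.+1 v x -> k < n -> ep k y <= pb n k (flip n j v).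
Proof.
move=> sv wx jn pj hy I kn; have wy := eM_wf wx hy.
have sf := size_flip n j v; have ef : eb n j (flip n j v) by rewrite eb_flip.
have ff : flip n j (flip n j v) = v by rewrite flipK.
have jx : ep j x = (ep j y).+1 := eM_ep n2 jn wx hy.
have kx := mirror_ep I kn.
case: (eqVneq j k) => [E|jk].
  subst k; move: kx; rewrite jx pj pb_flip //; case: (ep j y) => //.
case: (boolP (adj n j k)) => ajk; last first.
  have [_ pk] := flip_orth n2 jn kn sf jk ajk ef.
  by rewrite ff in pk; rewrite -pk (eM_orth n2 jn kn jk ajk wx hy).
have [_ ek pk] := flip_adj n2 jn kn sf ajk ef; rewrite ff in ek pk.
have [_ ->] := eM_tt n2 jn kn ajk wx hy; move: kx; rewrite pk leqn0 => /eqP ->.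
case pf: (pb n k (flip n j v)) ek => /= ek; first by case: (0 <= _)%R.
(* Step back at [k] to [x' = f_k x]: there the bound at [j] gives [ep j x' = 0]. So [e_k] raised
   [ep j] from 0, and the resulting sign of [tt] at [x] keeps [e_j] from raising [ep k]. *)
case: I => _ /(_ k kn ek) [x' hx' I'].
have akj : adj n k j by rewrite adjC.
have wx' := fM_wf wx hx'; have hx := fMK n2 kn wx hx'.
have [_ _ pj'] := flip_adj n2 kn jn sv akj ek.
have := mirror_ep I' jn; rewrite pj' leqn0 => /eqP jx'.
have [t1 e1] := eM_tt n2 kn jn akj wx' hx.
rewrite (tt_anti n2 kn jn wx akj) t1.
clear -jx jx' e1; lia.
Qed.

Lemma mirror_step m v x j y : size v = n -> wf x -> j < n -> pb n j v -> eM j x = Some y ->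
  mirror m.+1 v x -> mirror m (flip n j v) y.
Proof.
elim: m v x y => [|m IH] v x y sv wx jn pj hy I.
  by split=> // k; apply: mirror_step_ep hy I.
split=> [k|k kn ek]; first exact: mirror_step_ep hy I.
have wy := eM_wf wx hy.
have sf := size_flip n j v; have ef : eb n j (flip n j v) by rewrite eb_flip.
have ff : flip n j (flip n j v) = v by rewrite flipK.
case: (eqVneq j k) => [E|jk].
  subst k; exists x; first exact: (eMK n2 jn wx hy).
  by rewrite ff; apply/mirror_le/mirror_le.
case: (boolP (adj n j k)) => ajk.
  by have [] := flip_adj n2 jn kn sf ajk ef; rewrite ek.
have kj : k != j by rewrite eq_sym.
have akj : ~~ adj n k j by rewrite adjC.
have [ek' _] := flip_orth n2 jn kn sf jk ajk ef; rewrite ff ek in ek'.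
have [_ pj'] := flip_orth n2 kn jn sv kj akj ek'; rewrite pj in pj'.
case: I => _ /(_ k kn ek') [x' hx' I'].
have wx' := fM_wf wx hx'; have hx := fMK n2 kn wx hx'.
have [y' hy'] : exists y', eM j x' = Some y'.
  apply: (eM_some n2); rewrite -(eM_orth n2 kn jn kj akj wx' hx).
  by rewrite (eM_ep n2 jn wx hy).
have := sq_orth n2 kn jn kj akj wx' hx hy'; rewrite hy => /esym e1.
exists y'; first exact: (eMK n2 kn (eM_wf wx' hy') e1).
by rewrite flipC //; apply: IH hy' I' => //; apply: size_flip.
Qed.

(** The last hypothesis depends only on the total weight of [v] and [x], which is constant while [x]
    goes up and [v] goes down. With [ep j x <= pb n j v] it makes every raising of [x] also the
    action of [e_j] on [x ++ [:: y]]. *)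
Lemma mirror_high v x (y : seq bool) : size v = n -> wf x -> size y = n ->
  (forall m, mirror m v x) ->
  (forall j, j < n -> eb n j y + ep j x + eb n j v <= fp j x + pb n j v) ->
  high (x ++ [:: y]) = high (high x ++ [:: y]).
Proof.
move=> sv wx sy; have [m] := ubnP (eht n x); elim: m x v sv wx => // m IH x v sv wx hm I w.
have wxy : wf (x ++ [:: y]) by rewrite wf_cat wx /= sy eqxx.
have hu := high_ups n2 wx; move E: (high x) hu => u hu.
case: hu E => [|j x1 {}u jn hx hu] E; first by [].
have jx := eM_ep n2 jn wx hx; have wx1 := eM_wf wx hx.
have := mirror_ep (I 0) jn; rewrite jx => pj0.
have pj : pb n j v by case: (pb n j v) pj0.
have ej := pbebF pj.
have wj := w j jn.
have sf := size_flip n j v; have ef : eb n j (flip n j v) by rewrite eb_flip.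
have ff : flip n j (flip n j v) = v by rewrite flipK.
have e1 : eM j (x ++ [:: y]) = Some (x1 ++ [:: y]).
  rewrite (eM_cat n2) ifF ?hx //=; move: wj; rewrite jx pj ej; case: eb => /=; clear; lia.
rewrite (high_e n2 jn wxy e1) -E (high_e n2 jn wx hx).
apply: (IH x1 (flip n j v)) => //.
- by have := eM_eht n2 jn wx hx; clear -hm; lia.
- by move=> k; apply: mirror_step (I k.+1).
move=> k kn; case: (eqVneq j k) => [jk|jk].
  subst k; rewrite eb_flip // pb_flip // pj ej.
  have := st_fp (tens_stembridge n2) jn wx1 (eMK n2 jn wx hx).
  move: wj; rewrite jx pj ej; clear; lia.
have := eM_wt n2 jn kn jk wx hx; have := w k kn.
case: (boolP (adj n j k)) => ajk.
  have [_ ek pk] := flip_adj n2 jn kn sf ajk ef; rewrite ff in ek pk.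
  have := @ebpbF n k (flip n j v).
  have -> : eb n k (flip n j v) = false by have [] := flip_adj n2 jn kn sf ajk ef.
  rewrite ek pk; case: pb => /=; clear; lia.
have [ek pk] := flip_orth n2 jn kn sf jk ajk ef; rewrite ff in ek pk.
by rewrite ek pk; clear; lia.
Qed.

(** No node raises [a], and [e_j] reaches the last letter only if [fp j a = 0], that is, if the
    reflection in [j] fixes the weight of [a]. [Q] stands for any property of the letter preserved
    by these moves. *)
Lemma high_right a (y : seq bool) (Q : seq bool -> Prop) : wf a -> hw a -> size y = n -> Q y ->
  (forall j s, j < n -> size s = n -> fp j a = 0 -> eb n j s -> Q s -> Q (flip n j s)) ->
  exists c : seq bool, [/\ high (a ++ [:: y]) = a ++ [:: c], size c = n, Q c &
    forall j, j < n -> fp j a = 0 -> eb n j c = false].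
Proof.
move=> wa ha sy qy step.
have way s : size s = n -> wf (a ++ [:: s]) by move=> ss; rewrite wf_cat wa /= ss eqxx.
suff [c [h1 h2 h3]] : exists c : seq bool, [/\ high (a ++ [:: y]) = a ++ [:: c], size c = n & Q c].
  exists c; split=> // j jn fj; have := high_hw n2 (way y sy) jn; rewrite h1 => /(eM_epN n2).
  by rewrite (ep_cat n2) fj /=; have := @ebpbF n j c; case: eb => // -> //; clear; lia.
have := high_ups n2 (way y sy); move: (high _) => u.
move E: (a ++ [:: y]) => b hu; elim: hu y sy qy E => [{}b|{}b j b1 {}u jn hb hu IH] y sy qy E.
  by exists y.
move: hb; rewrite -E (eM_cat n2) (ha j jn) /=; case: ifP => // lt.
rewrite eM_cons /= in lt *; case ey: (eb n j y) lt => lt //.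
rewrite /= => -[E1].
have fj : fp j a = 0 by move: lt; rewrite (ebpbF ey); clear; lia.
by apply: (IH (flip n j y)) => //; [apply: size_flip | apply: step].
Qed.
End Straightening.

(** * Weights as column lengths *)

Section Columns.
Variable n : nat.
Hypothesis n2 : 2 <= n.
Implicit Types (i j k : nat) (s : seq bool) (a b u l x : tens) (c d : nat).
Local Notation ep := (ep n).
Local Notation fp := (fp n).
Local Notation eM := (eM n).
Local Notation fM := (fM n).
Local Notation wf := (wf n).
Local Notation high := (high n).
Local Notation low := (low n).
Local Notation hw := (hw n).
Local Notation lw := (lw n).
Local Notation theta := (theta n).
Local Notation eta := (eta n).
Local Notation xi := (xi n).



Lemma T_local a (y y' : seq bool) l (Q : seq bool -> Prop) :
  wf (a ++ y :: y' :: l) -> hw (a ++ [:: y; y']) -> Q y' ->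
  (forall j s, j < n -> size s = n -> fp j a = 0 -> eb n j s -> Q s -> Q (flip n j s)) ->
  exists c z : seq bool, [/\ T n (size a).+1 (a ++ y :: y' :: l) = a ++ c :: z :: l,
    size c = n /\ size z = n, Q c,
    forall j, j < n -> fp j a = 0 -> eb n j c = false &
    forall k, k < n -> nth false c k + nth false z k = nth false y k + nth false y' k].
Proof.
move=> wb hb qy step.
have [wa [sy [sy' wl]]] : wf a /\ size y = n /\ size y' = n /\ wf l.
  by move: wb; rewrite wf_cat => /andP[? /= /and3P[/eqP ? /eqP ? ?]].
have hay : hw (a ++ [:: y]) by apply: (@hw_catl _ n2 _ [:: y']); rewrite -catA.
have ha : hw a by apply: (hw_catl n2 hay).
have [v [a' [z [E1 [sv wa' sa' ha'] [hv sz] fv g]]]] := T_rot n2 (erefl _) wb hb.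
have mv m : mirror n m v a' := mirror_hw n2 m hv.
have E2 : high (a' ++ [:: y']) = high (a ++ [:: y']).
  (* The required inequality says that [y'] can follow a highest weight element of the weight of [a
     ++ [:: y]], which is also the weight of [v :: a']. *)
  rewrite -ha'; apply: (mirror_high n2 sv wa' sy' mv) => j jn.
  have := mirror_ep (mv 0) jn.
  have hb' : hw ((a ++ [:: y]) ++ [:: y']) by rewrite -catA.
  have := ((hw_catr n2 _ _).1 hb').2 j jn; rewrite -fv //=.
  have := (hwP n2 _).1 hv j jn => /=.
  have := @ebpbF n j v; have := @ebpbF n j y'.
  case: (eb n j v); case: (eb n j y') => h1 h2; rewrite ?(h1 isT) ?(h2 isT) /=; clear; lia.
have [c [E3 sc qc tc]] := high_right n2 wa ha sy' qy step.
exists c, z; split=> //; first by rewrite E1 E2 E3 -catA.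
move=> k kn; have := g k kn; rewrite E2 E3 -[[:: y; y']]/([:: y] ++ [:: y']) !g2_cat !g2_cons.
by do 4 case: nth => //=; rewrite /g2 /=; lia.
Qed.

(** [ep j] of the product is at most 1 and comes from the last letter; if it were 1, then [fp j a]
    would vanish and the weight would pair to -1 with the coroot. *)
Lemma dominant_hw a s : wf (a ++ [:: s]) -> hw a -> dominant n (a ++ [:: s]) -> hw (a ++ [:: s]).
Proof.
move=> was ha /andP[/forallP dom1 dom2]; apply/(hw_catr n2); split=> // j jn.
have w : (0 <= g2 (a ++ [:: s]) (pos n j) +
    (if j.+1 == n then 1 else -1) * g2 (a ++ [:: s]) (pos n j).+1)%R.
  rewrite /pos; case: (ltnP j.+1 n) => j1.
    have -> : (j.+1 == n) = false by lia.
    by have := dom1 (Ordinal jn); rewrite /= j1 /=; lia.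
  have -> : j.+1 == n by lia.
  have -> : (n - 2).+1 = n - 1 by lia.
  by rewrite mul1r.
have := wt_g2 n2 jn was; have ea := (hwP n2 _).1 ha j jn.
rewrite (ep_cat n2) (fp_cat n2) ea /=; move: w; set x := (g2 _ _ + _)%R.
have := @ebpbF n j s; case: (eb n j s) => h; rewrite ?(h isT) /=; clear; lia.
Qed.

(* Column [c] of the tableau gets a cell from the factor [s]. *)
Definition cell s c := if odd n && (c == 1) then nth false s (n - 1) else ~~ nth false s (n - c).
Definition colh b c := count (cell^~ c) b.

Lemma col_diag b c : 0 < c <= n -> Defs.col (diag n b) c = colh b c.
Proof.
move=> cn; rewrite /Defs.col /diag (nth_map 0) ?size_iota; last lia.
rewrite nth_iota; last lia.
have -> : 1 + c.-1 = c by lia.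
by rewrite /colh /cell /nplus /nminus; case: ifP.
Qed.

(* Node [0] removes a pair of cells from the first two columns; node [c > 0]
   moves a cell from column [c + 1] to column [c]. *)
Definition node c := theta (n - c.+1).

Lemma node_lt c : c < n -> node c < n.
Proof. by move=> cn; apply: theta_lt => //; lia. Qed.

Lemma node_surj j : j < n -> exists2 c, c < n & node c = j.
Proof.
move=> jn; have tn := theta_lt n2 jn; exists (n - (theta j).+1); first lia.
rewrite /node; have -> : n - (n - (theta j).+1).+1 = theta j by lia.
exact: thetaK.
Qed.

(** The term [maxn c 1] occurs because nodes 0 and 1 both act on columns 1 and 2; [theta] in [node]
    absorbs the opposite sign convention of column 1 for odd [n]. *)
Lemma lhi_llo_node c s : c < n ->
  lhi n (node c) s = ~~ cell s (maxn c 1).+1 /\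
  llo n (node c) s = (if c == 0 then cell s 1 else ~~ cell s c).
Proof.
move=> cn; rewrite /node /theta /lhi /llo /cell.
have n1 : (n - 2).+1 = n - 1 by lia.
have nF : n - 1 == n - 2 = false by lia.
case: (posnP c) => [->|c0].
  rewrite /= andbF negbK; case: (boolP (odd n)) => on /=.
    rewrite nF eqxx /pos n1 ifT ?n1 ?addbF; last lia.
    have -> : n - 1 == n = false by lia.
    by rewrite addbF.
  rewrite /pos; have -> : (n - 1).+1 = n by lia.
  by rewrite ltnn n1 eqxx addbT.
have -> : maxn c 1 = c by lia.
have -> : (c.+1 == 1) = false by lia.
rewrite andbF negbK.
case: (eqVneq c 1) => [->|c1].
  case: (boolP (odd n)) => on /=.
    rewrite eqxx /pos; have -> : (n - 1).+1 = n by lia.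
    by rewrite ltnn n1 eqxx addbT.
  rewrite /pos n1 ifT ?n1; last lia.
  have -> : n - 1 == n = false by lia.
  by rewrite addbF negbK.
rewrite andbF negbK.
have -> : n - c.+1 == n - 2 = false by lia.
have -> : n - c.+1 == n - 1 = false by lia.
rewrite if_same /pos ifT; last lia.
have -> : (n - c.+1).+1 = n - c by lia.
have -> : n - c == n = false by lia.
by rewrite addbF.
Qed.

Lemma pos_node c : c < n -> pos n (node c) = n - (maxn c 1).+1.
Proof.
move=> cn; rewrite /node /theta /pos.
have n1 : (n - 2).+1 = n - 1 by lia.
case: (odd n); do ?[case: eqP => ?]; case: ifP; lia.
Qed.

Lemma cell_flip c s d : c < n -> size s = n -> 0 < d <= n ->
  cell (flip n (node c) s) d = cell s d (+) ((d == maxn c 1) || (d == (maxn c 1).+1)).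
Proof.
move=> cn ss dn; rewrite /cell !nth_flip // pos_node //.
case: ifP => [/andP[_ /eqP ->]|_]; last rewrite -addNb; congr (_ (+) _); lia.
Qed.

Lemma eb_node c s : c < n ->
  eb n (node c) s = if c == 0 then cell s 1 && cell s 2 else ~~ cell s c && cell s c.+1.
Proof.
move=> cn; rewrite /eb; have [-> ->] := lhi_llo_node s cn; rewrite negbK.
by case: (posnP c) => [->|c0] /=; rewrite 1?andbC // (_ : maxn c 1 = c) //; lia.
Qed.

Lemma pb_node c s : c < n ->
  pb n (node c) s = if c == 0 then ~~ cell s 1 && ~~ cell s 2 else cell s c && ~~ cell s c.+1.
Proof.
move=> cn; rewrite /pb; have [-> ->] := lhi_llo_node s cn.
by case: (posnP c) => [->|c0] /=; rewrite 1?andbC // (_ : maxn c 1 = c) ?negbK //; lia.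
Qed.

(** So [fp] vanishes at a node exactly if columns [c] and [c.+1] are equally long or, for node 0, if
    the first two columns have as many cells as there are factors. *)
Lemma fp_node c b : c < n -> hw b ->
  ((fp (node c) b)%:Z = if c == 0%N then (size b)%:Z - (colh b 1)%:Z - (colh b 2)%:Z
                       else (colh b c)%:Z - (colh b c.+1)%:Z)%R.
Proof.
move=> cn hb; have := (hwP n2 _).1 hb _ (node_lt cn).
(* The difference of phi and epsilon is additive over the factors, while phi alone is not. *)
suff : ((fp (node c) b)%:Z - (ep (node c) b)%:Z =
  (if c == 0%N then (size b)%:Z - (colh b 1)%:Z - (colh b 2)%:Z
                       else (colh b c)%:Z - (colh b c.+1)%:Z))%R by move=> h e; rewrite e subr0 in h.
clear hb; elim: b => [|s b IH] /=; first by case: ifP.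
have : ((fp (node c) b + (pb n (node c) s - ep (node c) b))%N%:Z -
  (eb n (node c) s + ep (node c) b - pb n (node c) s)%N%:Z =
  (fp (node c) b)%:Z - (ep (node c) b)%:Z + (pb n (node c) s)%:Z - (eb n (node c) s)%:Z)%R.
  have := @ebpbF n (node c) s; case: eb => // h; rewrite ?(h isT); clear; lia.
move=> ->; rewrite IH eb_node // pb_node // /colh /=.
by case: ifP => _; do 2 case: (cell s _) => /=; clear; lia.
Qed.
End Columns.

(** * Columns of equal length *)

Section Blocks.
Variable n : nat.
Implicit Types (c d : nat).

Lemma iota_split c : 0 < c <= n -> iota 1 n = iota 1 c.-1 ++ c :: iota c.+1 (n - c).
Proof.
move=> cn; have -> : n = c.-1 + (n - c).+1 by lia.
by rewrite iotaD /=; congr (_ ++ _ :: _); [lia | congr iota; lia].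
Qed.

Lemma index_filter_iota (P : pred nat) c : 0 < c <= n -> P c ->
  index c [seq d <- iota 1 n | P d] = count P (iota 1 c.-1).
Proof.
move=> cn pc; rewrite (iota_split cn) filter_cat /= pc index_cat /= eqxx addn0 size_filter.
rewrite mem_filter mem_iota (_ : c < 1 + c.-1 = false) ?andbF //; lia.
Qed.

Variable D : nat -> nat.
Hypothesis Dmono : forall c, 0 < c < n -> D c.+1 <= D c.

Lemma mono_le (E : nat -> nat) c d : (forall c, 0 < c < n -> E c.+1 <= E c) ->
  0 < c -> c <= d -> d <= n -> E d <= E c.
Proof.
move=> Em c0; elim: d => [|d IH] cd dn; first lia.
case: (eqVneq c d.+1) => [->|ne]; first exact: leqnn.
have h1 : 0 < d < n by lia.
have h2 : c <= d by lia.
exact: leq_trans (Em d h1) (IH h2 (ltnW dn)).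
Qed.

Variable e : pred nat.
Hypothesis esorted : forall c, 0 < c < n -> D c = D c.+1 -> e c.+1 -> e c.

Lemma sorted_chain c d : 0 < c -> c <= d -> d <= n -> D c = D d -> e d -> e c.
Proof.
move=> c0; elim: d => [|d IH] cd dn; first lia.
case: (eqVneq c d.+1) => [->//|ne] Dd ed.
have d0 : 0 < d < n by lia.
have h1 := mono_le Dmono c0 (_ : c <= d) (_ : d <= n).
have h2 := Dmono d0.
apply: IH; [lia | lia | lia | apply: esorted => //; lia].
Qed.

(** By sortedness the columns satisfying [e] form an initial segment of each block of equal [D], so
    the rank of [c] in its block decides. *)
Lemma sorted_block c : 0 < c <= n ->
  e c = (count (fun d => D d == D c) (iota 1 c.-1) <
         count (fun d => (D d == D c) && e d) (iota 1 n)).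
Proof.
move=> cn; rewrite (iota_split cn) count_cat /= eqxx /=.
case ec: (e c).
  rewrite [X in _ < X + _](_ : _ = count (fun d => D d == D c) (iota 1 c.-1)); first by apply/esym; lia.
  apply: eq_in_count => d; rewrite mem_iota => dc; case: eqP => //= Dd.
  by apply: (@sorted_chain d c) => //; lia.
apply/esym/negbTE; rewrite -leqNgt add0n.
have -> : count (fun d => (D d == D c) && e d) (iota c.+1 (n - c)) = 0.
  apply/eqP; rewrite -leqn0 leqNgt -has_count; apply/hasPn => d; rewrite mem_iota => dc.
  apply/negP => /andP[/eqP Dd ed]; move: ec; rewrite (@sorted_chain c d) //; lia.
by rewrite addn0; apply: sub_count => d /andP[].
Qed.

Variables p q : pred nat.
Hypothesis Emono : forall c, 0 < c < n -> D c.+1 + p c.+1 + q c.+1 <= D c + p c + q c.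

Lemma pq_le c d : 0 < c -> c <= d -> d <= n -> D c = D d -> p d + q d <= p c + q c.
Proof.
by move=> c0 cd dn Dcd; have := mono_le Emono c0 cd dn; rewrite Dcd -!addnA leq_add2l.
Qed.

Section Block.
Variable c : nat.
Hypothesis cn : 0 < c <= n.
Hypothesis cnt : count (fun d => (D d == D c) && e d) (iota 1 n) =
                 count (fun d => (D d == D c) && q d) (iota 1 n).

(** By [pq_le] all earlier columns of the block satisfy [q] as well, so together with [c] they
    outnumber the rank of [c]. *)
Lemma new_double : p c -> q c -> e c.
Proof.
move=> pc qc; rewrite sorted_block // cnt (iota_split cn) count_cat /= eqxx qc /=.
rewrite [X in _ < X + _](_ : _ = count (fun d => D d == D c) (iota 1 c.-1)); first lia.
apply: eq_in_count => d; rewrite mem_iota => dc; case: eqP => //= Dd.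
have := @pq_le d c; rewrite Dd pc qc; case: (q d) => //; case: (p d) => /=; lia.
Qed.

(** Columns with both entries precede the free ones of their block; they contribute equally to the
    two sides of [sorted_block] and cancel, which leaves the Bender-Knuth comparison. *)
Lemma new_single : p c (+) q c ->
  e c = (count (fun d => (D d == D c) && (p d (+) q d)) (iota 1 c.-1) <
         count (fun d => (D d == D c) && (~~ p d && q d)) (iota 1 n)).
Proof.
move=> pq; rewrite sorted_block // cnt.
set both := fun d => (D d == D c) && (p d && q d).
have -> : count (fun d => (D d == D c) && q d) (iota 1 n) =
    count (fun d => (D d == D c) && (~~ p d && q d)) (iota 1 n) + count both (iota 1 n).
  rewrite -count_predUI [X in _ + X](_ : _ = 0) ?addn0; last first.
    by apply/eqP; rewrite -leqn0 leqNgt -has_count; apply/hasPn => d _ /=; rewrite /both; case: (D d == _); case: (p d); case: (q d).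
  by apply: eq_count => d /=; rewrite /both; case: (D d == _); case: (p d); case: (q d).
have -> : count both (iota 1 n) = count both (iota 1 c.-1).
  rewrite (iota_split cn) count_cat /=.
  have -> : count both (iota c.+1 (n - c)) = 0.
    apply/eqP; rewrite -leqn0 leqNgt -has_count; apply/hasPn => d; rewrite mem_iota => dc.
    apply/negP => /and3P[/eqP Dd pd qd]; have := @pq_le c d; rewrite Dd pd qd.
    by case: (p c) pq; case: (q c) => //= _; lia.
  by rewrite /both eqxx; case: (p c) pq; case: (q c) => //= _; rewrite !addn0.
have -> : count (fun d => D d == D c) (iota 1 c.-1) =
    count (fun d => (D d == D c) && (p d (+) q d)) (iota 1 c.-1) + count both (iota 1 c.-1).
  rewrite -count_predUI [X in _ + X](_ : _ = 0) ?addn0; last first.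
    by apply/eqP; rewrite -leqn0 leqNgt -has_count; apply/hasPn => d _ /=; rewrite /both; case: (D d == _); case: (p d); case: (q d).
  apply: eq_in_count => d; rewrite mem_iota => dc /=; rewrite /both; case: eqP => //= Dd.
  have := @pq_le d c; rewrite Dd; case: (p c) pq; case: (q c) => //= _; case: (p d); case: (q d) => //=; lia.
by rewrite ltn_add2r.
Qed.
End Block.
End Blocks.

Lemma head_filter_iota N (h : nat -> nat) r k : (forall k, h k <= h k.+1) -> h 0 = 0 ->
  0 < r -> 0 < k <= N ->
  (head 0 [seq k <- iota 1 N | r <= h k] == k) = (h k.-1 < r <= h k).
Proof.
move=> hm h0 r0 kN; have hle d : d <= k.-1 -> h d <= h k.-1.
  by move/(homo_leq (leqnn) leq_trans hm).
rewrite (iota_split kN) filter_cat.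
case E: [seq d <- iota 1 k.-1 | r <= h d] => [|d s] /=.
  have -> : h k.-1 < r.
    case: (posnP k.-1) => [->|k1]; first by rewrite h0.
    rewrite ltnNge; apply/negP => le.
    have : k.-1 \in [seq d <- iota 1 k.-1 | r <= h d] by rewrite mem_filter le mem_iota; lia.
    by rewrite E.
  case: ifP => /= _; first exact: eqxx.
  apply/negP => /eqP hd.
  (* The default 0 cannot be mistaken for [k], which is positive. *)
  have : head 0 [seq d <- iota k.+1 (N - k) | r <= h d] \in 0 :: iota k.+1 (N - k).
    case F: [seq d <- iota k.+1 (N - k) | r <= h d] => [|d s] /=; first by rewrite inE.
    have : d \in [seq d <- iota k.+1 (N - k) | r <= h d] by rewrite F inE eqxx.
    by rewrite mem_filter inE => /andP[_ ->]; rewrite orbT.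
  by rewrite hd inE mem_iota; lia.
have : d \in [seq d <- iota 1 k.-1 | r <= h d] by rewrite E inE eqxx.
rewrite mem_filter mem_iota => /andP[rd dk].
have -> : (d == k) = false by lia.
by have := hle d; lia.
Qed.

Lemma iota1 n : 0 < n -> iota 1 n = 1 :: iota 2 n.-1.
Proof. by case: n. Qed.

Lemma iota12 n : 1 < n -> iota 1 n = [:: 1, 2 & iota 3 n.-2].
Proof. by case: n => [|[]]. Qed.

(** * The rule for tableaux of type 2 *)

Section Type2.
Variables (n i : nat) (x : seq (seq nat)) (D : nat -> nat) (p q : pred nat).
Implicit Types (r c d : nat).
Let E c := D c + p c + q c.
Hypothesis n2 : 2 <= n.
Hypothesis i0 : 0 < i.
Hypothesis ent_i : forall r c, 0 < r -> 0 < c <= n -> (entry x r c == i) = (D c < r <= D c + p c).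
Hypothesis ent_i1 : forall r c, 0 < r -> 0 < c <= n ->
  (entry x r c == i.+1) = (D c + p c < r <= E c).
Hypothesis EN : forall c, 0 < c <= n -> E c <= size x.
Hypothesis Dmono : forall c, 0 < c < n -> D c.+1 <= D c.
Hypothesis Pmono : forall c, 0 < c < n -> D c.+1 + p c.+1 <= D c + p c.
Hypothesis Emono : forall c, 0 < c < n -> D c.+1 + p c.+1 + q c.+1 <= D c + p c + q c.
Hypothesis D12 : D 1 + D 2 <= i.-1.
Hypothesis col1 : Defs.col (nth [::] x i) 1 = E 1.
Hypothesis col2 : Defs.col (nth [::] x i) 2 = E 2.
Hypothesis t2 : type2 n i x.
Let L := lastrow n i x.

Lemma inSE r c : 0 < r -> 0 < c <= n -> inS n i x r c = (D c < r <= E c).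
Proof. by move=> r0 cn; rewrite /inS r0 cn ent_i // ent_i1 //= /E; lia. Qed.

Lemma le_lastrow c : 0 < c <= n -> D c < E c -> E c <= L.
Proof.
move=> cn DE; have e0 : 0 < E c by lia.
have : E c \in [seq r <- iota 1 (size x) | has (inS n i x r) (iota 1 n)].
  rewrite mem_filter mem_iota; apply/andP; split; last by have := EN cn; lia.
  by apply/hasP; exists c; [rewrite mem_iota; lia | rewrite inSE //; lia].
rewrite /L /lastrow; elim: [seq _ <- _ | _] => //= r s IH.
by rewrite inE => /orP[/eqP ->|/IH]; lia.
Qed.

Lemma freeE r c : 0 < r -> 0 < c <= n ->
  Defs.free n i x r c = (D c < r <= E c) && (p c (+) q c).
Proof.
move=> r0 cn; rewrite /Defs.free inSE //; case: (boolP (D c < r <= E c)) => //= rc.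
have Ec : E c = D c + p c + q c by [].
have := EN cn => ec.
case pq: (p c (+) q c); last first.
  have [pc qc] : p c /\ q c by case: (p c) pq Ec; case: (q c) => //= _; lia.
  rewrite pc qc /= in Ec.
  apply/negbTE/allPn; case: (eqVneq r (D c).+1) => rD.
    by exists (D c).+2; rewrite ?mem_iota ?inSE //; lia.
  by exists (D c).+1; rewrite ?mem_iota ?inSE //; lia.
apply/allP => r'; rewrite mem_iota => r1; rewrite inSE; [|lia|lia].
by case: (p c) pq Ec; case: (q c) => //= _; lia.
Qed.

Lemma two_free : exists c d, [/\ 0 < c, c < d, d <= n, Defs.free n i x L c & Defs.free n i x L d] /\
  entry x L d == i.+1 /\ 0 < L.
Proof.
case/and3P: t2 => h1 _ _; move: h1; rewrite -/L -size_filter.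
have srt : sorted ltn [seq c <- freecells n i x L | entry x L c == i.+1].
  by apply/(sorted_filter ltn_trans)/(sorted_filter ltn_trans)/iota_ltn_sorted.
case F: [seq _ <- _ | _] srt => [|c [|d s]] //= /andP[cd _] _.
have: c \in [:: c, d & s] by rewrite inE eqxx.
have: d \in [:: c, d & s] by rewrite !inE eqxx orbT.
rewrite -F !mem_filter !mem_iota => /and3P[e1 f1 d1] /and3P[e2 f2 d2].
exists c, d; split; first by split => //; lia.
by split=> //; case/andP: f1 => /andP[].
Qed.

(** A free [i.+1] in row [L] and a column [d >= 2] gives [D 2 >= L - 1], while no cell lies below
    row [L]. As the first two columns gain at least two cells in all, each gains exactly one, in row
    [L]. An [i] in column 2 would force another one in column 1, against the bound on entries
    [i]. *)
Lemma type2_facts : [/\ D 1 = L.-1, D 2 = L.-1, 0 < L & D 1 + D 2 = i.-1] /\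
  p 2 = false /\ p 1 (+) q 1.
Proof.
have [c [d [[c0 cd dn fc fd] [ed L0]]]] := two_free.
have dn' : 0 < d <= n by lia. have n1 : 0 < 1 <= n by lia. have n2' : 0 < 2 <= n by lia.
rewrite ent_i1 // in ed; rewrite freeE // in fd.
have Dd : D d = L.-1.
  by case/andP: fd; rewrite /E in ed *; case: (p d) ed; case: (q d) => //=; lia.
have D2d : D d <= D 2 by apply: (mono_le Dmono); lia.
have D21 : D 2 <= D 1 by apply: Dmono; lia.
have e12 : E 1 + E 2 = i.+1 by case/and3P: t2 => _ _; rewrite col1 col2 => /eqP.
have l1 := le_lastrow n1; have l2 := le_lastrow n2'.
have E1 : E 1 = D 1 + p 1 + q 1 by []. have E2 : E 2 = D 2 + p 2 + q 2 by [].
clear fd fc ed.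
have D1 : D 1 = L.-1.
  by move: l1 l2 E1 E2; case: (p 1); case: (q 1); case: (p 2); case: (q 2) => /=; lia.
have D2 : D 2 = L.-1 by lia.
split; first by split => //; move: l1 l2 E1 E2; case: (p 1); case: (q 1); case: (p 2); case: (q 2) => /=; lia.
split; last first.
  by move: l1 l2 E1 E2; case: (p 1); case: (q 1); case: (p 2); case: (q 2) => //=; lia.
apply/negP => p2; have p1 : p 1.
  by have := Pmono (c := 1); rewrite p2; case: (p 1) => //=; lia.
case/and3P: t2 => _ + _; rewrite -/L.
rewrite iota12 //= !inSE // !ent_i // p1 p2 E1 E2 p1 p2; lia.
Qed.

Variable e : pred nat.
Hypothesis esorted : forall c, 0 < c < n -> D c = D c.+1 -> e c.+1 -> e c.
Hypothesis ekill : ~~ (e 1 && e 2).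
Hypothesis ecount : forall h, h != D 1 ->
  count (fun d => (D d == h) && e d) (iota 1 n) = count (fun d => (D d == h) && q d) (iota 1 n).
Hypothesis eodd : odd (count (fun d => (D d == D 1) && e d) (iota 1 n)) =
  odd (count (fun d => (D d == D 1) && q d) (iota 1 n)).

Lemma block1 (s : pred nat) : (forall c, 1 < c <= n -> D c = D 1 -> s c = false) ->
  count (fun d => (D d == D 1) && s d) (iota 1 n) = s 1.
Proof.
move=> h; rewrite iota1; last lia.
rewrite /= eqxx /= [X in _ + X](_ : _ = 0) ?addn0 //.
apply/eqP; rewrite -leqn0 leqNgt -has_count; apply/hasPn => c; rewrite mem_iota => cn.
by apply/negP => /andP[/eqP Dc]; rewrite h //; lia.
Qed.

(** A column with [D c = L - 1] holds at most one new cell, which is then free, and the free cells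
    of row [L] all lie in such columns; among these, only column 1 can contain [i]. *)
Lemma size_freecells_last : size (freecells n i x L) = p 1 + count (fun d => (D d == D 1) && q d) (iota 1 n).
Proof.
have [[D1 D2 L0 D12'] [p2 _]] := type2_facts.
have pF c : 1 < c <= n -> D c = D 1 -> p c = false.
  move=> cn Dc; have : D c + p c <= D 2 + p 2 by apply: (mono_le (E := fun c => D c + p c) Pmono); lia.
  by rewrite p2 Dc D1 D2; case: (p c) => //=; lia.
rewrite /freecells size_filter -(block1 pF) -count_predUI addnC.
rewrite [X in _ = X + _](_ : _ = 0) ?add0n; last first.
  apply/eqP; rewrite -leqn0 leqNgt -has_count; apply/hasPn => c; rewrite mem_iota => cn /=.
  have cn' : 0 < c <= n by lia.
  have := le_lastrow cn'; rewrite /E; case: eqP => //= ->; rewrite D1.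
  by case: (p c); case: (q c) => //=; lia.
apply: eq_in_count => c; rewrite mem_iota => cn /=.
have cn' : 0 < c <= n by lia.
rewrite freeE //; have := le_lastrow cn'; rewrite /E D1; case: eqP => [->|ne];
  case: (p c); case: (q c) => //=; lia.
Qed.

Lemma last_block c : 1 < c <= n -> D c = D 1 -> p c = false /\ e c = false.
Proof.
move=> cn Dc; have [[D1 D2 L0 D12'] [p2 _]] := type2_facts.
have : D c + p c <= D 2 + p 2 by apply: (mono_le (E := fun c => D c + p c) Pmono); lia.
rewrite p2 Dc D1 D2 => pc; split; first by move: pc; clear; case: (p c) => //=; lia.
have D21 : D 1 = D 2 by rewrite D1 D2.
apply/negP => ec; have e2 : e 2.
  have D2c : D 2 = D c by rewrite Dc D21.
  have [c2 cn'] := andP cn.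
  exact: (sorted_chain Dmono esorted (isT : 0 < 2) c2 cn' D2c ec).
by move: ekill; rewrite e2 (esorted (c := 1) _ D21 e2) //; lia.
Qed.

(** In the block of the first columns sortedness and [ekill] leave at most [e 1], so [e 1] is the
    parity of the former [i.+1]s. Hence [p 1] and [e 1] differ exactly when the number of free cells
    is odd. *)
Lemma newentry_last c : 0 < c <= n -> D c < L <= E c -> newentry n i x L c =
  if L <= D c + e c then i else i.+1.
Proof.
move=> cn rc; have [[D1 D2 L0 D12'] [p2 pq1]] := type2_facts.
rewrite /newentry inSE // rc /= eqxx /=.
have ei := ent_i L0 cn; have ei1 := ent_i1 L0 cn.
have n1 : 0 < 1 <= n by rewrite (ltnW n2).
have -> : firstcell n i x L = 1.
  rewrite /firstcell iota1 /=; last exact: ltnW n2.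
  rewrite inSE // /E D1; case: (p 1) pq1; case: (q 1) => //= _; rewrite ifT //; clear -L0; lia.
case: (eqVneq c 1) => [c1|c1] /=; last first.
  have -> : entry x L c = i.+1.
    apply/eqP; rewrite ei1; case/andP: rc => rc1 rc2; rewrite rc2 andbT.
    have Ec : E c = D c + p c + q c by [].
    case: (eqVneq (D c) (D 1)) => Dc.
      have [|-> _] := last_block (c := c) _ Dc; first by clear -cn c1; lia.
      by rewrite addn0.
    move: Ec rc1 rc2 Dc; rewrite D1; clear; case: (p c); case: (q c) => //=; lia.
  case: ifP => // h; exfalso; case: (eqVneq (D c) (D 1)) => Dc.
    have [|_ ec] := last_block (c := c) _ Dc; first by clear -cn c1; lia.
    by move: h rc; rewrite ec; clear; lia.
  move: h rc Dc; rewrite D1; clear -L0; case: (e c) => /=; lia.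
subst c; have := eodd; rewrite -/L size_freecells_last oddD.
rewrite (block1 (s := e)); last by move=> c cn' Dc; case: (last_block cn' Dc).
move=> <-; rewrite D1; case p1: (p 1) ei ei1 pq1 => /=.
  rewrite D1 => /esym; have -> : L.-1 < L <= L.-1 + 1 by clear -L0; lia.
  move=> /esym/eqP -> _ _; rewrite /toggle eqxx; case: (e 1) => /=; case: ifP => //; clear -L0; lia.
rewrite D1 addn0 => _ + q1; have -> : L.-1 < L <= E 1 by rewrite /E D1 p1 q1; clear -L0; lia.
move=> /eqP ->; rewrite /toggle (gtn_eqF (ltnSn i)); case: (e 1) => /=; case: ifP => //; clear -L0; lia.
Qed.

(** A column with [D c = L - 1] has new cells in row [L] only, so another row meets only blocks
    where [ecount] is an equality; there [new_double] and [new_single] apply. *)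
Lemma newentry_upper r c : 0 < r -> 0 < c <= n -> D c < r <= E c -> r != L ->
  newentry n i x r c = if r <= D c + e c then i else i.+1.
Proof.
move=> r0 cn rc rL; have [[D1 D2 L0 D12'] _] := type2_facts.
have ei := ent_i r0 cn; have ei1 := ent_i1 r0 cn.
have le : E c <= L by apply: le_lastrow => //; lia.
have Ec : E c = D c + p c + q c by [].
have ent : entry x r c = if r <= D c + p c then i else i.+1.
  case: ifP => h; apply/eqP; rewrite ?ei ?ei1; clear -h rc; lia.
have Dc : D c != D 1 by rewrite D1; clear -rc le rL L0; lia.
have cnt := ecount Dc.
rewrite /newentry inSE // rc /= rL freeE // rc /=.
case: ifP => pq; last first.
  have [pc qc] : p c /\ q c.
    by move: pq Ec rc; clear; case: (p c); case: (q c) => //= _; lia.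
  by rewrite ent pc (new_double Dmono esorted Emono cn cnt pc qc).
have rD : r = (D c).+1 by move: pq Ec rc; clear; case: (p c); case: (q c) => //= _; lia.
(* A free cell lies immediately below [D], so the free cells of row [r] are the singly filled
   columns of one block. *)
have frE d : 0 < d <= n -> Defs.free n i x r d = (D d == D c) && (p d (+) q d).
  move=> dn; rewrite freeE // /E rD; clear; case: (p d); case: (q d) => //=; rewrite ?andbF ?andbT //; lia.
rewrite /bk_entry /freecells index_filter_iota //; last by rewrite frE // eqxx.
rewrite count_filter (new_single Dmono esorted Emono cn cnt pq) rD.
rewrite (eq_in_count (a2 := fun d => (D d == D c) && (p d (+) q d))); last first.
  by move=> d; rewrite mem_iota -rD => dn; rewrite frE //; clear -dn cn; lia.
rewrite [X in _ < X](eq_in_count (a2 := fun d => (D d == D c) && (~~ p d && q d))); last first.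
  move=> d; rewrite mem_iota -rD /= => dn; have dn' : 0 < d <= n by clear -dn; lia.
  rewrite frE // ent_i1 // rD /E; clear; case: (p d); case: (q d) => //=; rewrite ?andbF ?andbT //; lia.
by case: (_ < _) => /=; rewrite ?addn1 ?addn0 ?leqnn ?ltnn.
Qed.

Lemma newentryE r c : 0 < r -> 0 < c <= n -> newentry n i x r c =
  if D c < r <= E c then (if r <= D c + e c then i else i.+1) else entry x r c.
Proof.
move=> r0 cn; case: ifP => rc; last by rewrite /newentry inSE // rc.
by case: (eqVneq r L) => [rL|/newentry_upper -> //]; subst r; apply: newentry_last.
Qed.
End Type2.

(** * From tensors to tableaux *)

Section Tableaux.
Variable n : nat.
Hypothesis n2 : 2 <= n.
Implicit Types (a b l : tens) (s y : seq bool) (c d r k : nat).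

Lemma inT_hw b k : wf n b -> inT n b -> k <= size b -> hw n (take k b).
Proof.
move=> wb ib; elim: k => [|k IH] kb; first by rewrite take0.
have wt m : wf n (take m b) by apply/allP => s /mem_take; apply: (allP wb).
have E : take k.+1 b = take k b ++ [:: nth [::] b k] by rewrite (take_nth [::] kb) cats1.
rewrite E; apply: (dominant_hw n2); rewrite -?E //; first exact/IH/ltnW.
by apply: (allP ib); rewrite mem_iota; lia.
Qed.

Lemma colh_cat a b c : colh n (a ++ b) c = colh n a c + colh n b c.
Proof. by rewrite /colh count_cat. Qed.

Lemma size_chain b : size (chain n b) = size b.
Proof. by rewrite size_map size_iota. Qed.

Lemma nth_chain b k : k < size b -> nth [::] (chain n b) k = diag n (take k.+1 b).
Proof. by move=> kb; rewrite (nth_map 0) ?size_iota // nth_iota. Qed.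

Lemma entry_chain b r c : 0 < c <= n ->
  entry (chain n b) r c = head 0 [seq k <- iota 1 (size b) | r <= colh n (take k b) c].
Proof.
move=> cn; rewrite /entry size_chain; congr (head 0 _); apply: eq_in_filter => k.
by rewrite mem_iota => kb; rewrite nth_chain ?(col_diag n2) ?prednK //; lia.
Qed.

Lemma colh_take_mono b c k : colh n (take k b) c <= colh n (take k.+1 b) c.
Proof.
case: (ltnP k (size b)) => kb; last by rewrite !take_oversize // ltnW.
by rewrite (take_nth [::] kb) -cats1 colh_cat leq_addr.
Qed.

Lemma entry_eq b r c k : 0 < r -> 0 < c <= n -> 0 < k <= size b ->
  (entry (chain n b) r c == k) = (colh n (take k.-1 b) c < r <= colh n (take k b) c).
Proof.
move=> r0 cn kb; rewrite entry_chain //.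
apply: (@head_filter_iota (size b) (fun k => colh n (take k b) c)) => // [m|].
  exact: colh_take_mono.
by rewrite take0.
Qed.

Lemma colh_size b c : colh n b c <= size b.
Proof. exact: count_size. Qed.

Lemma hw_colh a c : c < n -> hw n a ->
  if c == 0 then colh n a 1 + colh n a 2 <= size a else colh n a c.+1 <= colh n a c.
Proof. by move=> cn ha; have := fp_node n2 cn ha; case: eqP => _; lia. Qed.

Lemma count_iota_swap (s s' : pred nat) c : 0 < c < n -> ~~ s c -> s c.+1 -> s' c -> ~~ s' c.+1 ->
  (forall d, 0 < d <= n -> d != c -> d != c.+1 -> s d = s' d) -> count s (iota 1 n) = count s' (iota 1 n).
Proof.
move=> cn h1 h2 h3 h4 h.
have -> : iota 1 n = iota 1 c.-1 ++ [:: c, c.+1 & iota c.+2 (n - c.+1)].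
  rewrite (@iota_split n c); last lia.
  by rewrite (_ : n - c = (n - c.+1).+1) //; lia.
rewrite !count_cat /= h2 h3 (negPf h1) (negPf h4) !add0n.
by congr (_ + (_ + _)); apply: eq_in_count => d; rewrite mem_iota => dn; apply: h; lia.
Qed.

Section Straight.
Variables (a : tens) (y : seq bool).
Hypotheses (ha : hw n a) (D12 : colh n a 1 = colh n a 2).
Local Notation D := (colh n a).
Local Notation cnt h s := (count (fun d => (D d == h) && cell n s d) (iota 1 n)).

(* Only the parity is preserved in the first columns, where pairs cancel. *)
Definition same_blocks s := forall h, odd (cnt h s) = odd (cnt h y) /\ (h != D 1 -> cnt h s = cnt h y).

(** A node [c > 0] with [fp = 0] moves a cell inside a block. Node 0 removes one cell from each of
    columns 1 and 2, and these lie in the same block because [D 1 = D 2]. *)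
Lemma same_blocks_step j s : j < n -> size s = n -> fp n j a = 0 -> eb n j s ->
  same_blocks s -> same_blocks (flip n j s).
Proof.
move=> jn ss fj ej sb h; have [c cn jc] := node_surj n2 jn; subst j.
move: ej; rewrite (eb_node n2 _ cn); have := fp_node n2 cn ha; rewrite fj.
have cf d : 0 < d <= n -> cell n (flip n (node n c) s) d = cell n s d (+) ((d == maxn c 1) || (d == (maxn c 1).+1)).
  by move=> dn; apply: cell_flip.
case: (posnP c) => [c0 _ /andP[s1 s2]|c0 fc /andP[s1 s2]]; last first.
  have Dc : D c = D c.+1 by lia.
  have mc : maxn c 1 = c by lia.
  rewrite mc in cf.
  suff -> : cnt h (flip n (node n c) s) = cnt h s by apply: sb.
  case: (eqVneq (D c) h) => Dh; last first.
    apply: eq_in_count => d; rewrite mem_iota => dn; case: eqP => //= Ddh.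
    rewrite cf; last lia.
    case: (eqVneq d c) => [E|_]; first by subst d; rewrite Ddh eqxx in Dh.
    case: (eqVneq d c.+1) => [E|_]; first by subst d; rewrite Dc Ddh eqxx in Dh.
    by rewrite addbF.
  apply/esym; apply: (@count_iota_swap _ _ c); first lia.
  - by rewrite (negPf s1) andbF.
  - by rewrite -Dc Dh eqxx.
  - by rewrite Dh eqxx cf ?(negPf s1) ?eqxx //=; lia.
  - by rewrite cf ?s2 ?eqxx ?orbT ?andbF //=; lia.
  - move=> d dn dc dc1; rewrite cf // (negPf dc) (negPf dc1) addbF //.
have n12 := iota12 n2.
have rest : count (fun d => (D d == h) && cell n (flip n (node n c) s) d) (iota 3 n.-2) =
    count (fun d => (D d == h) && cell n s d) (iota 3 n.-2).
  apply: eq_in_count => d; rewrite mem_iota => dn; rewrite cf ?c0; last lia.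
  by rewrite (gtn_eqF (_ : 1 < d)) ?(gtn_eqF (_ : 2 < d)) ?addbF //; lia.
have c1 := cf 1 (ltnW n2); have c2 := cf 2 n2; rewrite c0 in rest c1 c2 *.
have := sb h; rewrite n12 /= rest c1 c2.
by rewrite s1 s2 -D12; case: (eqVneq (D 1) h) => [_|_] //=; rewrite negbK => -[-> _].
Qed.
End Straight.
End Tableaux.

Theorem theoremC (n N i : nat) (nu : seq nat) (x : seq (seq nat)) :
  2 <= n -> 0 < i < N ->
  SYD n N nu -> SSSYT n nu N x -> type2 n i x ->
  forall b : seq (seq bool),
    size b = N -> all (fun s => size s == n) b -> inT n b -> chain n b = x ->
    forall r c, 0 < r -> 0 < c <= n ->
      entry (chain n (T n i b)) r c = newentry n i x r c.
Proof.
move=> n2 /andP[i0 iN] _ _ t2 b sb wb tb xb r c r0 cn.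
have [y0 [y1 y2]] : exists y0 y1 : seq bool, nth [::] b i.-1 = y0 /\ nth [::] b i = y1.
  by do 2 eexists.
case: y2 => E0 E1; set a := take i.-1 b; set l := drop i.+1 b.
have Eb : b = a ++ y0 :: y1 :: l.
  rewrite -E0 -E1 /a /l -{1}(cat_take_drop i.-1 b); congr (_ ++ _).
  by rewrite (drop_nth [::]) ?prednK ?(drop_nth [::] (_ : i < size b)) //; lia.
have sa : size a = i.-1 by rewrite size_take; case: ltnP; lia.
have hwk k : k <= N -> hw n (take k b) by move=> kN; apply: (inT_hw n2 wb tb); rewrite sb.
have ha : hw n a by apply: hwk; lia.
have ti : take i b = a ++ [:: y0].
  by rewrite -{1}(prednK i0) (take_nth [::]) ?E0 ?cats1 //; lia.
have ti1 : take i.+1 b = a ++ [:: y0; y1].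
  by rewrite (take_nth [::]) ?sb // ti E1 -cats1 -catA.
have hay : hw n (a ++ [:: y0]) by rewrite -ti; apply: hwk; lia.
have hayy : hw n (a ++ [:: y0; y1]) by rewrite -ti1; apply: hwk.
pose D d := colh n a d; pose p d := cell n y0 d; pose q d := cell n y1 d.
have H1 d : colh n (take i b) d = D d + p d by rewrite ti colh_cat /D /p /colh /= addn0.
have H2 d : colh n (take i.+1 b) d = D d + p d + q d.
  by rewrite ti1 colh_cat /D /p /q /colh /= addn0 addnA.
have e_i r' d : 0 < r' -> 0 < d <= n -> (entry x r' d == i) = (D d < r' <= D d + p d).
  by move=> r0' dn; rewrite -xb (entry_eq n2) ?sb ?H1 //; lia.
have e_i1 r' d : 0 < r' -> 0 < d <= n -> (entry x r' d == i.+1) = (D d + p d < r' <= D d + p d + q d).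
  by move=> r0' dn; rewrite -xb (entry_eq n2) ?sb ?H1 ?H2 //; lia.
have EN d : 0 < d <= n -> D d + p d + q d <= size x.
  by move=> dn; rewrite -H2 -xb size_chain; apply: leq_trans (colh_size _ _ _) _; rewrite size_take; case: ltnP; lia.
have mono k : k <= N -> forall d, 0 < d < n -> colh n (take k b) d.+1 <= colh n (take k b) d.
  by move=> kN d dn; have := hw_colh n2 (_ : d < n) (hwk k kN); case: eqP; lia.
have Dm : forall d, 0 < d < n -> D d.+1 <= D d by apply: mono; lia.
have Pm : forall d, 0 < d < n -> D d.+1 + p d.+1 <= D d + p d.
  by move=> d dn; rewrite -!H1; apply: mono => //; lia.
have Em : forall d, 0 < d < n -> D d.+1 + p d.+1 + q d.+1 <= D d + p d + q d.
  by move=> d dn; rewrite -!H2; apply: mono.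
have D12 : D 1 + D 2 <= i.-1.
  by have := hw_colh n2 (_ : 0 < n) ha; rewrite eqxx sa; apply; lia.
have nx d : 0 < d <= n -> Defs.col (nth [::] x i) d = D d + p d + q d.
  by move=> dn; rewrite -xb nth_chain ?sb // (col_diag n2) // H2.
have n1 : 0 < 1 <= n by rewrite (ltnW n2).
(* This equality makes [fp] vanish at [node n 0], so the final letter cannot fill both of the first
   two columns. *)
have [[_ _ _ D12'] _] := type2_facts n2 i0 e_i e_i1 EN Dm Pm D12 (nx 1 n1) (nx 2 n2) t2.
have [D1 D2 _ _] := (type2_facts n2 i0 e_i e_i1 EN Dm Pm D12 (nx 1 n1) (nx 2 n2) t2).1.
have D1D2 : colh n a 1 = colh n a 2 by rewrite -/(D 1) -/(D 2) D1 D2.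
have wb' : wf n (a ++ y0 :: y1 :: l) by rewrite -Eb.
have [s [z [ET [ss sz] Qs ts gs]]] := T_local n2 wb' hayy (Q := same_blocks n a y1)
  (fun h => conj erefl (fun _ => erefl)) (@same_blocks_step n n2 a y1 ha D1D2).
pose e d := cell n s d.
have node0 d : d < n -> (if d == 0 then D 1 + D 2 = i.-1 else D d = D d.+1) ->
    fp n (node n d) a = 0.
  move=> dn h; have := fp_node n2 dn ha; rewrite sa.
  by case: eqP h => _ h; rewrite -?/(D _) ?h; [move: h; clear; lia | clear; lia].
have es d : 0 < d < n -> D d = D d.+1 -> e d.+1 -> e d.
  case/andP=> d0 dn Dd; have := ts _ (node_lt n2 dn) (node0 d dn _).
  rewrite (eb_node n2 _ dn) (gtn_eqF d0) => /(_ Dd); rewrite /e.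
  by case: (cell n s d) => // /= ->.
have ek : ~~ (e 1 && e 2).
  by have := ts _ (node_lt n2 (ltnW n2)) (node0 0 (ltnW n2) D12'); rewrite (eb_node n2 _ (ltnW n2)) /= /e => ->.
have ec h : h != D 1 -> count (fun d => (D d == h) && e d) (iota 1 n) =
    count (fun d => (D d == h) && q d) (iota 1 n).
  by case: (Qs h) => _; apply.
have eo : odd (count (fun d => (D d == D 1) && e d) (iota 1 n)) =
    odd (count (fun d => (D d == D 1) && q d) (iota 1 n)) by case: (Qs (D 1)).
rewrite (newentryE n2 i0 e_i e_i1 EN Dm Pm Em D12 (nx 1 n1) (nx 2 n2) t2 es ek ec eo) //.
have sa' : (size a).+1 = i by rewrite sa prednK.
rewrite sa' -Eb in ET.
have sT : size (T n i b) = N by rewrite ET -sb Eb !size_cat.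
have K0 : colh n (take i.-1 (T n i b)) c = D c by rewrite ET take_size_cat.
have K1 : colh n (take i (T n i b)) c = D c + e c.
  rewrite ET take_cat ifF; last by rewrite sa; clear -i0; lia.
  have -> : i - size a = 1 by rewrite sa; clear -i0; lia.
  by rewrite /= ?take0 colh_cat /D /e /colh /= addn0.
(* Only the sum of the two new letters is known; it fixes the column lengths after [i.+1] factors,
   which is enough. *)
have cell2 : e c + cell n z c = p c + q c.
  rewrite /e /p /q /cell; case: ifP => _; first by apply: gs; clear -n2; lia.
  have := gs (n - c) _; clear -cn n2; do 4 case: nth => //=; lia.
have K2 k : i < k -> colh n (take k (T n i b)) c = colh n (take k b) c.
  move=> ik; rewrite ET [in RHS]Eb !take_cat !ifF; [|rewrite sa; clear -i0 ik; lia..].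
  have [m ->] : exists m, k - size a = m.+2 by exists (k - i.+1); rewrite sa; clear -i0 ik; lia.
  rewrite !colh_cat; congr (_ + _); rewrite /colh /= !addnA; congr (_ + _).
  exact: cell2.
have K3 k : k < i -> colh n (take k (T n i b)) c = colh n (take k b) c.
  by move=> ki; rewrite ET [in RHS]Eb !takel_cat // sa; clear -i0 ki; lia.
case: ifP => rc.
  apply/eqP; case: ifP => re.
    by rewrite (entry_eq n2) ?sT ?K0 ?K1 ?re ?andbT //; clear -rc i0 iN; lia.
  by rewrite (entry_eq n2) ?sT //= K1 K2 // H2; clear -rc re iN; lia.
rewrite -xb !(entry_chain n2) // sT sb; congr (head 0 _); apply: eq_in_filter => k _.
case: (ltngtP k i) => [/K3 -> //|/K2 -> //|->].
(* Outside the skew shape [r] is at most [D c] or exceeds the column length after [i.+1] factors, so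
   replacing [p c] by [e c] does not affect the comparison at [k = i]. *)
by rewrite K1 H1; move: cell2 rc; clear; lia.
Qed.
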